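(* Consider CTL separation: given finite sets $\mathit{P}$ and $\mathit{N}$ of finite pointed Kripke structures over propositions $\Sigma$, and a regular tree grammar $\mathcal{G}$ over syntax trees of CTL formulas, synthesize a CTL formula $\varphi\in L(\mathcal{G})$ true in every structure of $\mathit{P}$ and false in every structure of $\mathit{N}$, or declare none exists. This problem is decidable in time $\mathcal{O}(2^{\mathrm{poly}(mn^2)}\cdot|\mathcal{G}|)$, where $m=|\mathit{P}|+|\mathit{N}|$ and $n=\max_{G\in\mathit{P}\cup\mathit{N}}|G|$.
   Context: CTL formulas: $\varphi::=a\in\Sigma\mid\varphi\vee\varphi'\mid\neg\varphi\mid\mathsf{EG}\varphi\mid\mathsf{E}(\varphi\,\mathsf{U}\,\varphi')\mid\mathsf{EX}\varphi$, as syntax trees over the corresponding ranked alphabet. A finite pointed Kripke structure is $G=(W,s,E,P)$ with finite nodes $W$, start $s$, edges $E$, labeling $P:W\to\mathcal{P}(\Sigma)$. Semantics at node $w$: $a$ holds iff $a\in P(w)$; $\vee,\neg$ as usual; $G,w\models\mathsf{EX}\varphi$ iff some $E$-successor $w'$ satisfies $\varphi$; $\mathsf{EG}\varphi$ denotes the greatest fixpoint of $X\mapsto[\![\varphi]\!]\cap\{w:\exists w'\in X.\,E(w,w')\}$; $\mathsf{E}(\varphi\mathsf{U}\psi)$ denotes the least fixpoint of $X\mapsto[\![\psi]\!]\cup([\![\varphi]\!]\cap\{w:\exists w'\in X.\,E(w,w')\})$. $G\models\varphi$ iff $G,s\models\varphi$. $L(\mathcal{G})$ is the tree language of the regular tree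 grammar, $|\mathcal{G}|$ its size, $|G|$ the size of a structure. *)

(* Defs.v *)
From Stdlib Require List.
From Stdlib Require Import Relation_Operators.
From mathcomp Require Import all_boot all_algebra.

Set Implicit Arguments.
Unset Strict Implicit.
Unset Printing Implicit Defensive.

(** * CTL *)

(* [tree Sigma V] is T_Gamma(V): trees over the ranked alphabet Gamma of CTL
   (propositions of rank 0; Not, EG, EX of rank 1; Or, EU of rank 2) with
   leaves that may also be taken from V. *)
Inductive tree (Sigma V : Type) : Type :=
| Var (x : V)
| Atom (a : Sigma)
| Or (t u : tree Sigma V)
| Not (t : tree Sigma V)
| EG (t : tree Sigma V)
| EU (t u : tree Sigma V)
| EX (t : tree Sigma V).

Arguments Var {Sigma V} x.
Arguments Atom {Sigma V} a.

Definition ctl (Sigma : Type) : Type := tree Sigma void.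

Fixpoint tree_map (Sigma V V' : Type) (f : V -> V') (t : tree Sigma V) :
    tree Sigma V' :=
  match t with
  | Var x => Var (f x)
  | Atom a => Atom a
  | Or t u => Or (tree_map f t) (tree_map f u)
  | Not t => Not (tree_map f t)
  | EG t => EG (tree_map f t)
  | EU t u => EU (tree_map f t) (tree_map f u)
  | EX t => EX (tree_map f t)
  end.

Fixpoint tree_size (Sigma V : Type) (t : tree Sigma V) : nat :=
  match t with
  | Var _ | Atom _ => 1
  | Not t | EG t | EX t => (tree_size t).+1
  | Or t u | EU t u => (tree_size t + tree_size u).+1
  end.

Record kripke (Sigma : finType) : Type := Kripke {
  node : finType;
  start : node;
  edge : rel node;
  label : node -> {set Sigma}
}.

Arguments start {Sigma} k.
Arguments edge {Sigma} k.
Arguments label {Sigma} k.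

(* The bounds of this file are nondecreasing in the size of a structure, so
   they are strongest for this least of the usual measures. *)
Definition kripke_size (Sigma : finType) (K : kripke Sigma) : nat := #|node K|.

Definition pre (Sigma : finType) (K : kripke Sigma) (X : {set node K}) :
    {set node K} :=
  [set w | [exists w' in X, edge K w w']].

(* [fixset] and [cofixset] are the least and greatest fixpoints here, because
   both operators are monotone. *)
Fixpoint sem (Sigma : finType) (K : kripke Sigma) (phi : ctl Sigma) :
    {set node K} :=
  match phi with
  | Var x => match x with end
  | Atom a => [set w | a \in label K w]
  | Or f g => sem K f :|: sem K g
  | Not f => ~: sem K f
  | EG f => cofixset (fun X => sem K f :&: pre X)
  | EU f g => fixset (fun X => sem K g :|: (sem K f :&: pre X))
  | EX f => pre (sem K f)
  end.

Definition models (Sigma : finType) (K : kripke Sigma) (phi : ctl Sigma) : Prop :=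
  start K \in sem K phi.

Lemma pre_mono (Sigma : finType) (K : kripke Sigma) (X Y : {set node K}) :
  X \subset Y -> pre X \subset pre Y.
Proof.
move=> sXY; apply/subsetP => w; rewrite !inE => /exists_inP[v Xv wv].
by apply/exists_inP; exists v; rewrite ?(subsetP sXY).
Qed.

Lemma sem_EU (Sigma : finType) (K : kripke Sigma) (f g : ctl Sigma) :
  minset [pred X | sem K g :|: (sem K f :&: pre X) == X] (sem K (EU f g)).
Proof.
by apply: minset_fix => X Y sXY; rewrite setUS // setIS // pre_mono.
Qed.

Lemma sem_EG (Sigma : finType) (K : kripke Sigma) (f : ctl Sigma) :
  maxset [pred X | sem K f :&: pre X == X] (sem K (EG f)).
Proof. by apply: maxset_cofix => X Y sXY; rewrite setIS // pre_mono. Qed.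

(** * Regular tree grammars *)

Record grammar (Sigma : finType) : Type := Grammar {
  nonterm : finType;
  axiom : nonterm;
  rules : seq (nonterm * tree Sigma nonterm)
}.

Arguments axiom {Sigma} g.
Arguments rules {Sigma} g.

Definition grammar_size (Sigma : finType) (Gr : grammar Sigma) : nat :=
  #|nonterm Gr| + \sum_(r <- rules Gr) (tree_size r.2).+1.

Inductive rewrite_step (Sigma : finType) (Gr : grammar Sigma) :
    tree Sigma (nonterm Gr) -> tree Sigma (nonterm Gr) -> Prop :=
| step_rule A t : List.In (A, t) (rules Gr) -> rewrite_step (Var A) t
| step_Or_l t t' u : rewrite_step t t' -> rewrite_step (Or t u) (Or t' u)
| step_Or_r t u u' : rewrite_step u u' -> rewrite_step (Or t u) (Or t u')
| step_Not t t' : rewrite_step t t' -> rewrite_step (Not t) (Not t')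
| step_EG t t' : rewrite_step t t' -> rewrite_step (EG t) (EG t')
| step_EU_l t t' u : rewrite_step t t' -> rewrite_step (EU t u) (EU t' u)
| step_EU_r t u u' : rewrite_step u u' -> rewrite_step (EU t u) (EU t u')
| step_EX t t' : rewrite_step t t' -> rewrite_step (EX t) (EX t').

Definition in_language (Sigma : finType) (Gr : grammar Sigma) (phi : ctl Sigma) :
    Prop :=
  clos_refl_trans_1n _ (@rewrite_step Sigma Gr)
    (Var (axiom Gr)) (tree_map (@of_void (nonterm Gr)) phi).

(** * The separation problem *)

(* The finite sets of positive and negative structures are given as lists. *)
Definition separates (Sigma : finType) (P N : seq (kripke Sigma))
    (phi : ctl Sigma) : Prop :=
  (forall K, List.In K P -> models K phi) /\
  (forall K, List.In K N -> ~ models K phi).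

Definition solution (Sigma : finType) (P N : seq (kripke Sigma))
    (Gr : grammar Sigma) (phi : ctl Sigma) : Prop :=
  in_language Gr phi /\ separates P N phi.

(** * Random access machines

   Structured programs over natural-number registers and an indirectly
   addressed memory, with unit cost for each operation; the only arithmetic is
   addition and truncated subtraction, so unit cost is a reasonable measure. *)

Inductive exp : Type :=
| Const (k : nat)
| Reg (r : nat)
| Plus (e f : exp)
| Minus (e f : exp)
| Mem (e : exp).

Inductive com : Type :=
| Skip
| Assign (r : nat) (e : exp)
| Store (e f : exp)
| Seq (c d : com)
| If (e : exp) (c d : com)
| While (e : exp) (c : com).

Record state : Type := State { regs : nat -> nat; memory : nat -> nat }.

Fixpoint eval (s : state) (e : exp) : nat :=
  match e with
  | Const k => k
  | Reg r => regs s r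
  | Plus e f => eval s e + eval s f
  | Minus e f => eval s e - eval s f
  | Mem e => memory s (eval s e)
  end.

Fixpoint cost (e : exp) : nat :=
  match e with
  | Const _ | Reg _ => 1
  | Plus e f | Minus e f => (cost e + cost f).+1
  | Mem e => (cost e).+1
  end.

Definition update (f : nat -> nat) (i v : nat) : nat -> nat :=
  fun j => if j == i then v else f j.

(* [exec c s s' t]: started in [s], the program [c] halts in [s'] after [t]
   units of time.  A test succeeds when its value is nonzero. *)
Inductive exec : com -> state -> state -> nat -> Prop :=
| exec_Skip s : exec Skip s s 1
| exec_Assign r e s :
    exec (Assign r e) s (State (update (regs s) r (eval s e)) (memory s)) (cost e).+1
| exec_Store e f s :
    exec (Store e f) s (State (regs s) (update (memory s) (eval s e) (eval s f)))
      (cost e + cost f).+1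
| exec_Seq c d s s' s'' t t' :
    exec c s s' t -> exec d s' s'' t' -> exec (Seq c d) s s'' (t + t')
| exec_If_true e c d s s' t :
    eval s e != 0 -> exec c s s' t -> exec (If e c d) s s' (cost e + t).+1
| exec_If_false e c d s s' t :
    eval s e = 0 -> exec d s s' t -> exec (If e c d) s s' (cost e + t).+1
| exec_While_true e c s s' s'' t t' :
    eval s e != 0 -> exec c s s' t -> exec (While e c) s' s'' t' ->
    exec (While e c) s s'' (cost e + t + t').+1
| exec_While_false e c s :
    eval s e = 0 -> exec (While e c) s s (cost e).+1.

Lemma exec_det c s s1 t1 s2 t2 :
  exec c s s1 t1 -> exec c s s2 t2 -> s1 = s2 /\ t1 = t2.
Proof.
move=> H; elim: H s2 t2 => {c s s1 t1} => [s|r e s|e f s|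
  c d s s' s'' t t' _ IHc _ IHd|e c d s s' t e0 _ IH|e c d s s' t e0 _ IH|
  e c s s' s'' t t' e0 _ IHc _ IHd|e c s e0] s2 t2 H; inversion H; subst => //;
repeat match goal with
| nz : is_true (?x != 0), z : ?x = 0 |- _ => by rewrite z in nz
| IHr : forall q k, exec ?a ?b q k -> _, run : exec ?a ?b _ _ |- _ =>
    case: (IHr _ _ run) => ? ?; subst; clear IHr
end; by [].
Qed.

(** * Input and output formats *)

Definition rank (T : finType) (x : T) : nat := enum_rank x.

(* The two bit tables are stored row by row, one row for each node. *)
Definition enc_kripke (Sigma : finType) (K : kripke Sigma) : seq nat :=
  [:: #|node K|; rank (start K)]
  ++ [seq nat_of_bool (edge K v w) | v <- enum (node K), w <- enum (node K)]
  ++ [seq nat_of_bool (a \in label K w) | w <- enum (node K), a <- enum Sigma].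

(* Postfix notation. *)
Fixpoint enc_tree (Sigma V : finType) (t : tree Sigma V) : seq nat :=
  match t with
  | Var x => [:: 0; rank x]
  | Atom a => [:: 1; rank a]
  | Or t u => enc_tree t ++ enc_tree u ++ [:: 2]
  | Not t => enc_tree t ++ [:: 3]
  | EG t => enc_tree t ++ [:: 4]
  | EU t u => enc_tree t ++ enc_tree u ++ [:: 5]
  | EX t => enc_tree t ++ [:: 6]
  end.

Definition enc_rule (Sigma V : finType) (r : V * tree Sigma V) : seq nat :=
  [:: rank r.1; tree_size r.2] ++ enc_tree r.2.

Definition enc_grammar (Sigma : finType) (Gr : grammar Sigma) : seq nat :=
  [:: #|nonterm Gr|; rank (axiom Gr); size (rules Gr)]
  ++ flatten [seq enc_rule r | r <- rules Gr].

Definition enc_input (Sigma : finType) (P N : seq (kripke Sigma))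
    (Gr : grammar Sigma) : seq nat :=
  [:: #|Sigma|; size P; size N]
  ++ flatten [seq enc_kripke K | K <- P ++ N] ++ enc_grammar Gr.

Definition init_state (input : seq nat) : state :=
  State (fun=> 0) (fun i => nth 0 input i).

(* The memory [M] holds the syntax tree of [phi] as linked cells, rooted at
   address [p].  Cells may be shared between subtrees: the least formula in
   L(G) can have exponentially many nodes in the size of G, already when there
   are no structures at all, so no output format without sharing allows a
   bound that is linear in the size of the grammar. *)
Fixpoint stores (Sigma : finType) (M : nat -> nat) (p : nat) (phi : ctl Sigma) :
    Prop :=
  match phi with
  | Var x => match x with end
  | Atom a => M p = 1 /\ M p.+1 = rank a
  | Or f g => [/\ M p = 2, stores M (M p.+1) f & stores M (M p.+2) g]
  | Not f => M p = 3 /\ stores M (M p.+1) f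
  | EG f => M p = 4 /\ stores M (M p.+1) f
  | EU f g => [/\ M p = 5, stores M (M p.+1) f & stores M (M p.+2) g]
  | EX f => M p = 6 /\ stores M (M p.+1) f
  end.

(* Register 0 holds the verdict, register 1 the address of the formula. *)
Definition correct_output (Sigma : finType) (P N : seq (kripke Sigma))
    (Gr : grammar Sigma) (s : state) : Prop :=
  (regs s 0 = 1 /\ exists phi, solution P N Gr phi /\ stores (memory s) (regs s 1) phi)
  \/ (regs s 0 = 0 /\ ~ exists phi, solution P N Gr phi).

(* Main.v *)
Require Import Defs.
From Stdlib Require Import Relation_Operators.
From mathcomp Require Import all_boot all_algebra zify.

(* A formula denotes a set of nodes of the disjoint union of all structures, so
   it has one of [D <= 2 ^ (m * n)] meanings, coded as numbers below [D].  The nodes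
   of the grammar are its nonterminals and the positions of its right-hand
   sides; each pair of a node and a meaning gets a memory cell, which is marked
   when some formula generated by the node is known to have that meaning, and
   then points to the cells of its subformulas.  The marks are closed under the
   productions with a queue, as in linear-time Horn inference: every position is
   revisited at most [D] times for each of its children, so the cost is linear
   in the grammar.  Separation depends on the meaning only, so a solution exists
   exactly when one is found among the [D] cells of the axiom. *)

Set Implicit Arguments.
Unset Strict Implicit.
Unset Printing Implicit Defensive.

(* Time budgets contain [T.-1], where simplification would unfold products in [T]. *)
#[local] Arguments Nat.pred n : simpl never.

(** * Programs over arrays *)

(** The input does not state its own length, and the machine cannot multiply. A first pass therefore
    uses registers only and measures the input; the arrays are then laid out behind it, at a base
    address known only at run time. Programs are written over these arrays and compiled at a
    constant slowdown. A marked cell is never overwritten. The formula spelled by its pointers is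
    fixed by the first derivation found; later derivations of the same meaning are discarded, which
    loses nothing because every operator acts on meanings. Popping a cell fires each clause of its
    node on all pairs of marked operands, not only on the pairs with the popped cell. This costs a
    factor [D], but the effect of firing can be stated without mentioning the popped cell. The
    exponent 6 arises as follows: one pair costs a cubic number of steps in the number of nodes,
    hence of order [D ^ 3] at most; a clause has up to [D ^ 2] pairs; and each of its two entries is
    fired at most [D] times. *)

(* [Adr e] is the machine address of the entry [e] of array 0. *)
Inductive aexp : Type :=
| Lit (k : nat)
| Get (r : nat)
| Add (e f : aexp)
| Sub (e f : aexp)
| Inp (e : aexp)
| At (j : nat) (e : aexp)
| Adr (e : aexp).

Inductive acom : Type :=
| Nop
| Let (r : nat) (e : aexp)
| Put (j : nat) (i e : aexp)
| Then (c d : acom)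
| Cond (e : aexp) (c d : acom)
| Loop (e : aexp) (c : acom).

Coercion Lit : nat >-> aexp.
Declare Scope aexp_scope.
Delimit Scope aexp_scope with A.
Bind Scope aexp_scope with aexp.
Notation "$ r" := (Get r) (at level 1, r at level 0, format "$ r") : aexp_scope.
Notation "e + f" := (Add e f) : aexp_scope.
Notation "e - f" := (Sub e f) : aexp_scope.
Arguments Let r%_nat_scope e%_A.
Notation "c ;; d" := (Then c d) (at level 90, right associativity).
Notation "r <~ e" := (Let r e%A) (at level 75).

Record astate : Type := AState { rg : nat -> nat; ar : nat -> nat -> nat }.

Definition setr (s : astate) r v := AState (update (rg s) r v) (ar s).
Definition seta (s : astate) j i v :=
  AState (rg s) (fun j' => if j' == j then update (ar s j) i v else ar s j').

(** Replaces multiplication: the stride 32 of the interleaved arrays is obtained by doubling an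
    expression five times. The resulting 32 copies are a constant cost for a fixed program. *)
Fixpoint dbl n (e : exp) := if n is n'.+1 then dbl n' (Plus e e) else e.

Lemma eval_dbl s n e : eval s (dbl n e) = 2 ^ n * eval s e.
Proof.
elim: n e => [|n IH] e /=; first by rewrite mul1n.
by rewrite IH /= addnn -muln2 expnS; lia.
Qed.

(** Machine register 0 is reserved for the base address of the arrays, hence the shift of register
    numbers by one. *)
Fixpoint compile_exp (e : aexp) : exp :=
  match e with
  | Lit k => Const k
  | Get r => Reg r.+1
  | Add e f => Plus (compile_exp e) (compile_exp f)
  | Sub e f => Minus (compile_exp e) (compile_exp f)
  | Inp e => Defs.Mem (compile_exp e)
  | At j e => Defs.Mem (Plus (Reg 0) (Plus (dbl 5 (compile_exp e)) (Const j)))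
  | Adr e => Plus (Reg 0) (dbl 5 (compile_exp e))
  end.

Fixpoint compile (c : acom) : com :=
  match c with
  | Nop => Skip
  | Let r e => Assign r.+1 (compile_exp e)
  | Put j i e =>
      Store (Plus (Reg 0) (Plus (dbl 5 (compile_exp i)) (Const j))) (compile_exp e)
  | Then c d => Seq (compile c) (compile d)
  | Cond e c d => If (compile_exp e) (compile c) (compile d)
  | Loop e c => While (compile_exp e) (compile c)
  end.

(* Arrays 0, ..., 31 are interleaved in the memory beyond the input; [x] tells
   whether arrays may be used at all. *)
Fixpoint ok_exp x (e : aexp) : bool :=
  match e with
  | Lit _ | Get _ => true
  | Add e f | Sub e f => ok_exp x e && ok_exp x f
  | Inp e => ok_exp x e
  | At j e => [&& x, j < 32 & ok_exp x e]
  | Adr e => x && ok_exp x e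
  end.

Fixpoint ok_com x (c : acom) : bool :=
  match c with
  | Nop => true
  | Let _ e => ok_exp x e
  | Put j i e => [&& x, j < 32, ok_exp x i & ok_exp x e]
  | Then c d => ok_com x c && ok_com x d
  | Cond e c d => [&& ok_exp x e, ok_com x c & ok_com x d]
  | Loop e c => ok_exp x e && ok_com x c
  end.

(** The price in machine time of the most expensive elementary step, hence the conversion factor
    from step counts to machine time. *)
Fixpoint max_cost (c : com) : nat :=
  match c with
  | Skip => 1
  | Assign _ e => (cost e).+1
  | Store e f => (cost e + cost f).+1
  | Seq c d => maxn (max_cost c) (max_cost d)
  | If e c d => maxn (cost e).+1 (maxn (max_cost c) (max_cost d))
  | While e c => maxn (cost e).+1 (max_cost c)
  end.

Section Programs.

Variable inp : seq nat.
Let B := size inp.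

(** The machine memory described by an array state. Array stores only reach addresses from [B] on,
    so the input stays readable during the whole run. *)
Definition amem (s : astate) a :=
  if a < B then nth 0 inp a else ar s ((a - B) %% 32) ((a - B) %/ 32).

Definition adr c := B + 32 * c.

Lemma amem_adr s c j : j < 32 -> amem s (adr c + j) = ar s j c.
Proof.
move=> j32; rewrite /amem /adr ltnNge -addnA leq_addr /= addKn mulnC.
by rewrite modnMDl modn_small // divnMDl // divn_small // addn0.
Qed.

Fixpoint aeval (s : astate) (e : aexp) : nat :=
  match e with
  | Lit k => k
  | Get r => rg s r
  | Add e f => aeval s e + aeval s f
  | Sub e f => aeval s e - aeval s f
  | Inp e => amem s (aeval s e)
  | At j e => ar s j (aeval s e)
  | Adr e => adr (aeval s e)
  end.

(* Unlike [exec], [aexec] counts elementary steps, whatever the size of the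
   expressions involved. *)
Inductive aexec : acom -> astate -> astate -> nat -> Prop :=
| aexec_Nop s : aexec Nop s s 1
| aexec_Let r e s : aexec (Let r e) s (setr s r (aeval s e)) 1
| aexec_Put j i e s : aexec (Put j i e) s (seta s j (aeval s i) (aeval s e)) 1
| aexec_Then c d s s' s'' t t' :
    aexec c s s' t -> aexec d s' s'' t' -> aexec (Then c d) s s'' (t + t')
| aexec_Cond_true e c d s s' t :
    aeval s e != 0 -> aexec c s s' t -> aexec (Cond e c d) s s' t.+1
| aexec_Cond_false e c d s s' t :
    aeval s e = 0 -> aexec d s s' t -> aexec (Cond e c d) s s' t.+1
| aexec_Loop_true e c s s' s'' t t' :
    aeval s e != 0 -> aexec c s s' t -> aexec (Loop e c) s' s'' t' ->
    aexec (Loop e c) s s'' (t + t').+1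
| aexec_Loop_false e c s : aeval s e = 0 -> aexec (Loop e c) s s 1.

(** [b] is the content of the base register: 0 during the first pass, and [B] once the length of the
    input has been found. *)
Definition implements (b : nat) (s : astate) (s' : state) :=
  [/\ regs s' 0 = b, forall r, regs s' r.+1 = rg s r & memory s' =1 amem s].

Lemma compile_expP x b s s' e :
  implements b s s' -> ok_exp x e -> x ==> (b == B) ->
  eval s' (compile_exp e) = aeval s e.
Proof.
move=> [s0 sr sm] + xB; elim: e => //= [e IHe f IHf|e IHe f IHf|e IH|j e IH|e IH].
- by case/andP=> oke okf; rewrite IHe ?IHf.
- by case/andP=> oke okf; rewrite IHe ?IHf.
- by move=> oke; rewrite IH.
- case/and3P=> xt j32 oke; rewrite xt in xB.
  rewrite -amem_adr // -sm s0; have /= -> := eval_dbl s' 5 (compile_exp e).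
  by rewrite IH // (eqP xB) addnA.
case/andP=> xt oke; rewrite xt in xB.
by have /= -> := eval_dbl s' 5 (compile_exp e); rewrite IH // s0 (eqP xB).
Qed.

Lemma implements_setr b s s' r v :
  implements b s s' ->
  implements b (setr s r v) (State (update (regs s') r.+1 v) (memory s')).
Proof.
by case=> s0 sr sm; split=> // r'; rewrite /= /update eqSS; case: eqP.
Qed.

Lemma implements_seta b s s' j i v :
  implements b s s' -> j < 32 ->
  implements b (seta s j i v)
    (State (regs s') (update (memory s') (adr i + j) v)).
Proof.
case=> s0 sr sm j32; split=> // a; rewrite /= /update.
case: eqP => [->|ne]; first by rewrite amem_adr //= eqxx /update eqxx.
rewrite sm /amem; case: ifP => // aB; rewrite /=.
case: eqP => // ej; rewrite /update ej; case: eqP => // ei.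
by case: ne; rewrite /adr; have := divn_eq (a - B) 32; lia.
Qed.

(** By induction on the run: every elementary step becomes code of cost at most [max_cost], so the
    slowdown depends on the program alone. *)
Lemma aexec_compile x b c s1 s2 t s1' :
  aexec c s1 s2 t -> ok_com x c -> x ==> (b == B) -> implements b s1 s1' ->
  exists s2' t', [/\ exec (compile c) s1' s2' t', implements b s2 s2' &
    t' <= max_cost (compile c) * t].
Proof.
move=> run; elim: run s1' => {c s1 s2 t} /=.
- by move=> s s' _ _ ?; exists s', 1; split=> //; apply: exec_Skip.
- move=> r e s s' oke xB imp; rewrite -(compile_expP imp oke xB).
  do 2!eexists; split; first exact: exec_Assign; last by rewrite muln1.
  exact: implements_setr.
- move=> j i e s s' /and4P[xt j32 oki oke] xB imp.
  rewrite -(compile_expP imp oki xB) -(compile_expP imp oke xB).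
  do 2!eexists; split; first exact: exec_Store; last by rewrite muln1.
  have := implements_seta (eval s' (compile_exp i)) (eval s' (compile_exp e)) imp j32.
  congr (implements _ _ (State _ (update _ _ _))).
  have /= -> := eval_dbl s' 5 (compile_exp i).
  by case: imp => -> _ _; rewrite xt in xB; rewrite (eqP xB) /adr addnA.
- move=> c d s s' s'' t t' _ IHc _ IHd s1 /andP[okc okd] xB imp.
  have [s2 [t2 [run2 imp2 le2]]] := IHc _ okc xB imp.
  have [s3 [t3 [run3 imp3 le3]]] := IHd _ okd xB imp2.
  exists s3, (t2 + t3); split=> //; first exact: exec_Seq run2 run3.
  by rewrite mulnDr leq_add // (leq_trans le2, leq_trans le3) // leq_mul2r
    (leq_maxl, leq_maxr) orbT.
- move=> e c d s s' t nz _ IH s1 /and3P[oke okc okd] xB imp.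
  have [s2 [t2 [run2 imp2 le2]]] := IH _ okc xB imp.
  exists s2, (cost (compile_exp e) + t2).+1; split=> //.
    by apply: exec_If_true => //; rewrite (compile_expP imp oke xB).
  rewrite mulnS -addSn leq_add ?leq_maxl // (leq_trans le2) // leq_mul2r.
  by rewrite !leq_max leqnn !orbT.
- move=> e c d s s' t nz _ IH s1 /and3P[oke okc okd] xB imp.
  have [s2 [t2 [run2 imp2 le2]]] := IH _ okd xB imp.
  exists s2, (cost (compile_exp e) + t2).+1; split=> //.
    by apply: exec_If_false => //; rewrite (compile_expP imp oke xB).
  rewrite mulnS -addSn leq_add ?leq_maxl // (leq_trans le2) // leq_mul2r.
  by rewrite !leq_max leqnn !orbT.
- move=> e c s s' s'' t t' nz _ IHc _ IHd s1 okl xB imp.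
  have [oke okc] := andP okl.
  have [s2 [t2 [run2 imp2 le2]]] := IHc _ okc xB imp.
  have [s3 [t3 [run3 imp3 le3]]] := IHd _ okl xB imp2.
  exists s3, (cost (compile_exp e) + t2 + t3).+1; split=> //.
    by apply: exec_While_true run3 => //; rewrite (compile_expP imp oke xB).
  rewrite mulnS mulnDr -addnA -addSn leq_add ?leq_maxl // leq_add //.
  by rewrite (leq_trans le2) // leq_mul2r leq_maxr orbT.
move=> e c s z s' /andP[oke _] xB imp.
exists s', (cost (compile_exp e)).+1; split=> //; last by rewrite muln1 leq_maxl.
by apply: exec_While_false; rewrite (compile_expP imp oke xB).
Qed.

(** ** Reasoning about programs *)

Fixpoint written (c : acom) : seq nat :=
  match c with
  | Nop | Put _ _ _ => [::]
  | Let r _ => [:: r]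
  | Then c d | Cond _ c d => written c ++ written d
  | Loop _ c => written c
  end.

Fixpoint stored (c : acom) : seq nat :=
  match c with
  | Nop | Let _ _ => [::]
  | Put j _ _ => [:: j]
  | Then c d | Cond _ c d => stored c ++ stored d
  | Loop _ c => stored c
  end.

(** A syntactic frame condition. Membership in the concrete lists of assigned registers and arrays
    computes, so most preservation goals are closed by [isT]. *)
Definition frame c (s s' : astate) :=
  (forall r, r \notin written c -> rg s' r = rg s r) /\
  (forall j, j \notin stored c -> ar s' j = ar s j).

Lemma frame_refl c s : frame c s s. Proof. by []. Qed.

Lemma frame_trans c s s' s'' : frame c s s' -> frame c s' s'' -> frame c s s''.
Proof.
move=> [r1 a1] [r2 a2]; split=> x xP; first by rewrite r2 // r1.
by rewrite a2 // a1.
Qed.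

Lemma frame_sub c d s s' : {subset written c <= written d} ->
  {subset stored c <= stored d} -> frame c s s' -> frame d s s'.
Proof.
move=> sw sa [fr fa]; split=> x xP; first by rewrite fr //; apply: contra xP => /sw.
by rewrite fa //; apply: contra xP => /sa.
Qed.

Lemma aexec_frame c s s' t : aexec c s s' t -> frame c s s'.
Proof.
elim=> {c s s' t} //.
- by move=> r e s; split=> // r'; rewrite /= inE /update => /negPf->.
- by move=> j i e s; split=> // j'; rewrite /= inE => /negPf->.
- move=> c d s s' s'' t t' _ fc _ fd; apply: (@frame_trans _ s s').
    by apply: frame_sub fc => x; rewrite mem_cat => ->.
  by apply: frame_sub fd => x; rewrite mem_cat => ->; rewrite orbT.
- by move=> e c d s s' t _ _; apply: frame_sub => x; rewrite mem_cat => ->.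
- move=> e c d s s' t _ _; apply: frame_sub => x; rewrite mem_cat => ->;
  by rewrite orbT.
by move=> e c s s' s'' t t' _ _ + _; apply: frame_trans.
Qed.

(** Total correctness with a time bound. The start state is explicit instead of a precondition, so
    that straight-line code is executed symbolically. *)
Definition runs c s T (Q : astate -> Prop) :=
  exists s' t, [/\ aexec c s s' t, t <= T & Q s'].

(** The frame of the run is supplied here, so that postconditions need only describe what the
    program changes. *)
Lemma runs_weaken c s T T' (Q Q' : astate -> Prop) :
  runs c s T Q -> T <= T' -> (forall s', frame c s s' -> Q s' -> Q' s') ->
  runs c s T' Q'.
Proof.
move=> [s' [t [run le q]]] TT' QQ'; exists s', t; split=> //.
  exact: leq_trans TT'.
exact: QQ' (aexec_frame run) q.
Qed.

Lemma runs_Nop s T (Q : astate -> Prop) : 0 < T -> Q s -> runs Nop s T Q.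
Proof. by move=> T0 q; exists s, 1; split=> //; apply: aexec_Nop. Qed.

Lemma runs_Let r e s T (Q : astate -> Prop) :
  0 < T -> Q (setr s r (aeval s e)) -> runs (Let r e) s T Q.
Proof. by move=> T0 q; do 2!eexists; split; [apply: aexec_Let| |]. Qed.

Lemma runs_Put j i e s T (Q : astate -> Prop) :
  0 < T -> Q (seta s j (aeval s i) (aeval s e)) -> runs (Put j i e) s T Q.
Proof. by move=> T0 q; do 2!eexists; split; [apply: aexec_Put| |]. Qed.

Lemma runs_Then c d s T T1 T2 (Q Q1 : astate -> Prop) :
  runs c s T1 Q1 -> (forall s', frame c s s' -> Q1 s' -> runs d s' T2 Q) ->
  T1 + T2 <= T -> runs (c;; d) s T Q.
Proof.
move=> [s' [t [run le q]]] rd TT.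
have [s'' [t' [run' le' q']]] := rd s' (aexec_frame run) q.
exists s'', (t + t'); split=> //; first exact: aexec_Then run run'.
by apply: leq_trans TT; apply: leq_add.
Qed.

Lemma runs_Let_Then r e d s T (Q : astate -> Prop) :
  0 < T -> runs d (setr s r (aeval s e)) T.-1 Q -> runs (Let r e;; d) s T Q.
Proof.
case: T => // T _ [s' [t [run le q]]]; exists s', (1 + t); split=> //.
exact: aexec_Then (aexec_Let _ _ _) run.
Qed.

Lemma runs_Put_Then j i e d s T (Q : astate -> Prop) :
  0 < T -> runs d (seta s j (aeval s i) (aeval s e)) T.-1 Q ->
  runs (Put j i e;; d) s T Q.
Proof.
case: T => // T _ [s' [t [run le q]]]; exists s', (1 + t); split=> //.
exact: aexec_Then (aexec_Put _ _ _ _) run.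
Qed.

Lemma runs_Cond e c d s T (Q : astate -> Prop) :
  0 < T ->
  (aeval s e != 0 -> runs c s T.-1 Q) -> (aeval s e = 0 -> runs d s T.-1 Q) ->
  runs (Cond e c d) s T Q.
Proof.
case: T => // T _ rc rd; have [z|nz] := eqVneq (aeval s e) 0.
  have [s' [t [run le q]]] := rd z; exists s', t.+1; split=> //.
  exact: aexec_Cond_false.
have [s' [t [run le q]]] := rc nz; exists s', t.+1; split=> //.
exact: aexec_Cond_true.
Qed.

Lemma runs_Loop_false e c s T (Q : astate -> Prop) :
  0 < T -> aeval s e = 0 -> Q s -> runs (Loop e c) s T Q.
Proof. by move=> T0 z q; exists s, 1; split=> //; apply: aexec_Loop_false. Qed.

Lemma runs_Loop_true e c s T T1 T2 (Q Q1 : astate -> Prop) :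
  aeval s e != 0 -> runs c s T1 Q1 ->
  (forall s', frame c s s' -> Q1 s' -> runs (Loop e c) s' T2 Q) ->
  T1 + T2 < T -> runs (Loop e c) s T Q.
Proof.
move=> nz [s' [t [run le q]]] rd TT.
have [s'' [t' [run' le' q']]] := rd s' (aexec_frame run) q.
exists s'', (t + t').+1; split=> //; first exact: aexec_Loop_true run run'.
by apply: leq_ltn_trans TT; apply: leq_add.
Qed.

(* The potential [Phi] pays for the remaining iterations. *)
Lemma runs_Loop e c s (I : astate -> Prop) (Phi : astate -> nat) T :
  I s ->
  (forall s', frame c s s' -> I s' -> aeval s' e != 0 ->
    exists2 T', T' < Phi s' &
      runs c s' T' (fun s'' => I s'' /\ Phi s'' + T' < Phi s')) ->
  Phi s < T -> runs (Loop e c) s T (fun s' => I s' /\ aeval s' e = 0).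
Proof.
move=> Is body lt.
(* Induction on a bound for the potential; the frame from the start state is carried along because
   [body] asks for it in every iteration. *)
suff gen n s1 : Phi s1 <= n -> frame c s s1 -> I s1 ->
    runs (Loop e c) s1 (Phi s1).+1 (fun s' => I s' /\ aeval s' e = 0).
  by apply: runs_weaken (gen _ _ (leqnn _) (frame_refl c s) Is) _ _.
elim: n s1 => [|n IH] s1 le fr I1.
all: have [z|nz] := eqVneq (aeval s1 e) 0;
  first by exists s1, 1; split=> //; apply: aexec_Loop_false.
all: have [T' ltT [s2 [t [run let' [I2 lt2]]]]] := body s1 fr I1 nz.
  by move: ltT; rewrite ltnNge (leq_trans le).
have le2: Phi s2 <= n by lia.
have [s3 [t3 [run3 le3 q3]]] := IH s2 le2 (frame_trans fr (aexec_frame run)) I2.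
exists s3, (t + t3).+1; split=> //; first exact: aexec_Loop_true run run3.
lia.
Qed.

End Programs.

(** Truncated subtraction serves as the comparison here and in all later tests: [$n - $i] is nonzero
    exactly while [i < n]. *)
Definition For (i n : nat) c := i <~ 0;; Loop ($n - $i) (c;; i <~ $i + 1).

(** The potential is the sum of the budgets of the remaining rounds. In each round 2 units pay for
    the test and the increment; the 2 units outside the sum pay for the initialization and the last
    test. *)
Lemma runs_For_sum inp (I : nat -> astate -> Prop) (Tc : nat -> nat)
    (i n : nat) c s T :
  [&& n != i, n \notin written c & i \notin written c] ->
  I 0 (setr s i 0) ->
  (forall k s', k < rg s n -> frame (For i n c) s s' -> rg s' i = k -> I k s' ->
    runs inp c s' (Tc k) (fun s'' => I k.+1 (setr s'' i k.+1))) ->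
  \sum_(0 <= k < rg s n) (Tc k + 2) + 2 <= T ->
  runs inp (For i n c) s T (fun s' => I (rg s n) s').
Proof.
case/and3P=> ni nc ic I0 body; case: T => [|T0] le; first by lia.
apply: runs_Let_Then => //; rewrite /=; set s0 := setr s i _.
have fr0: frame (For i n c) s s0.
  split=> r; rewrite //= inE negb_or /update => /andP[/negPf-> //].
have en s' : frame (For i n c) s s' -> rg s' n = rg s n.
  by move=> [-> //]; rewrite /= !inE mem_cat !inE negb_or (negPf nc) ni.
have sub s' : frame (c;; i <~ $i + 1) s0 s' -> frame (For i n c) s s'.
  move=> fr; apply: frame_trans fr0 _.
  by apply: frame_sub fr => x; rewrite /= ?inE // => ->; rewrite orbT.
pose J s' := rg s' i <= rg s n /\ I (rg s' i) s'.
pose Phi s' := \sum_(rg s' i <= k < rg s n) (Tc k + 2).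
apply: runs_weaken (leqnn _) _; first apply: (@runs_Loop _ _ _ _ J Phi).
- by rewrite /J /= /update eqxx.
- move=> s' /sub fr [lei Ii] /= lti.
  have ltn : rg s' i < rg s n by rewrite en // in lti; lia.
  exists (Tc (rg s' i) + 1); first by rewrite /Phi big_ltn //; lia.
  apply: runs_Then (body _ _ ltn fr erefl Ii) _ (leqnn _) => s'' [fc _] Is''.
  apply: runs_Let; rewrite //= fc // /J /Phi /= /update eqxx addn1.
  by split; [split | rewrite [X in _ < X]big_ltn //; lia].
- by rewrite /Phi /= /update eqxx; lia.
by move=> s' /sub fr [[lei Ii] /=]; rewrite en // => e0; have <-: rg s' i = rg s n by lia.
Qed.

Lemma runs_For inp (I : nat -> astate -> Prop) Tc (i n : nat) c s T :
  [&& n != i, n \notin written c & i \notin written c] ->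
  I 0 (setr s i 0) ->
  (forall k s', k < rg s n -> frame (For i n c) s s' -> rg s' i = k -> I k s' ->
    runs inp c s' Tc (fun s'' => I k.+1 (setr s'' i k.+1))) ->
  rg s n * (Tc + 2) + 2 <= T ->
  runs inp (For i n c) s T (fun s' => I (rg s n) s').
Proof.
by move=> nic I0 body le; apply: runs_For_sum body _; rewrite // sum_nat_const_nat subn0.
Qed.

(** * Sequences and finite types *)

Lemma In_onth T (x : T) s : List.In x s <-> exists i, onth s i = Some x.
Proof.
elim: s => [|y s IH] /=; first by split=> // -[i]; rewrite onth0n.
split=> [[->|/IH[i si]]|[[[->]|i si]]]; [by exists 0|by exists i.+1|by left|].
by right; apply/IH; exists i.
Qed.

Lemma onth_lt T (s : seq T) i : i < size s -> exists x, onth s i = Some x.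
Proof. by rewrite -onthTE; case: onth => // x _; exists x. Qed.

Lemma onth_size T (s : seq T) i x : onth s i = Some x -> i < size s.
Proof. by move=> si; rewrite -onthTE si. Qed.

Lemma onth_all T (p : pred T) s i x : all p s -> onth s i = Some x -> p x.
Proof.
elim: s i => [|y s IH] [|i] //= /andP[py ps]; first by case=> <-.
exact: IH.
Qed.

(** The offset of block [k] when blocks of sizes [f] are laid end to end; it locates both the nodes
    of the disjoint union and the parts of the input. *)
Definition psum T (f : T -> nat) s k := sumn (map f (take k s)).

Lemma psum0 T (f : T -> nat) s : psum f s 0 = 0.
Proof. by rewrite /psum take0. Qed.

Lemma psum_cons T (f : T -> nat) x s k : psum f (x :: s) k.+1 = f x + psum f s k.
Proof. by []. Qed.

Lemma psumS T (f : T -> nat) s k x :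
  onth s k = Some x -> psum f s k.+1 = psum f s k + f x.
Proof.
rewrite /psum; elim: s k => [|y s IH] [|k] //= => [[->]|/IH->].
  by rewrite take0 addn0.
by rewrite addnA.
Qed.

Lemma psum_size T (f : T -> nat) s : psum f s (size s) = sumn (map f s).
Proof. by rewrite /psum take_size. Qed.

Lemma psum_lt T (f : T -> nat) s k x w :
  onth s k = Some x -> w < f x -> psum f s k + w < sumn (map f s).
Proof.
move=> sk lt; have := psumS f sk; rewrite {1}/psum => e.
have: sumn (map f (take k.+1 s)) <= sumn (map f s).
  by rewrite -{2}(cat_take_drop k.+1 s) map_cat sumn_cat leq_addr.
lia.
Qed.

Lemma psum_lt_psum T (f : T -> nat) s i k x w :
  onth s i = Some x -> w < f x -> i < k -> psum f s i + w < psum f s k.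
Proof.
move=> si lt ik; have := psumS f si; rewrite [in psum f s k]/psum => e.
have: psum f s i.+1 <= psum f s k.
  by rewrite /psum -(subnKC ik) takeD map_cat sumn_cat leq_addr.
by rewrite /psum in e *; lia.
Qed.

Lemma psum_locate T (f : T -> nat) s i : i < sumn (map f s) ->
  exists k x w, [/\ onth s k = Some x, w < f x & i = psum f s k + w].
Proof.
elim: s i => //= x s IH i; have [lt _|le lt] := ltnP i (f x).
  by exists 0, x, i.
have [|k [y [w [sk wy e]]]] := IH (i - f x); first lia.
by exists k.+1, y, w; split=> //; rewrite /psum /= -addnA -/(psum f s k) -e; lia.
Qed.

Lemma rank_lt (T : finType) (x : T) : rank x < #|T|.
Proof. exact: ltn_ord. Qed.

Lemma nth_rank (T : finType) (x0 x : T) : nth x0 (enum T) (rank x) = x.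
Proof. exact: nth_enum_rank. Qed.

(** * Bit vectors *)

Fixpoint num (b : nat -> bool) n : nat :=
  if n is n'.+1 then num b n' + b n' * 2 ^ n' else 0.

Lemma num_lt b n : num b n < 2 ^ n.
Proof.
elim: n => //= n IH; rewrite expnS mul2n -addnn.
by case: (b n); rewrite ?mul1n ?mul0n; lia.
Qed.

Lemma eq_num b c n : (forall i, i < n -> b i = c i) -> num b n = num c n.
Proof.
elim: n => //= n IH bc; rewrite bc // IH // => i lt; exact: bc (ltnW lt).
Qed.

Lemma num_inj b c n : num b n = num c n -> forall i, i < n -> b i = c i.
Proof.
elim: n => //= n IH e i; have := num_lt b n; have := num_lt c n => ltc ltb.
have bc: b n = c n by move: e; case: (b n) (c n) => [] []; lia.
rewrite bc in e; have /IH{}IH: num b n = num c n by lia.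
by rewrite ltnS leq_eqVlt => /orP[/eqP->|/IH].
Qed.

(** The top bit is found by comparison with a power of two, which lets [decode] do without
    division. *)
Lemma num_bit b n : (num b n.+1 < 2 ^ n) = ~~ b n.
Proof. by move=> /=; have := num_lt b n; case: (b n) => /=; lia. Qed.

(** * Operators by tags *)

Definition ops := [:: 2; 3; 4; 5; 6].

Lemma ops_case (P : nat -> Prop) : P 0 -> P 2 -> P 3 -> P 4 -> P 5 -> P 6 ->
  forall t, t \in 0 :: ops -> P t.
Proof. by move=> p0 p2 p3 p4 p5 p6 [|[|[|[|[|[|[|t]]]]]]]. Qed.

Lemma opsP t : t \in 0 :: ops -> t = 0 \/ t = 2 \/ t = 3 \/ t = 4 \/ t = 5 \/ t = 6.
Proof. by move=> tP; elim/ops_case: t / tP; intuition. Qed.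

(* Tag 0 copies the first operand. *)
Definition build (Sigma V : Type) t (f g : tree Sigma V) : tree Sigma V :=
  match t with
  | 2 => Or f g | 3 => Not f | 4 => EG f | 5 => EU f g | 6 => EX f | _ => f
  end.

(** * The disjoint union of the structures *)

Section Glue.

Variables (Sigma : finType) (Ks : seq (kripke Sigma)).
Implicit Types (K : kripke Sigma) (f g : ctl Sigma).

(** Indexing by all structures rather than by positions in [Ks] avoids types that depend on a
    position; a structure listed twice simply has the same set both times. *)
Definition fam := forall K : kripke Sigma, {set node K}.
Implicit Types X Y Z : fam.

Definition nd K i : node K := nth (start K) (enum (node K)) i.

Definition off := psum (@kripke_size Sigma) Ks.
Definition n_nodes := sumn (map (@kripke_size Sigma) Ks).

Definition glue X x : bool :=
  let fix loop (s : seq (kripke Sigma)) x :=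
    if s is K :: s' then
      if x < kripke_size K then nd K x \in X K else loop s' (x - kripke_size K)
    else false
  in loop Ks x.

Lemma glue_at X k K w : onth Ks k = Some K -> w < kripke_size K ->
  glue X (off k + w) = (nd K w \in X K).
Proof.
rewrite /off /glue; elim: Ks k => [|K' s IH] [|k] //=.
  by move=> [->] lt; rewrite psum0 add0n lt.
move=> sk lt; have -> : psum (@kripke_size Sigma) (K' :: s) k.+1 + w =
  kripke_size K' + (psum (@kripke_size Sigma) s k + w) by rewrite addnA.
by rewrite ltnNge leq_addr /= addKn IH.
Qed.

Variant located : nat -> Prop :=
| Located k K w : onth Ks k = Some K -> w < kripke_size K -> located (off k + w).

Lemma locate x : x < n_nodes -> located x.
Proof. by move/psum_locate=> [k [K [w [sk lt ->]]]]; apply: Located sk lt. Qed.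

Lemma glue_lt k K w : onth Ks k = Some K -> w < kripke_size K -> off k + w < n_nodes.
Proof. exact: psum_lt. Qed.

Lemma kripke_size_le k K : onth Ks k = Some K -> kripke_size K <= n_nodes.
Proof.
move=> sk; case e: (kripke_size K) => [//|n].
by have := @glue_lt k K n sk; rewrite e ltnSn => /(_ isT); lia.
Qed.

Lemma eq_glue X Y x : (forall K, List.In K Ks -> X K = Y K) -> x < n_nodes ->
  glue X x = glue Y x.
Proof.
move=> XY /locate[k K w sk lt]; rewrite !(glue_at _ sk lt) XY //.
by apply/In_onth; exists k.
Qed.

Lemma glue_inj X Y : (forall x, x < n_nodes -> glue X x = glue Y x) ->
  forall K, List.In K Ks -> X K = Y K.
Proof.
move=> XY K /In_onth[k sk]; apply/setP=> v.
have lt := rank_lt v; have := XY _ (glue_lt sk lt).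
by rewrite !(glue_at _ sk lt) /nd nth_rank.
Qed.

Lemma glueU X Y x : x < n_nodes ->
  glue (fun K => X K :|: Y K) x = glue X x || glue Y x.
Proof. by case/locate=> k K w sk lt; rewrite !(glue_at _ sk lt) inE. Qed.

Lemma glueI X Y x : x < n_nodes ->
  glue (fun K => X K :&: Y K) x = glue X x && glue Y x.
Proof. by case/locate=> k K w sk lt; rewrite !(glue_at _ sk lt) inE. Qed.

Lemma glueC X x : x < n_nodes -> glue (fun K => ~: X K) x = ~~ glue X x.
Proof. by case/locate=> k K w sk lt; rewrite !(glue_at _ sk lt) inE. Qed.

Lemma glue0 x : x < n_nodes -> glue (fun K => set0) x = false.
Proof. by case/locate=> k K w sk lt; rewrite !(glue_at _ sk lt) inE. Qed.

Lemma glueT x : x < n_nodes -> glue (fun K => setT) x = true.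
Proof. by case/locate=> k K w sk lt; rewrite !(glue_at _ sk lt) inE. Qed.

Lemma glue_pre X k K w : onth Ks k = Some K -> w < kripke_size K ->
  glue (fun K => pre (X K)) (off k + w) =
  has (fun v => glue X (off k + v) && edge K (nd K w) (nd K v))
    (iota 0 (kripke_size K)).
Proof.
move=> sk lt; rewrite (glue_at _ sk lt) inE.
apply/exists_inP/hasP => [[v Xv wv]|[v + /andP[Xv wv]]].
  exists (rank v); first by rewrite mem_iota /= add0n; apply: rank_lt.
  by rewrite (glue_at _ sk (rank_lt v)) /nd nth_rank Xv.
rewrite mem_iota /= add0n => ltv; exists (nd K v) => //.
by rewrite -(glue_at _ sk ltv).
Qed.

(* Each operator is [cnt t n] steps Z |-> B :|: (A :&: pre Z) from a start set. *)
Definition op_start t X Y : fam := fun K =>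
  match t with
  | 2 => X K :|: Y K | 3 => ~: X K | 4 => setT | 5 => set0 | _ => X K
  end.
Definition op_and t X : fam := fun K => if t == 6 then setT else X K.
Definition op_or t Y : fam := fun K => if t == 5 then Y K else set0.
Definition op_count t n := match t with 4 | 5 => n | 6 => 1 | _ => 0 end.
Definition op_step t X Y Z : fam :=
  fun K => op_or t Y K :|: (op_and t X K :&: pre (Z K)).
Definition op t n X Y := iter (op_count t n) (op_step t X Y) (op_start t X Y).

Lemma op_iterE t X Y k K :
  iter k (op_step t X Y) (op_start t X Y) K =
  iter k (fun W => op_or t Y K :|: (op_and t X K :&: pre W)) (op_start t X Y K).
Proof. by elim: k => //= k IH; rewrite -IH. Qed.

(** The iteration is stationary after [#|T|] rounds. Hence all structures can be iterated together,
    for as many rounds as their union has nodes. *)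
Lemma iter_fixset (T : finType) (F : {set T} -> {set T}) n :
  {homo F : X Y / X \subset Y} -> #|T| <= n -> iter n F set0 = fixset F.
Proof. by move=> mono le; rewrite -(subnK le) iterD; apply: fixsetKn. Qed.

Lemma iter_cofixset (T : finType) (F : {set T} -> {set T}) n :
  {homo F : X Y / X \subset Y} -> #|T| <= n -> iter n F setT = cofixset F.
Proof.
(* A greatest fixpoint is the complement of the least fixpoint of the dual operator, which reduces
   the claim to the previous lemma. *)
move=> mono le; rewrite /cofixset -(@iter_fixset _ _ n) //; last first.
  by move=> X Y XY; rewrite /funsetC setCS mono // setCS.
by elim: n {le} => [|n IH] /=; rewrite ?setC0 // IH /funsetC !setCK.
Qed.

Definition semF f : fam := fun K => sem K f.

Lemma op_sem t f g n K : t \in 0 :: ops -> kripke_size K <= n ->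
  op t n (semF f) (semF g) K = sem K (build t f g).
Proof.
move=> tP le; rewrite /op op_iterE; move: tP; rewrite !inE.
have mono (A B : {set node K}) :
    {homo (fun W => B :|: (A :&: pre W)) : X Y / X \subset Y}.
  by move=> X Y XY; rewrite setUS // setIS // pre_mono.
do 3!case/predU1P=> [->//|]; case/predU1P=> [->|] /=.
  rewrite iter_cofixset // /cofixset /semF; congr (~: _); apply: eq_iter => W.
  by rewrite /funsetC /op_or set0U.
case/predU1P=> [->|/eqP->] /=; first by rewrite iter_fixset.
by rewrite /op_or /op_and set0U setTI.
Qed.

Lemma sem_build_eq t f g f' g' K : t \in 0 :: ops ->
  sem K f = sem K f' -> sem K g = sem K g' ->
  sem K (build t f g) = sem K (build t f' g').
Proof.
by move=> + ef eg; elim/ops_case: t /; rewrite //= ?ef ?eg.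
Qed.

(** ** Codes of formulas *)

Definition code f := num (glue (semF f)) n_nodes.

Lemma code_lt f : code f < 2 ^ n_nodes. Proof. exact: num_lt. Qed.

Lemma code_sem f g K : code f = code g -> List.In K Ks -> sem K f = sem K g.
Proof. by move=> /num_inj/glue_inj h /h. Qed.

Lemma code_glue X f : (forall K, List.In K Ks -> X K = sem K f) ->
  num (glue X) n_nodes = code f.
Proof. by move=> XK; apply: eq_num => x; apply: eq_glue. Qed.

(** The congruence behind the whole algorithm: it suffices to keep one formula for each meaning. *)
Lemma code_build t f g f' g' : t \in 0 :: ops ->
  code f = code f' -> code g = code g' -> code (build t f g) = code (build t f' g').
Proof.
move=> tP ef eg; apply: code_glue => K KP.
by apply: sem_build_eq => //; apply: code_sem.
Qed.

Lemma code_op t f g : t \in 0 :: ops ->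
  num (glue (op t n_nodes (semF f) (semF g))) n_nodes = code (build t f g).
Proof.
move=> tP; apply: code_glue => K /In_onth[k sk].
by rewrite op_sem // (kripke_size_le sk).
Qed.

Lemma code_atom a : code (Atom a) = num (glue (fun K => [set w | a \in label K w])) n_nodes.
Proof. by []. Qed.

End Glue.

(** * Derivations *)

Section Derivations.

Variables (Sigma : finType) (Gr : grammar Sigma).
Notation NT := (nonterm Gr).

(** Derivation trees instead of rewriting sequences: the order of expansion disappears, and
    completeness can be proved by induction on them. *)
Inductive gen : tree Sigma NT -> ctl Sigma -> Prop :=
| gen_Var A t phi : List.In (A, t) (rules Gr) -> gen t phi -> gen (Var A) phi
| gen_Atom a : gen (Atom a) (Atom a)
| gen_Or t u f g : gen t f -> gen u g -> gen (Or t u) (Or f g)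
| gen_Not t f : gen t f -> gen (Not t) (Not f)
| gen_EG t f : gen t f -> gen (EG t) (EG f)
| gen_EU t u f g : gen t f -> gen u g -> gen (EU t u) (EU f g)
| gen_EX t f : gen t f -> gen (EX t) (EX f).

Lemma gen_build k t u f g : k \in 0 :: ops ->
  gen t f -> gen u g -> gen (build k t u) (build k f g).
Proof.
by elim/ops_case: k / => //; constructor.
Qed.

Notation emb := (tree_map (@of_void NT)).
Notation derives := (clos_refl_trans_1n _ (@rewrite_step Sigma Gr)).

Lemma derives_trans t u v : derives t u -> derives u v -> derives t v.
Proof.
by elim=> // x y z s _ IH /IH; apply: (Relation_Operators.rt1n_trans _ _ _ _ _ s).
Qed.

Lemma derives_ctx (c : tree Sigma NT -> tree Sigma NT) t u :
  (forall t u, rewrite_step t u -> rewrite_step (c t) (c u)) ->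
  derives t u -> derives (c t) (c u).
Proof.
move=> cc; elim=> [x|x y z s _ IH]; first exact: rt1n_refl.
exact: rt1n_trans (cc _ _ s) IH.
Qed.

Lemma gen_derives t phi : gen t phi -> derives t (emb phi).
Proof.
elim=> {t phi} /=.
- move=> A t phi r _ IH; exact: rt1n_trans (step_rule r) IH.
- by move=> a; apply: rt1n_refl.
- move=> t u f g _ IHt _ IHu; apply: (@derives_trans _ (Or (emb f) u)).
    by apply: (derives_ctx (c := fun t => Or t u)) IHt => *; apply: step_Or_l.
  by apply: derives_ctx IHu => *; apply: step_Or_r.
- by move=> t f _; apply: derives_ctx => *; apply: step_Not.
- by move=> t f _; apply: derives_ctx => *; apply: step_EG.
- move=> t u f g _ IHt _ IHu; apply: (@derives_trans _ (EU (emb f) u)).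
    by apply: (derives_ctx (c := fun t => EU t u)) IHt => *; apply: step_EU_l.
  by apply: derives_ctx IHu => *; apply: step_EU_r.
by move=> t f _; apply: derives_ctx => *; apply: step_EX.
Qed.

Lemma gen_emb phi : gen (emb phi) phi.
Proof. by elim: phi => [[]| | | | | |] *; constructor. Qed.

(** Together with [gen_emb], this turns a rewriting sequence, read from its end, into a derivation
    tree. *)
Lemma gen_step t t' phi : rewrite_step t t' -> gen t' phi -> gen t phi.
Proof.
move=> s; elim: s phi => {t t'} [A t r phi|||||||]; first exact: gen_Var.
all: by move=> * /=; match goal with H : gen _ _ |- _ => inversion H; subst end;
  constructor; auto.
Qed.

Lemma derives_gen t phi : derives t (emb phi) -> gen t phi.
Proof.
move: (emb phi) (gen_emb phi) => u gu tu; elim: tu gu => // x y z s _ IH /IH.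
exact: gen_step.
Qed.

Lemma in_languageP phi : in_language Gr phi <-> gen (Var (axiom Gr)) phi.
Proof. by split=> [/derives_gen|/gen_derives]. Qed.

End Derivations.

(** * The layout of the input *)

Section Segments.

Variable inp : seq nat.

(** The bound on [p] matters: beyond the input, the memory holds array entries and not the default
    value of [nth]. *)
Definition at_ p v := p < size inp /\ nth 0 inp p = v.

Definition seg p xs := forall i, i < size xs -> at_ (p + i) (nth 0 xs i).

Lemma amem_at s p v : at_ p v -> amem inp s p = v.
Proof. by case=> lt <-; rewrite /amem lt. Qed.

Lemma seg_inp : seg 0 inp.
Proof. by move=> i. Qed.

Lemma seg_catl p xs ys : seg p (xs ++ ys) -> seg p xs.
Proof.
move=> sg i lt; have := sg i; rewrite size_cat nth_cat lt; apply; lia.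
Qed.

Lemma seg_catr p xs ys : seg p (xs ++ ys) -> seg (p + size xs) ys.
Proof.
move=> sg i lt; have := sg (size xs + i).
by rewrite size_cat nth_cat ltn_add2l -ltn_subRL subnn ltn0 addKn addnA; apply.
Qed.

Lemma seg_head p x xs : seg p (x :: xs) -> at_ p x.
Proof. by move=> /(_ 0 isT); rewrite addn0. Qed.

Lemma seg_tail p x xs : seg p (x :: xs) -> seg p.+1 xs.
Proof. by rewrite -cat1s => /seg_catr; rewrite addn1. Qed.

Lemma seg_flatten T (f : T -> seq nat) s p k x : seg p (flatten (map f s)) ->
  onth s k = Some x -> seg (p + psum (size \o f) s k) (f x).
Proof.
elim: s p k => [|y s IH] p [|k] //= => [/seg_catl + [<-]|/seg_catr/IH + sk].
  by rewrite psum0 addn0.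
by rewrite psum_cons addnA; apply.
Qed.

End Segments.

Lemma size_flatten_map T (f : T -> seq nat) s :
  size (flatten (map f s)) = psum (size \o f) s (size s).
Proof. by rewrite psum_size size_flatten /shape -map_comp. Qed.

Lemma nth_allpairs S T (s : seq S) (t : seq T) (f : S -> T -> nat) x0 y0 n i j :
  size t = n -> i < size s -> j < n ->
  nth 0 [seq f x y | x <- s, y <- t] (i * n + j) = f (nth x0 s i) (nth y0 t j).
Proof.
move=> <-; elim: s i => [//|x s IH] [|i] /= lti ltj; rewrite nth_cat size_map.
  by rewrite mul0n ltj (nth_map y0).
by rewrite mulSn -addnA ltnNge leq_addr /= addKn IH.
Qed.

Lemma table_lt n m i j : i < n -> j < m -> i * m + j < n * m.
Proof.
by move=> ltn ltm; apply: leq_trans (leq_mul ltn (leqnn m)); rewrite mulSn; lia.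
Qed.

(** The letters of the postfix notation. A leaf takes two numbers of the input and an operator one,
    so sizes are counted in letters; their number is the recorded [tree_size]. *)
Inductive token (Sigma V : Type) : Type :=
| TVar (x : V)
| TAtom (a : Sigma)
| TOp (k : nat).
Arguments TVar {Sigma V} x.
Arguments TAtom {Sigma V} a.
Arguments TOp {Sigma V} k.

Fixpoint tokens (Sigma V : Type) (t : tree Sigma V) : seq (token Sigma V) :=
  match t with
  | Var x => [:: TVar x]
  | Atom a => [:: TAtom a]
  | Or t u => tokens t ++ tokens u ++ [:: TOp 2]
  | Not t => tokens t ++ [:: TOp 3]
  | EG t => tokens t ++ [:: TOp 4]
  | EU t u => tokens t ++ tokens u ++ [:: TOp 5]
  | EX t => tokens t ++ [:: TOp 6]
  end.

Definition enc_token (Sigma V : finType) (k : token Sigma V) : seq nat :=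
  match k with
  | TVar x => [:: 0; rank x] | TAtom a => [:: 1; rank a] | TOp k => [:: k]
  end.

Lemma size_tokens (Sigma V : Type) (t : tree Sigma V) : size (tokens t) = tree_size t.
Proof. by elim: t => //= *; rewrite !size_cat /=; lia. Qed.

Lemma enc_treeE (Sigma V : finType) (t : tree Sigma V) :
  enc_tree t = flatten (map (@enc_token Sigma V) (tokens t)).
Proof.
by elim: t => //= [t -> u ->|t ->|t ->|t -> u ->|t ->]; rewrite !map_cat !flatten_cat.
Qed.

Definition tok_ok (Sigma V : Type) (k : token Sigma V) :=
  if k is TOp k then k \in ops else true.

Lemma tokens_ok (Sigma V : Type) (t : tree Sigma V) : all (@tok_ok Sigma V) (tokens t).
Proof.
by elim: t => //= [t okt u oku|t okt|t okt|t okt u oku|t okt];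
  rewrite !all_cat ?okt ?oku.
Qed.

Section Layout.

Variables (Sigma : finType) (P N : seq (kripke Sigma)) (Gr : grammar Sigma).
Notation Ks := (P ++ N).
Notation inp := (enc_input P N Gr).

(** Input positions: of structure [k], of the grammar, of rule [k], and, relative to the start of a
    right-hand side, of its letter [k]. The summands 3 skip the two headers. *)
Definition spos k := 3 + psum (size \o @enc_kripke Sigma) Ks k.
Definition gpos := spos (size Ks).
Definition rpos k := gpos + 3 + psum (size \o @enc_rule Sigma (nonterm Gr)) (rules Gr) k.
Definition tpos (t : tree Sigma (nonterm Gr)) k :=
  psum (size \o @enc_token Sigma (nonterm Gr)) (tokens t) k.

Lemma at_sigma : at_ inp 0 #|Sigma|. Proof. by split. Qed.
Lemma at_P : at_ inp 1 (size P). Proof. by split. Qed.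
Lemma at_N : at_ inp 2 (size N). Proof. by split. Qed.

Lemma seg_kripke k K : onth Ks k = Some K -> seg inp (spos k) (enc_kripke K).
Proof.
have /seg_catr/seg_catl sg := @seg_inp inp; exact: seg_flatten.
Qed.

Lemma size_enc_kripke (K : kripke Sigma) :
  size (enc_kripke K) = 2 + (#|node K| * #|node K| + #|node K| * #|Sigma|).
Proof. by rewrite /enc_kripke !size_cat !size_allpairs -!cardE. Qed.

Lemma at_size k K : onth Ks k = Some K -> at_ inp (spos k) (kripke_size K).
Proof. by move/seg_kripke/seg_head. Qed.

Lemma at_start k K : onth Ks k = Some K -> at_ inp (spos k).+1 (rank (start K)).
Proof. by move/seg_kripke/seg_tail/seg_head. Qed.

Lemma at_edge k K v w : onth Ks k = Some K -> v < kripke_size K -> w < kripke_size K ->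
  at_ inp (spos k + 2 + v * kripke_size K + w) (edge K (nd K v) (nd K w)).
Proof.
move=> /seg_kripke/seg_catr/seg_catl sg ltv ltw.
have := sg (v * #|node K| + w); rewrite size_allpairs -cardE addnA.
rewrite (nth_allpairs _ (start K) (start K)) -?cardE //; apply.
exact: table_lt.
Qed.

Lemma at_label k K w (a : Sigma) : onth Ks k = Some K -> w < kripke_size K ->
  at_ inp (spos k + 2 + kripke_size K * kripke_size K + w * #|Sigma| + rank a)
    (a \in label K (nd K w)).
Proof.
move=> /seg_kripke/seg_catr/seg_catr sg ltw; have lta := rank_lt a.
have := sg (w * #|Sigma| + rank a); rewrite !size_allpairs -!cardE !addnA.
rewrite (nth_allpairs _ (start K) a) -?cardE // nth_rank; apply.
exact: table_lt.
Qed.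

Lemma seg_grammar : seg inp gpos (enc_grammar Gr).
Proof.
have /seg_catr/seg_catr := @seg_inp inp.
by rewrite /gpos /spos size_flatten_map.
Qed.

Lemma at_nonterm : at_ inp gpos #|nonterm Gr|.
Proof. exact: seg_head seg_grammar. Qed.

Lemma at_axiom : at_ inp (gpos + 1) (rank (axiom Gr)).
Proof. by rewrite addn1; exact: seg_head (seg_tail seg_grammar). Qed.

Lemma at_nrules : at_ inp (gpos + 2) (size (rules Gr)).
Proof. by rewrite addn2; exact: seg_head (seg_tail (seg_tail seg_grammar)). Qed.

Lemma seg_rule k r : onth (rules Gr) k = Some r -> seg inp (rpos k) (enc_rule r).
Proof. have /seg_catr sg := seg_grammar; exact: seg_flatten. Qed.

Lemma at_lhs k r : onth (rules Gr) k = Some r -> at_ inp (rpos k) (rank r.1).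
Proof. by move/seg_rule/seg_head. Qed.

Lemma at_tree_size k r : onth (rules Gr) k = Some r ->
  at_ inp (rpos k + 1) (size (tokens r.2)).
Proof. by rewrite addn1 size_tokens => /seg_rule/seg_tail/seg_head. Qed.

Lemma seg_token k r i tk : onth (rules Gr) k = Some r ->
  onth (tokens r.2) i = Some tk ->
  seg inp (rpos k + 2 + tpos r.2 i) (enc_token tk).
Proof.
move=> /seg_rule/seg_catr; rewrite enc_treeE; exact: seg_flatten.
Qed.

Lemma rposS k r : onth (rules Gr) k = Some r ->
  rpos k.+1 = rpos k + 2 + tpos r.2 (size (tokens r.2)).
Proof.
move=> rk; rewrite /rpos (psumS _ rk) /= /enc_rule enc_treeE /=.
by rewrite size_flatten_map -/(tpos _ _) -!addnA.
Qed.

(** This is how the first pass measures the input: after the last rule, its read position is the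
    length. *)
Lemma rpos_end : rpos (size (rules Gr)) = size inp.
Proof.
rewrite /rpos /gpos /spos -!size_flatten_map /enc_input size_cat.
by rewrite [size (_ ++ enc_grammar _)]size_cat [size (enc_grammar _)]size_cat !addnA.
Qed.

Lemma tposS t i tk : onth (tokens t) i = Some tk ->
  tpos t i.+1 = tpos t i + size (enc_token tk).
Proof. exact: psumS. Qed.

Lemma sposS k K : onth Ks k = Some K -> spos k.+1 =
  spos k + 2 + kripke_size K * kripke_size K + kripke_size K * #|Sigma|.
Proof.
by move=> sk; rewrite /spos (psumS _ sk) [(size \o _) K]size_enc_kripke /kripke_size; lia.
Qed.

End Layout.

(** * Reading the input *)

Notation rPtr := 0.
Notation rRes := 1.
Notation rN := 2.
Notation rD := 3.
Notation rP := 4.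
Notation rNxt := 5.
Notation rNe := 6.
Notation rQt := 7.
Notation rQh := 8.
Notation rSp := 9.
Notation rSig := 10.
Notation rM := 11.
Notation rPs := 12.
Notation rI := 13.
Notation rJ := 14.
Notation rK := 15.
Notation rL := 16.
Notation rLen := 17.

(** The sizes of the two bit tables are products; both tables are skipped together, by adding the
    lengths of one row of each per node. *)
Definition skip_structures :=
  rSig <~ Inp 0;; rM <~ Inp 1 + Inp 2;; rP <~ 3;;
  For rI rM (
    rLen <~ Inp $rP;; rP <~ $rP + 2;;
    For rJ rLen (rP <~ $rP + $rLen + $rSig)).

(** The test is zero exactly for the tags 0 and 1 of leaves, which are followed by an operand. *)
Definition skip_grammar :=
  rM <~ Inp ($rP + 2);; rP <~ $rP + 3;;
  For rI rM (
    rLen <~ Inp ($rP + 1);; rP <~ $rP + 2;;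
    For rJ rLen (Cond (Inp $rP - 1) (rP <~ $rP + 1) (rP <~ $rP + 2))).

Ltac simpl_state := rewrite /setr /seta /update /=.

Ltac use_frame fr :=
  repeat match goal with
  | |- context [rg ?s ?r] => rewrite (proj1 fr r isT)
  | |- context [ar ?s ?j] => rewrite (proj2 fr j isT)
  end.

Section Correctness.

Variables (Sigma : finType) (P N : seq (kripke Sigma)) (Gr : grammar Sigma).
Notation Ks := (P ++ N).
Notation inp := (enc_input P N Gr).
Notation n := (n_nodes Ks).
Notation D := (2 ^ n).

Lemma kripke_size_gt0 (K : kripke Sigma) : 0 < kripke_size K.
Proof. by apply/card_gt0P; exists (start K). Qed.

(** Every structure contains its start node. Loops over the structures can therefore be bounded in
    terms of the number of nodes. *)
Lemma size_le_total : size Ks <= n.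
Proof.
rewrite /n_nodes; elim: Ks => //= K s IH; have := kripke_size_gt0 K; lia.
Qed.

Lemma runs_skip_structures s :
  runs inp skip_structures s (6 * (n.+1 * n.+1)) (fun s' => rg s' rP = gpos P N).
Proof.
have le := size_le_total.
do 3!(apply: runs_Let_Then; first lia); simpl_state.
rewrite (amem_at _ (at_sigma P N Gr)) (amem_at _ (at_P P N Gr)) (amem_at _ (at_N P N Gr)).
set s0 := AState _ _.
pose I k s := rg s rP = spos P N k.
apply: runs_weaken (leqnn _) _.
  apply: (@runs_For _ I (3 * n + 5)) => //.
  - by rewrite /I /spos psum0.
  - move=> k s1 /= ltk fr1 ek Ik.
    have [K sk]: exists K, onth Ks k = Some K by apply: onth_lt; rewrite size_cat.
    do 2!(apply: runs_Let_Then; first lia); simpl_state.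
    rewrite Ik (amem_at _ (at_size Gr sk)).
    apply: runs_weaken (leqnn _) _.
      apply: (@runs_For _ (fun j s =>
        rg s rP = spos P N k + 2 + j * (kripke_size K + #|Sigma|)) 1) => //=.
      + by rewrite /update /= mul0n addn0.
      + move=> j s2 /= ltj fr2 ej e2.
        apply: runs_Let => //; simpl_state.
        rewrite e2; use_frame fr2; rewrite /=; use_frame fr1; rewrite /= mulSn; lia.
      + have := kripke_size_le sk; lia.
    by move=> s2 fr2 /= e2; rewrite /I /= /update /= e2 (sposS sk) mulnDr addnA.
  have := leq_mul le (leqnn (3 * n + 5 + 2)); rewrite size_cat /=; nia.
rewrite /= -size_cat => s' _ //.
Qed.

Definition rule k := nth (axiom Gr, Var (axiom Gr)) (rules Gr) k.
Definition rule_size k := (size (tokens (rule k).2)).+1.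

Lemma onth_rule k : k < size (rules Gr) -> onth (rules Gr) k = Some (rule k).
Proof. by move=> lt; rewrite onthE (nth_map (axiom Gr, Var (axiom Gr))). Qed.

Lemma sum_rule_size : #|nonterm Gr| + \sum_(0 <= k < size (rules Gr)) rule_size k =
  grammar_size Gr.
Proof.
rewrite /grammar_size (big_nth (axiom Gr, Var (axiom Gr))); congr (_ + _).
by apply: eq_bigr => k _; rewrite /rule_size size_tokens.
Qed.

Lemma nonterm_gt0 : 0 < #|nonterm Gr|.
Proof. by apply/card_gt0P; exists (axiom Gr). Qed.

Lemma runs_skip_grammar s : rg s rP = gpos P N ->
  runs inp skip_grammar s (10 * grammar_size Gr) (fun s' => rg s' rP = size inp).
Proof.
move=> eP; rewrite -sum_rule_size; have := nonterm_gt0.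
set S := \sum_(_ <= _ < _) _; move=> gt0.
do 2!(apply: runs_Let_Then; first lia); simpl_state.
rewrite eP (amem_at _ (at_nrules _ _ _)).
set s0 := AState _ _.
pose I k s := rg s rP = rpos P N Gr k.
apply: runs_weaken (leqnn _) _.
  (* The loop rule adds 2 per round; subtracting it in advance makes the total [6 * S], as
     [rule_size] is positive. *)
  apply: (@runs_For_sum _ I (fun k => 6 * rule_size k - 2)) => //.
  - by rewrite /I /rpos psum0 addn0.
  - move=> k s1 /= ltk fr1 ek Ik; have rk := onth_rule ltk.
    do 2!(apply: runs_Let_Then; first by rewrite /rule_size; lia); simpl_state.
    rewrite Ik (amem_at _ (at_tree_size _ _ rk)).
    apply: runs_weaken (leqnn _) _.
      apply: (@runs_For _ (fun j s => rg s rP = rpos P N Gr k + 2 + tpos (rule k).2 j) 2) => //=.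
      + by rewrite /update /= /tpos psum0 addn0.
      + move=> j s2 /= ltj fr2 ej e2.
        have [tk tkj] := onth_lt ltj.
        have tok := onth_all (tokens_ok (rule k).2) tkj.
        have sg := seg_token P N rk tkj.
        have hd : amem inp s2 (rg s2 rP) = nth 0 (enc_token tk) 0.
          by rewrite e2 -[X in amem _ _ X]addn0; apply/amem_at/sg; case: (tk).
        apply: runs_Cond => //= c; apply: runs_Let => //; simpl_state;
        rewrite e2 (tposS tkj); move: c tok; rewrite hd; case: (tk) => [x|a|[|[|k']]] //= _ _; lia.
      + rewrite /rule_size; lia.
    by move=> s2 fr2 /= e2; rewrite /I /= /update /= e2 (rposS _ _ rk).
  rewrite /=.
  have -> : \sum_(0 <= k < size (rules Gr)) (6 * rule_size k - 2 + 2) = 6 * S.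
    rewrite /S big_distrr /=; apply: eq_bigr => k _; rewrite /rule_size; lia.
  move: S #|nonterm Gr| gt0 => S x gt0; lia.
by move=> s' _ e; apply: etrans e (rpos_end P N Gr).
Qed.

End Correctness.

(* Node [x] of the disjoint union belongs to the [aLen x] nodes that start at
   [aLo x]; [aRow x] and [aLab x] are the addresses of its rows in the input. *)
Notation aSt := 17.
Notation aRow := 13.
Notation aLab := 14.
Notation aLo := 15.
Notation aLen := 16.
Notation aPow := 18.
Arguments Put j%_nat_scope (i e)%_A.

(** * Tables for the disjoint union of the structures *)

Definition setup_row :=
  Put aRow ($rN + $rJ) $rP;; Put aLab ($rN + $rJ) $rL;;
  Put aLo ($rN + $rJ) $rN;; Put aLen ($rN + $rJ) $rLen;;
  rP <~ $rP + $rLen;; rL <~ $rL + $rSig.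

(** The first inner loop moves [rL] past the edge table to the labels, the second fills in one table
    row per node. [rN] is the offset of the current structure and ends up as the number of all
    nodes. *)
Definition setup_structures :=
  rSig <~ Inp 0;; rPs <~ Inp 1;; rM <~ $rPs + Inp 2;; rP <~ 3;; rN <~ 0;;
  For rI rM (
    rLen <~ Inp $rP;; Put aSt $rI ($rN + Inp ($rP + 1));;
    rP <~ $rP + 2;; rL <~ $rP;;
    For rJ rLen (rL <~ $rL + $rLen);;
    For rJ rLen setup_row;;
    rN <~ $rN + $rLen;; rP <~ $rL).

(** Tabulated powers of two stand in for the shifts that the machine lacks; the last doubling leaves
    [D] in [rD]. *)
Definition setup_powers :=
  rD <~ 1;; For rI rN (Put aPow $rI $rD;; rD <~ $rD + $rD).

Section Setup.

Variables (Sigma : finType) (P N : seq (kripke Sigma)) (Gr : grammar Sigma).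
Notation Ks := (P ++ N).
Notation inp := (enc_input P N Gr).
Notation n := (n_nodes Ks).
Notation D := (2 ^ n).
Notation off := (off Ks).
Notation spos := (spos P N).

Definition row_ok s k (K : kripke Sigma) w :=
  [/\ ar s aRow (off k + w) = spos k + 2 + w * kripke_size K,
      ar s aLab (off k + w) =
        spos k + 2 + kripke_size K * kripke_size K + w * #|Sigma|,
      ar s aLo (off k + w) = off k & ar s aLen (off k + w) = kripke_size K].

Definition start_ok s k (K : kripke Sigma) := ar s aSt k = off k + rank (start K).

Definition rows_ok s k := forall i K, i < k -> onth Ks i = Some K ->
  start_ok s i K /\ forall w, w < kripke_size K -> row_ok s i K w.

Lemma rows_ok_ext s s' k : (forall j, j \in [:: aSt; aRow; aLab; aLo; aLen] ->
  ar s' j = ar s j) -> rows_ok s k -> rows_ok s' k.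
Proof.
move=> e rows i K lti si; have [st rw] := rows i K lti si.
by rewrite /start_ok e //; split=> // w /rw; rewrite /row_ok !e.
Qed.

Lemma runs_setup_row s k K j : onth Ks k = Some K -> j < kripke_size K ->
  rows_ok s k -> (forall w, w < j -> row_ok s k K w) -> start_ok s k K ->
  rg s rN = off k -> rg s rJ = j -> rg s rLen = kripke_size K ->
  rg s rSig = #|Sigma| -> rg s rP = spos k + 2 + j * kripke_size K ->
  rg s rL = spos k + 2 + kripke_size K * kripke_size K + j * #|Sigma| ->
  runs inp setup_row s 6 (fun s' =>
    [/\ rows_ok s' k, forall w, w < j.+1 -> row_ok s' k K w, start_ok s' k K,
     rg s' rP = spos k + 2 + j.+1 * kripke_size K &
     rg s' rL = spos k + 2 + kripke_size K * kripke_size K + j.+1 * #|Sigma|]).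
Proof.
move=> sk ltj rows cur st eN eJ eLen eSig eP eL.
do 4!(apply: runs_Put_Then; first done; simpl_state).
apply: runs_Let_Then; first done; apply: runs_Let; first done.
simpl_state; rewrite eN eJ eLen eSig eP eL.
split=> //=; last by rewrite mulSn; move: #|_| => x; lia.
- move=> i K' lti si; have [st' rw] := rows i K' lti si; split=> // w ltw.
  (* Rows of earlier structures lie strictly below the current offset, so the new row does not touch
     them. *)
  have lt := psum_lt_psum si ltw lti.
  rewrite /row_ok /= ltn_eqF; first exact: rw.
  by apply: leq_trans lt _; apply: leq_addr.
- move=> w; rewrite ltnS leq_eqVlt => /predU1P[->|ltw]; rewrite /row_ok /=.
    by rewrite eqxx.
  by rewrite eqn_add2l ltn_eqF //; apply: cur.
by rewrite mulSn; lia.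
Qed.

Definition structs s :=
  [/\ rg s rN = n, rg s rM = size Ks, rg s rPs = size P & rows_ok s (size Ks)].

Lemma runs_setup_structures s :
  runs inp setup_structures s (40 * (n.+1 * n.+1)) (fun s' =>
    structs s' /\ rg s' rP = gpos P N).
Proof.
have le := size_le_total P N.
do 5!(apply: runs_Let_Then; first lia); simpl_state.
rewrite (amem_at _ (at_sigma P N Gr)) (amem_at _ (at_P P N Gr)) (amem_at _ (at_N P N Gr)).
set s0 := AState _ _.
pose I k s := [/\ rg s rP = spos k, rg s rN = off k & rows_ok s k].
apply: runs_weaken (leqnn _) _.
  apply: (@runs_For _ I (20 * n + 20)) => //.
  - by split=> //; rewrite /= /off /spos psum0.
  - move=> k s1 /= ltk fr1 ek [eP eN rows].
    have [K sk]: exists K, onth Ks k = Some K by apply: onth_lt; rewrite size_cat.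
    have leK := kripke_size_le sk.
    apply: runs_Let_Then; first lia.
    apply: runs_Put_Then; first lia.
    do 2!(apply: runs_Let_Then; first lia); simpl_state.
    rewrite eP eN ek addn1 (amem_at _ (at_size Gr sk)) (amem_at _ (at_start Gr sk)).
    set s2 := AState _ _.
    have rows2: rows_ok s2 k.
      move=> i K' lti si; have [st rw] := rows i K' lti si.
      by split=> //; rewrite /start_ok /= ltn_eqF.
    apply: (@runs_Then _ _ _ _ _ (3 * n + 2) (8 * n + 4)); last lia.
    + apply: (@runs_For _ (fun j s => rg s rL = spos k + 2 + j * kripke_size K) 1) => //=.
      * by rewrite /update /= mul0n addn0.
      * move=> j s3 /= ltj fr3 ej e3; apply: runs_Let => //; simpl_state.
        by rewrite e3; use_frame fr3; rewrite /= mulSn; lia.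
      * lia.
    + move=> s3 fr3 /= eL.
      have eLen : rg s3 rLen = kripke_size K by use_frame fr3.
      apply: (@runs_Then _ _ _ _ _ (8 * n + 2) 2) => //; last lia.
      * pose J j s := [/\ rows_ok s k, forall w, w < j -> row_ok s k K w, start_ok s k K,
         rg s rP = spos k + 2 + j * kripke_size K &
         rg s rL = spos k + 2 + kripke_size K * kripke_size K + j * #|Sigma|].
        apply: (@runs_For _ J 6) => //; last by rewrite eLen; lia.
        + split=> //; rewrite /= /update /= ?mul0n ?addn0 //.
          - by apply: rows_ok_ext rows2 => j _; use_frame fr3.
          - by rewrite /start_ok /=; use_frame fr3; rewrite /= eqxx.
          by use_frame fr3.
        + move=> j s4; rewrite eLen => ltj fr4 ej [rows4 cur st eP4 eL4].
          have eN4: rg s4 rN = off k by use_frame fr4; use_frame fr3; rewrite /= eN.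
          have eLen4: rg s4 rLen = kripke_size K by use_frame fr4.
          have eSig4: rg s4 rSig = #|Sigma|.
            by use_frame fr4; use_frame fr3; rewrite /=; use_frame fr1.
          have := runs_setup_row sk ltj rows4 cur st eN4 ej eLen4 eSig4 eP4 eL4.
          by move/runs_weaken; apply=> // s5 _ [].
      * rewrite eLen => s4 fr4 [rows4 cur st eP4 eL4].
        apply: runs_Let_Then => //; apply: runs_Let => //; simpl_state.
        rewrite eL4; have -> : rg s4 rN = off k by use_frame fr4; use_frame fr3; rewrite /= eN.
        have -> : rg s4 rLen = kripke_size K by use_frame fr4.
        split; rewrite /= ?(sposS sk) //; first by rewrite /off (psumS _ sk).
        move=> i K'; rewrite ltnS leq_eqVlt => /predU1P[->|lti]; last exact: rows4.
        by rewrite sk => -[<-].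
  have := leq_mul le (leqnn (20 * n + 22)); rewrite size_cat /=; nia.
move=> s' fr' [eP eN rows]; move: eP eN rows; rewrite /= -size_cat => eP eN rows.
have eM : rg s' rM = size Ks by use_frame fr'; rewrite size_cat.
split=> //; split=> //; last by use_frame fr'.
by rewrite eN /off psum_size.
Qed.

End Setup.

(** * Operators on coded meanings *)

Notation rV1 := 18.
Notation rV2 := 19.
Notation rX := 21.
Notation rY := 22.
Notation rV := 23.
Notation rR := 24.
Notation rT := 25.
Notation rCount := 29.
Notation rAcc := 30.

Notation aA := 19.
Notation aB := 20.
Notation aC := 21.
Notation aC2 := 22.
Notation aFa := 23.
Notation aFb := 24.

(** Binary digits from the top: a bit is set if the remainder reaches its power of two, which is
    then subtracted. *)
Definition decode j :=
  For rK rN (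
    rX <~ $rN - 1 - $rK;;
    Cond (At aPow $rX - $rV)
      (Put j $rX 0)
      (Put j $rX 1;; rV <~ $rV - At aPow $rX)).

Definition encode :=
  rR <~ 0;; For rX rN (Cond (At aC $rX) (rR <~ $rR + At aPow $rX) Nop).

(** A switch on the tag: going down from [$rT - 5], the first nonzero difference identifies the tag,
    and tag 0 falls through all tests. [aC], [aFa] and [aFb] receive [op_start], [op_and] and
    [op_or]. *)
Definition run_init :=
  For rX rN (
    Put aFa $rX (At aA $rX);; Put aFb $rX 0;; Put aC $rX (At aA $rX);;
    Cond ($rT - 5) (Put aFa $rX 1)
    (Cond ($rT - 4) (Put aFb $rX (At aB $rX);; Put aC $rX 0)
    (Cond ($rT - 3) (Put aC $rX 1)
    (Cond ($rT - 2) (Put aC $rX (1 - At aA $rX))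
    (Cond ($rT - 1) (Cond (At aA $rX) Nop (Put aC $rX (At aB $rX))) Nop))))).

Definition run_row :=
  rAcc <~ At aFb $rX;;
  Cond (At aFa $rX) (
    rLen <~ At aLen $rX;;
    For rY rLen (
      Cond (At aC (At aLo $rX + $rY))
        (Cond (Inp (At aRow $rX + $rY)) (rAcc <~ 1) Nop) Nop)) Nop;;
  Put aC2 $rX $rAcc.

(** The new set is built in [aC2] and copied back afterwards, so that all rows of one step read the
    same old set. *)
Definition run_step := For rX rN run_row;; For rX rN (Put aC $rX (At aC2 $rX)).

Definition run_op :=
  run_init;;
  rCount <~ 0;;
  Cond ($rT - 5) (rCount <~ 1) (Cond ($rT - 3) (rCount <~ $rN) Nop);;
  For rK rCount run_step.

Section Vectors.

Variables (Sigma : finType) (P N : seq (kripke Sigma)) (Gr : grammar Sigma).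
Notation Ks := (P ++ N).
Notation inp := (enc_input P N Gr).
Notation n := (n_nodes Ks).
Notation D := (2 ^ n).
Notation off := (off Ks).
Notation spos := (spos P N).
Notation glue := (glue Ks).

Definition powers s := rg s rD = D /\ forall i, i < n -> ar s aPow i = 2 ^ i.

Lemma runs_setup_powers s : structs P N s ->
  runs inp setup_powers s (4 * n + 3) (fun s' => structs P N s' /\ powers s').
Proof.
move=> [eN eM ePs rows]; apply: runs_Let_Then; first lia.
apply: runs_weaken (leqnn _) _.
  pose I k s := rg s rD = 2 ^ k /\ forall i, i < k -> ar s aPow i = 2 ^ i.
  apply: (@runs_For _ I 2) => //.
  - move=> k s1 /= ltk fr1 ek [eD pw].
    apply: runs_Put_Then => //; apply: runs_Let => //; simpl_state.
    rewrite ek eD addnn -mul2n -expnS; split=> // i.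
    by rewrite ltnS leq_eqVlt /= => /predU1P[->|lti]; rewrite ?eqxx // ltn_eqF // pw.
  - by rewrite /= /update /= eN; lia.
move=> s' fr; rewrite /= /update /= eN => -[eD pw]; split=> //.
split; try by use_frame fr.
by apply: rows_ok_ext rows => j; rewrite !inE => /or4P[| | |/orP[]] /eqP->; use_frame fr.
Qed.

Definition env s := structs P N s /\ powers s.

(** A boolean test on the program text, so that preservation of the environment holds by
    computation; [data_safe], [graph_safe] and [parse_safe] serve the same purpose for later
    invariants. *)
Definition env_safe c :=
  ~~ has (mem (written c)) [:: rN; rM; rPs; rD] &&
  ~~ has (mem (stored c)) [:: aSt; aRow; aLab; aLo; aLen; aPow].

Lemma env_frame c s s' : frame c s s' -> env_safe c -> env s -> env s'.
Proof.
move=> [fr fa] /andP[/hasPn sr /hasPn sa] [[eN eM ePs rows] [eD pw]].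
have er r : r \in [:: rN; rM; rPs; rD] -> rg s' r = rg s r by move=> rP; apply/fr/(sr r rP).
have ea j : j \in [:: aSt; aRow; aLab; aLo; aLen; aPow] -> ar s' j = ar s j.
  by move=> jP; apply/fa/(sa j jP).
split; split; rewrite ?er //; last by rewrite ea.
apply: rows_ok_ext rows => j jP; apply: ea.
by move: jP; rewrite !inE => /or4P[| | |/orP[]] ->; rewrite ?orbT.
Qed.

Definition bits s j (b : nat -> bool) := forall x, x < n -> ar s j x = b x.

Lemma runs_decode s j b : j != aPow -> env s -> rg s rV = num b n ->
  runs inp (decode j) s (6 * n + 2) (fun s' => bits s' j b).
Proof.
move=> jP [[eN _ _ _] [_ pw]] eV; apply: runs_weaken (leqnn _) _.
  pose I k s := rg s rV = num b (n - k) /\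
    forall x, n - k <= x < n -> ar s j x = b x.
  apply: (@runs_For _ I 4) => //.
  - by split=> [|x]; rewrite /= /update /= subn0 ?eV //; lia.
  - move=> k s1; rewrite eN => ltk fr ek [eV1 bs].
    have eN1: rg s1 rN = n by use_frame fr.
    have e1 : n - k = (n - k.+1).+1 by lia.
    apply: runs_Let_Then => //; simpl_state; rewrite eN1 ek.
    have -> : n - 1 - k = n - k.+1 by lia.
    have ePow x : x < n -> ar s1 aPow x = 2 ^ x.
      case: fr => _ fa lt; rewrite fa ?pw //=.
      by rewrite !inE eq_sym (negPf jP).
    have := num_bit b (n - k.+1); rewrite -e1 => nb.
    apply: runs_Cond => //=; rewrite /= eV1 ePow; try lia; move=> c.
      have b0 : b (n - k.+1) = false by move: nb; case: (b _) => //=; lia.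
      apply: runs_Put => //; rewrite /I; simpl_state; rewrite eV1 e1 /= b0 addn0.
      split=> // x; rewrite eqxx /=; case: eqP => [->|/eqP ne lt]; first by rewrite b0.
      by apply: bs; lia.
    have b1 : b (n - k.+1) by move: nb; case: (b _) => //=; lia.
    apply: runs_Put_Then => //; apply: runs_Let => //; rewrite /I; simpl_state.
    rewrite eV1 (eq_sym aPow) (negPf jP) ePow; last lia.
    rewrite e1 /= b1 mul1n addnK; split=> // x; rewrite eqxx.
    case: eqP => [->|/eqP ne lt]; first by rewrite b1.
    by apply: bs; lia.
  by rewrite eN; lia.
move=> s' fr; rewrite eN subnn => -[_ bs] x lt; exact: bs.
Qed.

Lemma runs_encode s b : env s -> bits s aC b ->
  runs inp encode s (4 * n + 3) (fun s' => rg s' rR = num b n).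
Proof.
move=> [[eN _ _ _] [_ pw]] bs; apply: runs_Let_Then; first lia.
apply: runs_weaken (leqnn _) _.
  apply: (@runs_For _ (fun k s => rg s rR = num b k) 2) => //=.
  - move=> k s1; rewrite /update /= eN => ltk fr ek eR.
    apply: runs_Cond => //=; use_frame fr; rewrite /= ek bs // => c.
      apply: runs_Let => //; simpl_state; rewrite eR; use_frame fr.
      by rewrite /= ek pw //; move: c; case: (b k); rewrite // mul1n.
    by apply: runs_Nop => //; move: c; rewrite /= eR; case: (b k); rewrite // addn0.
  - by rewrite /update /= eN; lia.
by move=> s' fr; rewrite /= /update /= eN.
Qed.

Notation holds s j X := (bits s j (glue X)).

Lemma runs_init s t X Y : t \in 0 :: ops -> env s -> rg s rT = t ->
  holds s aA X -> holds s aB Y ->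
  runs inp run_init s (12 * n + 2) (fun s' =>
    [/\ holds s' aC (op_start t X Y), holds s' aFa (op_and t X) &
        holds s' aFb (op_or t Y)]).
Proof.
move=> tP [[eN _ _ _] _] eT hA hB; apply: runs_weaken (leqnn _) _.
  pose I k s := forall x, x < k -> [/\ ar s aC x = glue (op_start t X Y) x,
    ar s aFa x = glue (op_and t X) x & ar s aFb x = glue (op_or t Y) x].
  apply: (@runs_For _ I 10) => //.
  - move=> k s1; rewrite eN => ltk fr ek Ik.
    have [eA eB eT1] : [/\ ar s1 aA = ar s aA, ar s1 aB = ar s aB & rg s1 rT = t].
      by split; use_frame fr.
    have fin (a b c : bool) r f : glue (op_start t X Y) k = a ->
        glue (op_and t X) k = b -> glue (op_or t Y) k = c ->
        (forall x, f aC x = if x == k then a : nat else ar s1 aC x) ->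
        (forall x, f aFa x = if x == k then b : nat else ar s1 aFa x) ->
        (forall x, f aFb x = if x == k then c : nat else ar s1 aFb x) ->
        I k.+1 (AState r f).
      move=> ea eb ec e1 e2 e3 x; rewrite /= e1 e2 e3 ltnS leq_eqVlt.
      move=> /predU1P[->|lt]; first by rewrite eqxx ea eb ec.
      by rewrite ltn_eqF //; apply: Ik.
    do 3!(apply: runs_Put_Then; first done); simpl_state; rewrite ek eA hA //.
    case: (opsP tP) => [|[|[|[|[|]]]]] et; rewrite et in eT1 fin;
    repeat (apply: runs_Cond => //=; rewrite eT1 => c; first [by [] | clear c]).
    + apply: runs_Nop => //.
      by apply: (fin (glue X k) (glue X k) false); rewrite // glue0.
    + apply: runs_Cond => //=; rewrite ek eA hA // => c.
        apply: runs_Nop => //; apply: (fin true (glue X k) false); rewrite ?glue0 //.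
          by rewrite glueU //; move: c; case: (glue X k).
        by move: c; case: (glue X k).
      apply: runs_Put => //; simpl_state; rewrite ek eB hB //.
      apply: (fin (glue Y k) (glue X k) false); rewrite ?glue0 //.
        by rewrite glueU //; move: c; case: (glue X k).
      by move=> x /=; case: eqP.
    + apply: runs_Put => //; simpl_state; rewrite ek eA hA //.
      apply: (fin (~~ glue X k) (glue X k) false); rewrite ?glue0 ?glueC //=.
      by move=> x /=; case: eqP; case: (glue X k).
    + apply: runs_Put => //; simpl_state; rewrite ek.
      apply: (fin true (glue X k) false); rewrite ?glue0 ?glueT //=.
      by move=> x /=; case: eqP.
    + apply: runs_Put_Then => //; apply: runs_Put => //; simpl_state; rewrite ek eB hB //.
      by apply: (fin false (glue X k) (glue Y k)); rewrite ?glue0 //= => x; case: eqP.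
    apply: runs_Put => //; simpl_state; rewrite ek.
    by apply: (fin (glue X k) true false); rewrite ?glue0 ?glueT //= => x; case: eqP.
  - by rewrite eN; lia.
by move=> s' _; rewrite eN => post; split=> x /post[].
Qed.

Lemma runs_row s x A B Z : env s -> rg s rX = x -> x < n ->
  holds s aFa A -> holds s aFb B -> holds s aC Z ->
  runs inp run_row s (5 * n + 6) (fun s' =>
    ar s' aC2 = update (ar s aC2) x (glue (fun K => B K :|: (A K :&: pre (Z K))) x)).
Proof.
move=> [[eN _ _ rows] _] eX ltx hA hB hZ.
case/locate: ltx eX => k K w sk ltw eX.
have ltx := glue_lt sk ltw.
have [_ /(_ w ltw)[eRow _ eLo eLen]] := rows k K (onth_size sk) sk.
apply: runs_Let_Then; first lia; rewrite /= eX hB //; set s1 := setr _ _ _.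
have leK := kripke_size_le sk.
(* The accumulator after [j] candidate successors. The scan is made only if the conjunct [A] holds
   at the node; otherwise the value stays [b 0]. *)
pose b j := glue B (off k + w) ||
  has (fun v => glue Z (off k + v) && edge K (nd K w) (nd K v)) (iota 0 j).
apply: (@runs_Then _ _ _ _ _ (5 * n + 4) 1 _
  (fun s' => rg s' rAcc = if glue A (off k + w) then b (kripke_size K) else b 0)); last lia.
    apply: runs_Cond => //; first lia; rewrite /s1 /= /update /= eX hA // => c.
      apply: runs_Let_Then; first lia; rewrite /= /update /= eX eLen; set s2 := setr _ _ _.
      have -> : glue A (off k + w) by case: (glue A _) c.
      apply: runs_weaken (leqnn _) _.
        apply: (@runs_For _ (fun j s => rg s rAcc = b j) 3) => //=.
        - by rewrite /s2 /s1 /= /update /= /b orbF.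
        - move=> j s3; rewrite /update /= => ltj fr ej eAcc.
          have bS : b j.+1 = b j || glue Z (off k + j) && edge K (nd K w) (nd K j).
            by rewrite /b -[j.+1]addn1 iotaD has_cat /= add0n orbF orbA.
          have ltj' := glue_lt sk ltj.
          have eX3 : rg s3 rX = off k + w by use_frame fr.
          apply: runs_Cond => //=; rewrite eX3 ej; use_frame fr; rewrite /= eLo hZ // => c1.
            apply: runs_Cond => //=; rewrite eX3 ej; use_frame fr; rewrite /= eRow.
              rewrite (amem_at _ (at_edge Gr sk ltw ltj)) => c2; apply: runs_Let => //.
              by rewrite /= /update /= bS; case: (glue Z _) (edge _ _ _) c1 c2 => [] [];
                rewrite // orbT.
            rewrite (amem_at _ (at_edge Gr sk ltw ltj)) => c2; apply: runs_Nop => //.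
            by rewrite /= /update /= eAcc bS; case: (edge _ _ _) c2; rewrite // andbF orbF.
          apply: runs_Nop => //.
          by rewrite /= /update /= eAcc bS; case: (glue Z _) c1; rewrite // orbF.
        - by rewrite /= /update /=; lia.
      by move=> s' _; rewrite /= /update /=.
    apply: runs_Nop => //; first lia.
    have -> : glue A (off k + w) = false by case: (glue A _) c.
    by rewrite /b /= /update /= orbF.
move=> s' fr eAcc; apply: runs_Put => //=.
have -> : rg s' rX = off k + w by use_frame fr.
rewrite eAcc; use_frame fr; rewrite glueU // glueI // (glue_pre _ sk ltw) /=.
by rewrite /b /= orbF; case: (glue A _); rewrite ?orbF.
Qed.

Lemma runs_step s A B Z : env s -> holds s aFa A -> holds s aFb B -> holds s aC Z ->
  runs inp run_step s (16 * (n.+1 * n.+1)) (fun s' =>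
    holds s' aC (fun K => B K :|: (A K :&: pre (Z K)))).
Proof.
move=> es hA hB hZ; have eN : rg s rN = n by case: es => [[]].
set W : fam Sigma := fun K => _ :|: _.
apply: (@runs_Then _ _ _ _ _ (n * (5 * n + 8) + 2) (3 * n + 2)); last lia.
  pose I k s := forall x, x < k -> ar s aC2 x = glue W x.
  apply: (@runs_For _ I (5 * n + 6)); rewrite ?eN //; last lia.
  move=> k s1 ltk fr ek Ik.
  have := @runs_row s1 k A B Z (env_frame fr isT es) ek ltk.
  rewrite /bits; use_frame fr => /(_ hA hB hZ)/runs_weaken; apply=> // s2 fr2 e2 x.
  rewrite /= e2 /update ltnS leq_eqVlt => /predU1P[->|lt]; first by rewrite eqxx.
  by rewrite ltn_eqF //; apply: Ik.
rewrite eN => s1 fr I1; have eN1 : rg s1 rN = n by use_frame fr.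
apply: runs_weaken (leqnn _) _.
  apply: (@runs_For _ (fun k s => forall x, x < k -> ar s aC x = glue W x) 1);
    rewrite ?eN1 //; last lia.
  move=> k s2 ltk fr2 ek Ik; apply: runs_Put => // x; rewrite /= /update ek.
  rewrite ltnS leq_eqVlt => /predU1P[->|lt]; first by rewrite eqxx; use_frame fr2; apply: I1.
  by rewrite ltn_eqF //; apply: Ik.
by rewrite eN1.
Qed.

(** At most [n.+1] rounds are made, each of quadratic cost because every node scans the nodes of its
    own structure. *)
Lemma runs_run_op s t X Y : t \in 0 :: ops -> env s -> rg s rT = t ->
  holds s aA X -> holds s aB Y ->
  runs inp run_op s (40 * (n.+1 * (n.+1 * n.+1))) (fun s' => holds s' aC (op t n X Y)).
Proof.
move=> tP es eT hA hB.
have le1 : n.+1 <= n.+1 * (n.+1 * n.+1) by rewrite leq_pmulr.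
apply: (@runs_Then _ _ _ _ _ (12 * n + 2) (1 + (3 + (n.+1 * (16 * (n.+1 * n.+1) + 2) + 2))));
  last by rewrite mulnDr mulnCA; lia.
  exact: runs_init tP es eT hA hB.
move=> s1 fr1 [hC hFa hFb]; have es1 := env_frame fr1 isT es.
have eT1 : rg s1 rT = t by use_frame fr1.
have eN1 : rg s1 rN = n by case: es1 => [[]].
apply: runs_Let_Then => //; simpl_state.
apply: (@runs_Then _ _ _ _ _ 3 (n.+1 * (16 * (n.+1 * n.+1) + 2) + 2) _
  (fun s' => rg s' rCount = op_count t n)).
- case: (opsP tP) => [|[|[|[|[|]]]]] et;
    repeat (apply: runs_Cond => //=; rewrite eT1 et => c; first [by [] | clear c]);
    by [apply: runs_Nop | apply: runs_Let].
- move=> s2 fr2 eC; have eN2 : rg s2 rN = n by use_frame fr2.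
  pose I k s := holds s aC (iter k (op_step t X Y) (op_start t X Y)).
  apply: runs_weaken (leqnn _) _; first apply: (@runs_For _ I (16 * (n.+1 * n.+1))) => //.
  + by rewrite /I /bits /=; use_frame fr2.
  + move=> k s3 ltk fr3 ek Ik.
    have es3 : env s3.
      by apply: (env_frame fr3 isT); apply: (env_frame fr2 isT); case: es1.
    have := @runs_step s3 (op_and t X) (op_or t Y) _ es3.
    rewrite /bits; use_frame fr3; use_frame fr2 => /(_ _ hFa hFb Ik)/runs_weaken.
    by apply.
  + rewrite eC leq_add2r leq_mul2r orbC; case: (opsP tP) => [|[|[|[|[|]]]]] -> //=; lia.
  by move=> s' _; rewrite eC.
lia.
Qed.

End Vectors.

(** * Saturation *)

(* The numbers of nodes are multiples of [D], so the cell of a node and a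
   meaning is their sum; it contains a tag (0 if unmarked) and two operands, in
   the output format.  Entry [e] of the clause table says that applying [aEt] to
   formulas of the nodes [aEl] and [aEr] gives a formula of the node [aEh]; it is
   in the list of the node [aEa].  Each clause has two entries, one in the list
   of each of its operands. *)
Notation rH := 26.
Notation rE := 27.
Notation rU := 28.
Notation rCell := 33.
Notation rG1 := 34.
Notation rG2 := 35.
Notation rG3 := 36.

Notation aTag := 0.
Notation aFst := 1.
Notation aSnd := 2.
Notation aHead := 3.
Notation aNext := 4.
Notation aEh := 5.
Notation aEt := 6.
Notation aEl := 7.
Notation aEr := 8.
Notation aEa := 9.
Notation aQn := 10.
Notation aQc := 11.

(** A marked cell is left alone, so pointers always lead to formulas found earlier. [rG1], [rG2] and
    [rG3] hold the contents proposed for the cell. *)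
Definition add_fact :=
  rCell <~ $rH + $rR;;
  Cond (At aTag $rCell) Nop (
    Put aTag $rCell $rG1;; Put aFst $rCell $rG2;; Put aSnd $rCell $rG3;;
    Put aQn $rQt $rH;; Put aQc $rQt $rCell;; rQt <~ $rQt + 1).

Definition fire_value :=
  rV <~ $rV1;; decode aA;; rV <~ $rV2;; decode aB;;
  rT <~ At aEt $rE;; run_op;; encode.

(** Tag 0 passes formulas from a right-hand side to its nonterminal. The operand's cell is then
    copied and not pointed to, since the output format has no indirections. *)
Definition fire_pair :=
  fire_value;;
  rH <~ At aEh $rE;;
  Cond $rT
    (rG1 <~ $rT;; rG2 <~ Adr (At aEl $rE + $rV1);; rG3 <~ Adr (At aEr $rE + $rV2))
    (rCell <~ At aEl $rE + $rV1;;
     rG1 <~ At aTag $rCell;; rG2 <~ At aFst $rCell;; rG3 <~ At aSnd $rCell);;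
  add_fact.

Definition fire :=
  For rV1 rD (Cond (At aTag (At aEl $rE + $rV1))
    (For rV2 rD (Cond (At aTag (At aEr $rE + $rV2)) fire_pair Nop)) Nop).

Definition saturate :=
  rQh <~ 0;;
  Loop ($rQt - $rQh) (
    rU <~ At aQn $rQh;; rQh <~ $rQh + 1;; rE <~ At aHead $rU;;
    Loop $rE (fire;; rE <~ At aNext $rE)).

Section Saturation.

Variables (Sigma : finType) (P N : seq (kripke Sigma)) (Gr : grammar Sigma).
Notation Ks := (P ++ N).
Notation inp := (enc_input P N Gr).
Notation n := (n_nodes Ks).
Notation D := (2 ^ n).
Notation glue := (glue Ks).
Notation code := (code Ks).
Notation env := (env P N).
Notation holds s j X := (bits P N s j (glue X)).

Variable nt : seq (tree Sigma (nonterm Gr)).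

Lemma D_gt0 : 0 < D. Proof. by rewrite expn_gt0. Qed.
Lemma n_lt_D : n < D. Proof. exact: ltn_expl. Qed.

(** In use, [nt] lists the nonterminals, followed by the positions of the right-hand sides that
    carry an atom or an operator. The spacing by [D] leaves one cell for each meaning. *)
Definition at_node u t := exists2 k, onth nt k = Some t & u = k * D.

Lemma at_node_inj u u' t t' v v' : at_node u t -> at_node u' t' ->
  v < D -> v' < D -> u + v = u' + v' -> [/\ u = u', v = v' & t = t'].
Proof.
move=> [k ntk ->] [k' ntk' ->] ltv ltv' e.
have ek : k = k'.
  have := congr1 (divn^~ D) e.
  by rewrite !divnMDl ?D_gt0 // !(divn_small ltv, divn_small ltv') !addn0.
by subst k'; split=> //; [move/addnI: e | move: ntk'; rewrite ntk => -[]].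
Qed.

Definition marked s c := ar s aTag c != 0.

(** The counterpart of [stores] for arrays: operands are entered as machine addresses from the
    start, so the table needs no conversion for the output. *)
Fixpoint cell_stores (m : nat -> nat -> nat) c (phi : ctl Sigma) : Prop :=
  let fst f := exists2 c', m aFst c = adr inp c' & cell_stores m c' f in
  let snd f := exists2 c', m aSnd c = adr inp c' & cell_stores m c' f in
  match phi with
  | Var x => match x with end
  | Atom a => m aTag c = 1 /\ m aFst c = rank a
  | Or f g => [/\ m aTag c = 2, fst f & snd g]
  | Not f => m aTag c = 3 /\ fst f
  | EG f => m aTag c = 4 /\ fst f
  | EU f g => [/\ m aTag c = 5, fst f & snd g]
  | EX f => m aTag c = 6 /\ fst f
  end.

Lemma cell_storesP s c phi :
  cell_stores (ar s) c phi -> stores (amem inp s) (adr inp c) phi.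
Proof.
have e0 c' : amem inp s (adr inp c') = ar s aTag c'.
  by rewrite -[adr inp c']addn0 amem_adr.
have e1 c' : amem inp s (adr inp c').+1 = ar s aFst c' by rewrite -addn1 amem_adr.
have e2 c' : amem inp s (adr inp c').+2 = ar s aSnd c' by rewrite -addn2 amem_adr.
elim: phi c => [[]|a|f IHf g IHg|f IHf|f IHf|f IHf g IHg|f IHf] c /=;
  rewrite e0 ?e1 ?e2.
- by [].
- by case=> -> [cf -> /IHf sf] [cg -> /IHg sg].
- by case=> -> [cf -> /IHf sf].
- by case=> -> [cf -> /IHf sf].
- by case=> -> [cf -> /IHf sf] [cg -> /IHg sg].
by case=> -> [cf -> /IHf sf].
Qed.

Definition same_cell s c s' c' :=
  [/\ ar s' aTag c' = ar s aTag c, ar s' aFst c' = ar s aFst c &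
      ar s' aSnd c' = ar s aSnd c].

(** The marked cells and the queue are append-only, which keeps stored formulas valid while new
    cells are written. *)
Definition grows s s' :=
  [/\ forall c, marked s c -> same_cell s c s' c, rg s rQt <= rg s' rQt &
      forall i, i < rg s rQt -> ar s' aQn i = ar s aQn i /\ ar s' aQc i = ar s aQc i].

Lemma grows_marked s s' c : grows s s' -> marked s c -> marked s' c.
Proof. by rewrite /marked => -[h _ _] m; have [-> _ _] := h c m. Qed.

Lemma grows_trans s s' s'' : grows s s' -> grows s' s'' -> grows s s''.
Proof.
move=> g1 g2; have [c1 q1 e1] := g1; have [c2 q2 e2] := g2; split.
- move=> c m; rewrite /same_cell; have [-> -> ->] := c2 c (grows_marked g1 m).
  exact: c1.
- exact: leq_trans q1 q2.
move=> i lt; have [-> ->] := e2 i (leq_trans lt q1); exact: e1.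
Qed.

Lemma cell_stores_marked s c phi : cell_stores (ar s) c phi -> marked s c.
Proof.
by rewrite /marked; case: phi => [[]|a|f g|f|f|f g|f] /= [] => [-> _|->|-> _|-> _|->|-> _].
Qed.

(** Only the root may move, from [c] to [c'], which covers the copying of a cell. All cells below it
    are marked, hence unchanged. *)
Lemma cell_stores_same s c s' c' phi :
  (forall d, marked s d -> same_cell s d s' d) -> same_cell s c s' c' ->
  cell_stores (ar s) c phi -> cell_stores (ar s') c' phi.
Proof.
move=> g; elim: phi c c' => [[]|a|f IHf f' IHf'|f IHf|f IHf|f IHf f' IHf'|f IHf] c c' /=;
  case=> e1 e2 e3; rewrite ?e1 ?e2 ?e3 //.
all: have keep h : (forall c c', same_cell s c s' c' -> cell_stores (ar s) c h ->
       cell_stores (ar s') c' h) -> forall d, cell_stores (ar s) d h -> cell_stores (ar s') d h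
  by move=> IH d sd; apply: (IH d) => //; apply/g/cell_stores_marked/sd.
- by case=> -> [d -> sd] [d' -> sd']; split=> //; [exists d|exists d'] => //;
    [apply: keep sd | apply: keep sd'].
- by case=> -> [d -> sd]; split=> //; exists d => //; apply: keep sd.
- by case=> -> [d -> sd]; split=> //; exists d => //; apply: keep sd.
- by case=> -> [d -> sd] [d' -> sd']; split=> //; [exists d|exists d'] => //;
    [apply: keep sd | apply: keep sd'].
by case=> -> [d -> sd]; split=> //; exists d => //; apply: keep sd.
Qed.

Definition facts s := forall c, marked s c -> exists u t phi,
  [/\ at_node u t, c = u + code phi, gen t phi & cell_stores (ar s) c phi].

(** The queue enumerates the marked cells without repetition; therefore a cell is popped at most
    once, and a marked cell cannot be forgotten. *)
Definition queue s :=
  [/\ forall i, i < rg s rQt -> marked s (ar s aQc i) /\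
        exists t v, [/\ at_node (ar s aQn i) t, v < D & ar s aQc i = ar s aQn i + v],
      forall i j, i < j -> j < rg s rQt -> ar s aQc i != ar s aQc j &
      forall c, marked s c -> exists2 i, i < rg s rQt & ar s aQc i = c].

(* A cell with the given contents represents [phi], now and later. *)
Definition represents s g1 g2 g3 phi := g1 != 0 /\ forall s' c, grows s s' ->
  ar s' aTag c = g1 -> ar s' aFst c = g2 -> ar s' aSnd c = g3 ->
  cell_stores (ar s') c phi.

Lemma runs_add_fact s t phi : facts s -> queue s ->
  at_node (rg s rH) t -> gen t phi -> rg s rR = code phi ->
  represents s (rg s rG1) (rg s rG2) (rg s rG3) phi ->
  runs inp add_fact s 8 (fun s' => [/\ facts s', queue s', grows s s' &
    marked s' (rg s rH + code phi)]).
Proof.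
move=> fs qs nd gt eR [g0 rep]; apply: runs_Let_Then => //; simpl_state.
rewrite eR; set c := _ + _; set s1 := AState _ _.
apply: runs_Cond => //= m; first by apply: runs_Nop => //; split=> //; exact: fs.
do 5!(apply: runs_Put_Then; first done; simpl_state).
apply: runs_Let; first done; simpl_state.
set s2 := AState _ _.
have gr : grows s s2.
  split=> [d md|//=|i lti] /=; last by rewrite ltn_eqF.
    by rewrite /same_cell /=; case: eqP => // ed; move: md; rewrite ed /marked m.
  by rewrite leq_addr.
have mk d : marked s2 d = (d == c) || marked s d.
  by rewrite /marked /=; case: (d =P c); rewrite ?g0.
(* [represents] speaks of all later states, in particular of the one in which the cell has just been
   written. *)
have cs : cell_stores (ar s2) c phi by apply: (rep s2 c gr); rewrite /= eqxx.
have [q1 q2 q3] := qs.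
split=> //; last by rewrite mk eqxx.
  move=> d; rewrite mk => /predU1P[->|md]; first by exists (rg s rH), t, phi.
  have [u [t' [psi [ndu -> gt' cs']]]] := fs d md.
  exists u, t', psi; split=> //; have [gr' _ _] := gr.
  apply: (cell_stores_same _ _ cs'); first exact: gr'.
  exact/gr'/(cell_stores_marked cs').
split.
- move=> i; rewrite /= addn1 ltnS leq_eqVlt => /predU1P[->|lti].
    rewrite eqxx mk eqxx; split=> //; exists t, (code phi); split=> //; exact: code_lt.
  by rewrite ltn_eqF // mk; have [-> ?] := q1 i lti; rewrite orbT.
- move=> i j ltij; rewrite /= addn1 ltnS leq_eqVlt => /predU1P[ej|ltj].
    have lti : i < rg s rQt by rewrite -ej.
    rewrite ej eqxx (ltn_eqF lti).
    by apply/eqP=> ec; have [] := q1 i lti; rewrite ec /marked m.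
  by rewrite (ltn_eqF ltj) (ltn_eqF (ltn_trans ltij ltj)) q2.
move=> d; rewrite mk => /predU1P[->|/q3[i lti <-]]; rewrite /= addn1.
  by exists (rg s rQt); rewrite ?eqxx.
by exists i; rewrite ?ltn_eqF // ltnW.
Qed.

Lemma runs_fire_value s t f g : env s -> rg s rV1 = code f -> rg s rV2 = code g ->
  ar s aEt (rg s rE) = t -> t \in 0 :: ops ->
  runs inp fire_value s (16 * n + 10 + 40 * (n.+1 * (n.+1 * n.+1)))
    (fun s' => rg s' rT = t /\ rg s' rR = code (build t f g)).
Proof.
move=> es e1 e2 eT tP; apply: runs_Let_Then; first lia; rewrite /= e1.
apply: (@runs_Then _ _ _ _ _ (6 * n + 2) (10 * n + 7 + 40 * (n.+1 * (n.+1 * n.+1)))); last lia.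
  by apply: (@runs_decode _ _ _ Gr _ _ (glue (semF f))).
move=> s1 fr1 hA; have es1 : env s1 by apply: (env_frame fr1).
apply: runs_Let_Then; first lia; rewrite /=; use_frame fr1; rewrite /= /update /= e2.
set s2 := setr _ _ _.
apply: (@runs_Then _ _ _ _ _ (6 * n + 2) (4 * n + 4 + 40 * (n.+1 * (n.+1 * n.+1)))); last lia.
  by apply: (@runs_decode _ _ _ Gr _ _ (glue (semF g))).
move=> s3 fr3 hB; have es3 : env s3 by apply: (env_frame fr3).
apply: runs_Let_Then; first lia; rewrite /=; use_frame fr3; rewrite /= /update /=.
use_frame fr1; rewrite /= /update /= eT; set s4 := setr _ _ _.
apply: (@runs_Then _ _ _ _ _ (40 * (n.+1 * (n.+1 * n.+1))) (4 * n + 3)); last lia.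
  apply: (@runs_run_op _ _ _ Gr s4 t (semF f) (semF g)) => //.
  by rewrite /bits /=; use_frame fr3.
move=> s5 fr5 hC; rewrite -code_op //.
have := runs_encode Gr (env_frame fr5 isT (es3 : env s4)) hC.
by move/runs_weaken; apply=> // s6 fr6 eR; split=> //; use_frame fr6; use_frame fr5.
Qed.

Definition cells_ok s := facts s /\ queue s.

Definition data_safe c := (rQt \notin written c) &&
  ~~ has (mem (stored c)) [:: aTag; aFst; aSnd; aQn; aQc].

Lemma cells_ok_frame c s s' :
  frame c s s' -> data_safe c -> cells_ok s -> cells_ok s' /\ grows s s'.
Proof.
move=> [fr fa] /andP[sr /hasPn sa] [fs [q1 q2 q3]].
have ea j : j \in [:: aTag; aFst; aSnd; aQn; aQc] -> ar s' j = ar s j.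
  by move=> jP; apply/fa/(sa j jP).
have [e0 e1 e2 e3 e4] : [/\ ar s' aTag = ar s aTag, ar s' aFst = ar s aFst,
  ar s' aSnd = ar s aSnd, ar s' aQn = ar s aQn & ar s' aQc = ar s aQc].
  by split; apply: ea.
have eQ := fr _ sr; have em c' : marked s' c' = marked s c' by rewrite /marked e0.
have gr : grows s s'.
  split=> [d _||i _]; [by rewrite /same_cell e0 e1 e2|by rewrite eQ|by rewrite e3 e4].
split=> //; split.
  move=> d; rewrite em => /fs[u [t [phi [nd -> gt cs]]]]; exists u, t, phi; split=> //.
  by have [sc _ _] := gr; apply: (cell_stores_same sc _ cs); apply/sc/(cell_stores_marked cs).
split=> [i|i j|d].
- by rewrite eQ e3 e4 em => /q1.
- by rewrite eQ e4; apply: q2.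
by rewrite eQ em e4 => /q3.
Qed.

Definition entry_ok s e := exists th tl tr,
  [/\ ar s aEt e \in 0 :: ops, at_node (ar s aEh e) th, at_node (ar s aEl e) tl,
      at_node (ar s aEr e) tr & forall f g, gen tl f -> gen tr g ->
      gen th (build (ar s aEt e) f g)].

(** The stored witness [f'] may be another formula than [f]; only their meanings are known to
    agree. *)
Lemma marked_fact s u t f : cells_ok s -> at_node u t -> marked s (u + code f) ->
  exists f', [/\ code f = code f', gen t f' & cell_stores (ar s) (u + code f) f'].
Proof.
move=> [fs _] nd /[dup] /fs[u' [t' [f' [nd' e gt cs]]]] m.
have [eu ef et] := at_node_inj nd nd' (code_lt _ _) (code_lt _ _) e.
by exists f'; rewrite et.
Qed.

Lemma represents_build s t cl cr f g : t \in ops ->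
  cell_stores (ar s) cl f -> cell_stores (ar s) cr g ->
  represents s t (adr inp cl) (adr inp cr) (build t f g).
Proof.
move=> tP sl sr; split=> [|s' c [gr _ _] e0 e1 e2]; first by case: t tP.
have tl : cell_stores (ar s') cl f.
  by apply: (cell_stores_same gr _ sl); apply/gr/(cell_stores_marked sl).
have tr : cell_stores (ar s') cr g.
  by apply: (cell_stores_same gr _ sr); apply/gr/(cell_stores_marked sr).
have t0 : t \in 0 :: ops by rewrite inE tP orbT.
case: (opsP t0) => [|[|[|[|[|]]]]] et; rewrite et in e0 tP *; rewrite //= e0 ?e1 ?e2.
- by split; [|exists cl|exists cr].
- by split; [|exists cl].
- by split; [|exists cl].
- by split; [|exists cl|exists cr].
by split; [|exists cl].
Qed.

Lemma represents_copy s c f : cell_stores (ar s) c f ->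
  represents s (ar s aTag c) (ar s aFst c) (ar s aSnd c) f.
Proof.
move=> sc; split=> [|s' c' [gr _ _] e0 e1 e2]; first exact: cell_stores_marked sc.
by apply: (cell_stores_same gr _ sc).
Qed.

(** The operator takes [40 * n.+1 ^ 3]; coding and bookkeeping take [16 * n + 24], at most
    [24 * n.+1]. The sum is below 64 cubes of [n.+1], and [n.+1 <= D]. *)
Definition pair_time := 64 * (D * (D * D)).

Lemma runs_fire_pair s e f g : env s -> cells_ok s -> rg s rE = e -> entry_ok s e ->
  rg s rV1 = code f -> rg s rV2 = code g ->
  marked s (ar s aEl e + code f) -> marked s (ar s aEr e + code g) ->
  runs inp fire_pair s pair_time (fun s' => [/\ cells_ok s', grows s s' &
    marked s' (ar s aEh e + code (build (ar s aEt e) f g))]).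
Proof.
move=> es ix eE [th [tl [tr [tP nh nl nr gb]]]] e1 e2 m1 m2.
have [f' [ef gf sf]] := marked_fact ix nl m1.
have [g' [eg gg sg]] := marked_fact ix nr m2.
have DD : n.+1 * (n.+1 * n.+1) <= D * (D * D) by rewrite !leq_mul // n_lt_D.
have le1 : n.+1 <= n.+1 * (n.+1 * n.+1) by rewrite leq_pmulr.
(* From here on the stored witnesses replace the given formulas, whose meanings they share. *)
rewrite (code_build tP ef eg).
apply: (@runs_Then _ _ _ _ _ (16 * n + 10 + 40 * (n.+1 * (n.+1 * n.+1))) 14 _
  (fun s' => rg s' rT = ar s aEt e /\ rg s' rR = code (build (ar s aEt e) f' g'))).
- by apply: runs_fire_value; rewrite ?eE ?e1 ?e2.
- move=> s1 fr1 [eT eR].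
  have es1 : env s1 by apply: (env_frame fr1).
  have [ix1 gr1] := cells_ok_frame fr1 isT ix.
  apply: runs_Let_Then => //; simpl_state; use_frame fr1; rewrite eE.
  set s2 := AState _ _.
  set phi := build _ f' g'; set c1 := _ + code f in m1 sf; set c2 := _ + code g in m2 sg.
  have sf1 : cell_stores (ar s1) c1 f'.
    by case: gr1 => sc _ _; apply: (cell_stores_same sc _ sf); apply/sc.
  have sg1 : cell_stores (ar s1) c2 g'.
    by case: gr1 => sc _ _; apply: (cell_stores_same sc _ sg); apply/sc.
  apply: (@runs_Then _ _ _ _ _ 5 8 _ (fun s3 => [/\ cells_ok s3, grows s s3,
    rg s3 rH = ar s aEh e, rg s3 rR = code phi &
    represents s3 (rg s3 rG1) (rg s3 rG2) (rg s3 rG3) phi])) => //.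
    have eQ3 s3 : rg s3 rH = ar s aEh e -> rg s3 rR = rg s1 rR ->
        ar s3 = ar s1 -> rg s3 rQt = rg s1 rQt ->
        represents s1 (rg s3 rG1) (rg s3 rG2) (rg s3 rG3) phi ->
        [/\ cells_ok s3, grows s s3, rg s3 rH = ar s aEh e, rg s3 rR = code phi &
          represents s3 (rg s3 rG1) (rg s3 rG2) (rg s3 rG3) phi].
      move=> eH eR3 ea eq; rewrite eR3 eR eH; split=> //.
      - by rewrite /cells_ok /facts /queue /marked ea eq.
      - by case: gr1 => a b c; rewrite /grows /marked /same_cell ea eq.
      by rewrite /represents /grows /marked /same_cell ea eq.
    apply: runs_Cond => //= eT0; rewrite eT in eT0.
      do 2!(apply: runs_Let_Then => //); apply: runs_Let => //.
      apply: eQ3 => //; simpl_state; use_frame fr1; rewrite eT eE e1 e2.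
      by apply: represents_build => //; move: tP; rewrite inE (negPf eT0).
    do 3!(apply: runs_Let_Then => //); apply: runs_Let => //.
    apply: eQ3 => //; simpl_state; use_frame fr1; rewrite eE e1 -/c1.
    have -> : phi = f' by rewrite /phi eT0.
    by have := represents_copy sf1; use_frame fr1.
  move=> s3 fr3 [[fs3 qs3] gr3 eH3 eR3 rep3].
  have := runs_add_fact fs3 qs3 _ (gb f' g' gf gg) eR3 rep3; rewrite eH3 => /(_ nh).
  move/runs_weaken; apply=> // s4 _ [fs4 qs4 gr4 m4]; split=> //.
  exact: grows_trans gr4.
by rewrite /pair_time; lia.
Qed.

(** Only operands marked in the initial state [s] count. Those marked during the firing are in the
    queue and get their turn later. *)
Definition fired s e s' := forall f g,
  marked s (ar s aEl e + code f) -> marked s (ar s aEr e + code g) ->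
  marked s' (ar s aEh e + code (build (ar s aEt e) f g)).

Lemma marked_code s u t k : cells_ok s -> at_node u t -> k < D -> marked s (u + k) ->
  exists f, k = code f.
Proof.
move=> [fs _] nd ltk /fs[u' [t' [f [nd' e _ _]]]]; exists f.
by have [] := at_node_inj nd nd' ltk (code_lt _ _) e.
Qed.

Lemma entry_ok_frame c s s' e : frame c s s' ->
  ~~ has (mem (stored c)) [:: aEh; aEt; aEl; aEr] -> entry_ok s e -> entry_ok s' e.
Proof.
move=> [_ fa] /hasPn sa; have ea j : j \in [:: aEh; aEt; aEl; aEr] -> ar s' j = ar s j.
  by move=> jP; apply/fa/(sa j jP).
by rewrite /entry_ok !ea.
Qed.

Definition fire_time := D * (D * (pair_time + 3) + 2 + 3) + 2.

Lemma runs_fire s e : env s -> cells_ok s -> rg s rE = e -> entry_ok s e ->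
  runs inp fire s fire_time (fun s' => [/\ cells_ok s', grows s s' & fired s e s']).
Proof.
move=> es ix eE eok; have [th [tl [tr [tP _ nl nr _]]]] := eok.
have eD : rg s rD = D by case: es => _ [].
(* Progress of the two nested loops, in the lexicographic order of the pairs of codes. *)
pose done k j s' := forall f g, code f < k \/ code f = k /\ code g < j ->
  marked s (ar s aEl e + code f) -> marked s (ar s aEr e + code g) ->
  marked s' (ar s aEh e + code (build (ar s aEt e) f g)).
apply: runs_weaken (leqnn _) _.
  pose I k s' := [/\ cells_ok s', grows s s' & done k 0 s'].
  apply: (@runs_For _ I (D * (pair_time + 3) + 2 + 1)); rewrite ?eD //.
  - by split=> // f g []; [|case].
  - move=> k s1 ltk fr1 ek [ix1 gr1 dn1].
    apply: runs_Cond => //=; first (by rewrite addn1); use_frame fr1;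
      rewrite eE ek => m; last first.
      apply: runs_Nop => //; first by rewrite addn1; lia.
      split=> // f g lt mf mg; apply: dn1 => //; case: lt => [|[_ //]].
      rewrite ltnS leq_eqVlt => /predU1P[ef|]; last by left.
      by have := grows_marked gr1 mf; rewrite ef /marked m.
    have [f0 ef0] := marked_code ix1 nl ltk m.
    apply: runs_weaken.
    + pose J j s' := [/\ cells_ok s', grows s1 s' & done k j s'].
      apply: (@runs_For _ J (pair_time + 1)); last exact: leqnn.
      * done.
      * by split.
      * have -> : rg s1 rD = D by use_frame fr1.
        move=> j s2 ltj fr2 ej [ix2 gr2 dn2].
        apply: runs_Cond => //=; first (by rewrite addn1); use_frame fr2; use_frame fr1;
          rewrite eE ej => m2; last first.
          apply: runs_Nop => //; first by rewrite addn1 /pair_time; have := D_gt0; nia.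
          split=> // f g lt mf mg; apply: dn2 => //; case: lt => [|[ef]]; first by left.
          rewrite ltnS leq_eqVlt => /predU1P[eg|]; last by right.
          by have := grows_marked gr2 (grows_marked gr1 mg); rewrite eg /marked m2.
        have [g0 eg0] := marked_code ix2 nr ltj m2.
        have es2 : env s2 by apply/(env_frame fr2 isT)/(env_frame fr1 isT).
        have eok2 : entry_ok s2 e.
          exact/(entry_ok_frame fr2 isT)/(entry_ok_frame fr1 isT).
        have := @runs_fire_pair s2 e f0 g0 es2 ix2; use_frame fr2; use_frame fr1.
        rewrite ek ej -ef0 -eg0 => /(_ eE eok2 erefl erefl (grows_marked gr2 m) m2).
        move/runs_weaken; apply=> [|s3 fr3 [ix3 gr3 m3]]; first by rewrite addn1.
        split; [exact: ix3|exact: grows_trans gr3|].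
        move=> f g lt mf mg; case: lt => [lt|[ef]].
          by apply: (grows_marked gr3); apply: dn2 => //; left.
        rewrite ltnS leq_eqVlt => /predU1P[eg|ltg].
          by rewrite (code_build tP (_ : _ = code f0) (_ : _ = code g0)) // -?ef0 -?eg0.
        by apply: (grows_marked gr3); apply: dn2 => //; right.
    + have -> : rg s1 rD = D by use_frame fr1.
      by rewrite -(addnA pair_time) [X in _ <= X.-1]addn1.
    move=> s2 fr2; have -> : rg s1 rD = D by use_frame fr1.
    move=> [ix2 gr2 dn2]; split; [exact: ix2|exact: grows_trans gr2|].
    move=> f g lt mf mg; apply: dn2 => //.
    case: lt => [|[_ //]]; rewrite ltnS leq_eqVlt => /predU1P[ef|]; last by left.
    by right; split=> //; apply: code_lt.
  - by rewrite /fire_time leq_add2r leq_mul2l -!addnA leqnn orbT.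
move=> s' _; rewrite eD => -[ix' gr' dn']; split=> // f g mf mg; apply: dn' => //.
by left; apply: code_lt.
Qed.

(** * Working off the queue *)

Fixpoint chain (next : nat -> nat) e es :=
  if es is e' :: es' then [/\ e = e', e != 0 & chain next (next e) es'] else e = 0.

Lemma runs_chain es s : env s -> cells_ok s -> (forall e, e \in es -> entry_ok s e) ->
  chain (ar s aNext) (rg s rE) es ->
  runs inp (Loop $rE (fire;; rE <~ At aNext $rE)) s (size es * (fire_time + 2) + 1)
    (fun s' => [/\ cells_ok s', grows s s' & forall e, e \in es -> fired s e s']).
Proof.
elim: es s => [|e es IH] s es_ ix eok; first by move=> e0; apply: runs_Loop_false.
case=> eE e0 ch; have eok_e := eok e (mem_head _ _).
apply: (@runs_Loop_true _ _ _ _ _ (fire_time + 1) (size es * (fire_time + 2) + 1) _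
  (fun s' => [/\ cells_ok s', grows s s', fired s e s' & rg s' rE = ar s aNext e])).
- exact: e0.
- apply: runs_Then (runs_fire es_ ix eE eok_e) _ (leqnn _) => s1 fr1 [ix1 gr1 fd1].
  apply: runs_Let => //; split=> //=; rewrite /update /=; use_frame fr1.
  by rewrite eE.
- move=> s1 fr1 [ix1 gr1 fd1 eE1].
  have eok1 e' : e' \in es -> entry_ok s1 e'.
    by move=> e'P; apply: (entry_ok_frame fr1) => //; apply: eok; rewrite inE e'P orbT.
  have es1 : env s1 by apply: (env_frame fr1).
  have := IH s1 es1 ix1 eok1; rewrite eE1; use_frame fr1; rewrite -{1}eE => /(_ ch).
  move/runs_weaken; apply=> // s2 _ [ix2 gr2 fd2]; split=> //; first exact: grows_trans gr2.
  move=> e'; rewrite inE => /predU1P[->|/fd2 fd'] f g mf mg.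
    by apply: (grows_marked gr2); apply: fd1.
  have := fd' f g; use_frame fr1; apply; exact: (grows_marked gr1).
by rewrite /= mulSn; lia.
Qed.

(** Reversed because entries are pushed at the front of their list. Numbering starts at 1, as 0 is
    the end mark of the lists. *)
Definition entries_at s u := [seq e <- rev (iota 1 (rg s rNe)) | ar s aEa e == u].

Definition valid_entry s e := 0 < e <= rg s rNe.

(** By the last condition, a clause is listed under each of its operands, so it is fired no matter
    which of them is popped last. *)
Definition graph s :=
  [/\ forall e, valid_entry s e -> entry_ok s e /\
         (ar s aEa e = ar s aEl e \/ ar s aEa e = ar s aEr e),
      forall u, chain (ar s aNext) (ar s aHead u) (entries_at s u) &
      forall e r, valid_entry s e -> r \in [:: aEl; aEr] -> exists e',
        [/\ valid_entry s e', ar s aEa e' = ar s r e &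
          forall j, j \in [:: aEh; aEt; aEl; aEr] -> ar s j e' = ar s j e]].

Definition graph_safe c := (rNe \notin written c) &&
  ~~ has (mem (stored c)) [:: aHead; aNext; aEh; aEt; aEl; aEr; aEa].

Lemma graph_frame c s s' : frame c s s' -> graph_safe c -> graph s -> graph s'.
Proof.
move=> fr /andP[sr sa]; have [fr1 fa] := fr; have eNe := fr1 _ sr.
have ea j : j \in [:: aHead; aNext; aEh; aEt; aEl; aEr; aEa] -> ar s' j = ar s j.
  by move=> jP; apply/fa; apply: (hasPn sa j jP).
case=> g1 g2 g3; split.
- move=> e; rewrite /valid_entry eNe => /g1[ok dir]; split; last by rewrite !ea.
  apply: (entry_ok_frame fr) ok; apply/hasPn=> j jP; apply: (hasPn sa).
  by move: jP; rewrite !inE => /or4P[] ->; rewrite ?orbT.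
- by move=> u; rewrite /entries_at eNe !ea.
move=> e r; rewrite /valid_entry eNe => ve rP; have [e' [ve' e1 e2]] := g3 e r ve rP.
exists e'; split=> //; first by rewrite !ea //; move: rP; rewrite !inE => /orP[] ->; rewrite ?orbT.
move=> j jP; have jP' : j \in [:: aHead; aNext; aEh; aEt; aEl; aEr; aEa].
  by move: jP; rewrite !inE => /or4P[] ->; rewrite ?orbT.
by rewrite !ea // e2.
Qed.

(** Closure restricted to operands already popped. When the queue is exhausted, every marked cell
    has been popped, and this becomes [saturated]. *)
Definition closed_below s q := forall e f g i j, valid_entry s e -> i < q -> j < q ->
  ar s aQc i = ar s aEl e + code f -> ar s aQc j = ar s aEr e + code g ->
  marked s (ar s aEh e + code (build (ar s aEt e) f g)).

Definition saturated s := forall e f g, valid_entry s e ->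
  marked s (ar s aEl e + code f) -> marked s (ar s aEr e + code g) ->
  marked s (ar s aEh e + code (build (ar s aEt e) f g)).

Definition weight s u := 5 + size (entries_at s u) * (fire_time + 2).

Definition n_cells := size nt * D.

(** The sum extends over all cells not yet popped, marked or not: new marks cannot increase it, and
    every pop removes exactly the budget of the popped cell. *)
Definition potential s := \sum_(c < n_cells |
  val c \notin [seq ar s aQc i | i <- iota 0 (rg s rQh)]) weight s (c %/ D * D).

Lemma at_node_cell u t v : at_node u t -> v < D ->
  u + v < n_cells /\ (u + v) %/ D * D = u.
Proof.
move=> [k ntk ->] ltv; rewrite divnMDl ?D_gt0 // divn_small // addn0; split=> //.
by apply: table_lt ltv; apply: onth_size ntk.
Qed.

Lemma potential_pop s s' : let q := rg s rQh in
  rg s' rQh = q.+1 -> (forall i, i <= q -> ar s' aQc i = ar s aQc i) ->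
  (forall u, entries_at s' u = entries_at s u) -> ar s aQc q < n_cells ->
  (forall i, i < q -> ar s aQc i != ar s aQc q) ->
  potential s = weight s (ar s aQc q %/ D * D) + potential s'.
Proof.
move=> q eQ eC eE lt ne; rewrite /potential (bigD1 (Ordinal lt)) /=; last first.
  apply/mapP=> -[i]; rewrite mem_iota => /= lti /eqP; apply/negP.
  by rewrite eq_sym ne.
congr (_ + _); rewrite eQ -[q.+1]addn1 iotaD map_cat /= add0n eC //.
have -> : [seq ar s' aQc i | i <- iota 0 q] = [seq ar s aQc i | i <- iota 0 q].
  by apply/eq_in_map => i; rewrite mem_iota => /= lti; rewrite eC // ltnW.
apply: eq_big => [c|c _]; last by rewrite /weight eE.
by rewrite mem_cat inE negb_or -val_eqE.
Qed.

Lemma runs_saturate s : env s -> cells_ok s -> graph s ->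
  runs inp saturate s (\sum_(c < n_cells) weight s (c %/ D * D) + 2)
    (fun s' => [/\ cells_ok s', graph s', grows s s' & saturated s']).
Proof.
move=> es ix gr; apply: runs_Let_Then; first by rewrite addn2.
pose J s' := [/\ cells_ok s', rg s' rQh <= rg s' rQt, grows s s' & closed_below s' (rg s' rQh)].
apply: runs_weaken.
- apply: (@runs_Loop _ _ _ _ J potential); last exact: leqnn.
  + by split=> // e f g i j.
  + move=> s1 fr1 [ix1 le1 gr1 cl1] /= ne0.
    have es1 : env s1 by apply: (env_frame fr1).
    have gr_1 : graph s1 by apply: (graph_frame fr1).
    have lt1 : rg s1 rQh < rg s1 rQt by lia.
    set q := rg s1 rQh; set u := ar s1 aQn q; set c := ar s1 aQc q.
    have [fs1 [q1 q2 q3]] := ix1; have [mc [t [v [ndu ltv ec]]]] := q1 q lt1.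
    have [ltc ecu] := at_node_cell ndu ltv; rewrite -ec in ltc ecu.
    have [g1 g2 g3] := gr_1.
    exists (4 + size (entries_at s1 u) * (fire_time + 2)).
      rewrite /potential (bigD1 (Ordinal ltc)) /=; last first.
        apply/mapP=> -[i]; rewrite mem_iota => /= lti /eqP; apply/negP.
        by rewrite eq_sym q2.
      by rewrite ecu /weight -/u; move: (size _ * _) => A; lia.
    do 3!(apply: runs_Let_Then; first by []); rewrite /= /update /=.
    set s2 := setr _ _ _.
    have ix2 : cells_ok s2 by [].
    have eok2 e : e \in entries_at s1 u -> entry_ok s2 e.
      rewrite mem_filter mem_rev mem_iota add1n ltnS => /andP[_ ve].
      by have [] := g1 e ve.
    have /runs_weaken := @runs_chain (entries_at s1 u) s2 es1 ix2 eok2 (g2 u).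
    apply; first by rewrite addnC.
    move=> s3 fr3 [ix3 gr3 fd3].
    have gr13 : grows s1 s3 by exact: gr3.
    have eQh : rg s3 rQh = q.+1 by use_frame fr3; rewrite /= /update /= addn1.
    have eQc i : i <= q -> ar s3 aQc i = ar s1 aQc i.
      by move=> lei; have [_ _ h] := gr13; have [] := h i (leq_ltn_trans lei lt1).
    have ents w : entries_at s3 w = entries_at s1 w.
      by rewrite /entries_at; use_frame fr3.
    split.
      split=> //; [|exact: grows_trans gr13|].
        by rewrite eQh; case: gr13 => _ h _; apply: leq_trans h.
      rewrite eQh => e f g i j ve; rewrite !ltnS => lei lej; rewrite !eQc //.
      have ve1 : valid_entry s1 e by move: ve; rewrite /valid_entry; use_frame fr3.
      use_frame fr3; rewrite /= => ei ej.
      have [[th [tl [tr [_ _ nl nr _]]]] _] := g1 e ve1.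
      have [mi _] := q1 i (leq_ltn_trans lei lt1); rewrite ei in mi.
      have [mj _] := q1 j (leq_ltn_trans lej lt1); rewrite ej in mj.
      (* If one operand is the cell just popped, the copy of the clause in the list of its node has
         been fired in this round. *)
      have key r : r \in [:: aEl; aEr] -> ar s1 r e = u ->
          marked s3 (ar s1 aEh e + code (build (ar s1 aEt e) f g)).
        move=> rP eu; have [e' [ve' ea' same]] := g3 e r ve1 rP.
        have /fd3 : e' \in entries_at s1 u.
          by rewrite mem_filter mem_rev mem_iota add1n ltnS ea' eu eqxx.
        by move=> /(_ f g); rewrite /= !same //; apply.
      move: lei; rewrite leq_eqVlt => /predU1P[eiq|lti].
        apply: (key aEl) => //; rewrite eiq ec in ei.
        by have [<- _ _] := at_node_inj ndu nl ltv (code_lt _ _) ei.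
      move: lej; rewrite leq_eqVlt => /predU1P[ejq|ltj].
        apply: (key aEr) => //; rewrite ejq ec in ej.
        by have [<- _ _] := at_node_inj ndu nr ltv (code_lt _ _) ej.
      by apply: (grows_marked gr13); apply: (cl1 e f g i j).
    rewrite (@potential_pop s1 s3) ?eQh // => [|i lti]; last exact: q2.
    by rewrite ecu /weight -/u; move: (size _ * _) => A; lia.
- apply: leq_ltn_trans (_ : _ <= \sum_(c < n_cells) weight s (c %/ D * D)) _; last lia.
  by rewrite /potential /=; under eq_bigl do rewrite /=; exact: leqnn.
move=> s' fr [[ix' le' gr' cl'] /= e0]; have eq : rg s' rQh = rg s' rQt by lia.
split=> //; first exact: (graph_frame fr).
move=> e f g ve mf mg; have [_ [_ _ q3]] := ix'.
have [i lti ei] := q3 _ mf; have [j ltj ej] := q3 _ mg.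
by apply: (cl' e f g i j); rewrite // eq.
Qed.

End Saturation.

(** * Parsing the grammar *)

Notation rCl := 31.
Notation rCr := 32.
Notation rNr := 37.
Notation rAx := 38.
Notation rLhs := 39.
Notation rTl := 40.
Notation aStk := 12.

(** Multiplication by [D] through [n] doublings; it takes the index of a grammar node to its
    number. *)
Definition shift r := For rX rN (r <~ $r + $r).

Definition add_entry r :=
  rNe <~ $rNe + 1;;
  Put aEh $rNe $rH;; Put aEt $rNe $rT;; Put aEl $rNe $rCl;; Put aEr $rNe $rCr;;
  Put aEa $rNe $r;; Put aNext $rNe (At aHead $r);; Put aHead $r $rNe.

Definition add_clause := add_entry rCl;; add_entry rCr.

Definition parse_var := rH <~ Inp $rP;; rP <~ $rP + 1;; shift rH.

Definition atom_value :=
  For rX rN (Put aC $rX (Inp (At aLab $rX + $rG2)));; encode.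

(** An atom needs no clause: its only fact is entered at once. These facts are the seeds of the
    saturation. *)
Definition parse_atom :=
  rH <~ $rNxt;; rNxt <~ $rNxt + $rD;;
  rG2 <~ Inp $rP;; rP <~ $rP + 1;;
  atom_value;;
  rG1 <~ 1;; rG3 <~ 0;; add_fact.

Definition pop_left := rSp <~ $rSp - 1;; rCl <~ At aStk $rSp.

(** The right operand is on top of the stack. A second one is popped for tags 2 and 5 only; a unary
    operator gets the same node as both operands, so that clauses have a uniform shape. *)
Definition pop_args :=
  rSp <~ $rSp - 1;; rCr <~ At aStk $rSp;; rCl <~ $rCr;;
  Cond ($rT - 2) (Cond ($rT - 4) (Cond ($rT - 5) Nop pop_left) Nop) pop_left.

Definition parse_op := rH <~ $rNxt;; rNxt <~ $rNxt + $rD;; pop_args;; add_clause.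

Definition parse_token :=
  rT <~ Inp $rP;; rP <~ $rP + 1;;
  Cond $rT (Cond ($rT - 1) parse_op parse_atom) parse_var;;
  Put aStk $rSp $rH;; rSp <~ $rSp + 1.

(** Besides the nodes of its right-hand side, a rule contributes a clause with tag 0 from their root
    to the nonterminal. *)
Definition parse_rule :=
  rLhs <~ Inp $rP;; shift rLhs;;
  rTl <~ Inp ($rP + 1);; rP <~ $rP + 2;;
  For rJ rTl parse_token;;
  rSp <~ $rSp - 1;;
  rH <~ $rLhs;; rT <~ 0;; rCl <~ At aStk $rSp;; rCr <~ $rCl;;
  add_clause.

Definition parse_grammar :=
  rNxt <~ Inp $rP;; shift rNxt;;
  rAx <~ Inp ($rP + 1);; shift rAx;;
  rNr <~ Inp ($rP + 2);; rP <~ $rP + 3;;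
  rNe <~ 0;; rQt <~ 0;; rSp <~ 0;;
  For rI rNr parse_rule.

(** * Postfix notation read with a stack *)

Section Postfix.

Variables Sigma V : Type.

Definition unary := [:: 3; 4; 6].

(** The stack of trees that the machine's stack of node numbers stands for. A unary operator doubles
    its operand, in accordance with [pop_args]. *)
Definition tok_step (k : token Sigma V) (st : seq (tree Sigma V)) :=
  match k, st with
  | TVar x, _ => Some (Var x :: st)
  | TAtom a, _ => Some (Atom a :: st)
  | TOp k, t :: st' =>
      if k \in unary then Some (build k t t :: st')
      else if st' is u :: st'' then Some (build k u t :: st'') else None
  | TOp _, [::] => None
  end.

Fixpoint tok_run ts st :=
  if ts is k :: ts' then obind (tok_run ts') (tok_step k st) else Some st.

Lemma tok_run_tokens t ts st : tok_run (tokens t ++ ts) st = tok_run ts (t :: st).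
Proof.
by elim: t ts st => //= [t IHt u IHu|t IHt|t IHt|t IHt u IHu|t IHt] ts st;
  rewrite -?catA IHt ?IHu.
Qed.

End Postfix.

Lemma drop_onth T (s : seq T) i x : onth s i = Some x -> drop i s = x :: drop i.+1 s.
Proof. by elim: s i => [|y s IH] [|i] //= => [[->]|/IH //]; rewrite drop0. Qed.

Section Parsing.

Variables (Sigma : finType) (P N : seq (kripke Sigma)) (Gr : grammar Sigma).
Notation Ks := (P ++ N).
Notation inp := (enc_input P N Gr).
Notation n := (n_nodes Ks).
Notation D := (2 ^ n).
Notation code := (code Ks).
Notation env := (env P N).
Notation trees := (seq (tree Sigma (nonterm Gr))).
Implicit Types (nt st : trees).
Notation at_node := (at_node P N).
Notation cells_ok := (cells_ok P N).
Notation graph := (graph P N).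
Notation entry_ok := (entry_ok P N).
Notation rule := (rule Gr).

Lemma runs_shift s r v : rg s rN = n -> rg s r = v -> r != rX -> r != rN ->
  runs inp (shift r) s (3 * n + 2) (fun s' => rg s' r = v * D).
Proof.
move=> eN er rX_ rN_; apply: runs_weaken (leqnn _) _.
  apply: (@runs_For _ (fun k s => rg s r = v * 2 ^ k) 1).
  - by rewrite /= !inE eq_sym rN_ eq_sym rX_.
  - by rewrite /= /update (negPf rX_) er muln1.
  - move=> k s1 _ _ _ e1; apply: runs_Let => //=.
    by rewrite /update (negPf rX_) eqxx e1 addnn -mul2n mulnCA expnS.
  - by rewrite eN; lia.
by move=> s' _; rewrite eN.
Qed.

Lemma runs_atom_value s a : env s -> rg s rG2 = rank a ->
  runs inp atom_value s (7 * n + 5)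
    (fun s' => rg s' rR = code (Atom a)).
Proof.
move=> es eG; have [[eN _ _ rows] _] := es; rewrite code_atom.
apply: (@runs_Then _ _ _ _ _ (3 * n + 2) (4 * n + 3)); last lia.
  pose b x := glue Ks (fun K => [set w | a \in label K w]) x.
  apply: (@runs_For _ (fun k s => forall x, x < k -> ar s aC x = b x) 1); rewrite ?eN //; last lia.
  move=> k s1 ltk fr ek hk; apply: runs_Put => //= x; rewrite /update ek.
  rewrite ltnS leq_eqVlt => /predU1P[->|lt]; last by rewrite ltn_eqF // hk.
  rewrite eqxx; use_frame fr; rewrite eG /b; case/locate: ltk => i K w si ltw.
  have [_ /(_ w ltw)[_ -> _ _]] := rows i K (onth_size si) si.
  by rewrite (amem_at _ (at_label Gr a si ltw)) (glue_at _ si ltw) inE.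
rewrite eN => s1 fr hC; apply: runs_encode; first exact: (env_frame fr).
exact: hC.
Qed.

(** * The clause table *)

Definition entry_fields := [:: aEh; aEt; aEl; aEr; aEa].

Definition same_entries s s' := forall e, valid_entry s e ->
  forall j, j \in entry_fields -> ar s' j e = ar s j e.

Definition is_entry s e h tg l r a :=
  [/\ ar s aEh e = h, ar s aEt e = tg, ar s aEl e = l, ar s aEr e = r & ar s aEa e = a].

Lemma same_fields s s' e : same_entries s s' -> valid_entry s e ->
  is_entry s' e (ar s aEh e) (ar s aEt e) (ar s aEl e) (ar s aEr e) (ar s aEa e).
Proof. by move=> same ve; split; apply: same. Qed.

(** [graph] without its last condition, which may fail between the two entries made for one
    clause. *)
Definition pregraph nt s :=
  (forall e, valid_entry s e -> entry_ok nt s e /\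
     (ar s aEa e = ar s aEl e \/ ar s aEa e = ar s aEr e)) /\
  (forall u, chain (ar s aNext) (ar s aHead u) (entries_at s u)).

Definition clause_ok nt h tg l r := exists th tl tr,
  [/\ tg \in 0 :: ops, at_node nt h th, at_node nt l tl, at_node nt r tr &
    forall f g, gen tl f -> gen tr g -> gen th (build tg f g)].

Lemma chain_update next x v e es : x \notin es ->
  chain next e es -> chain (update next x v) e es.
Proof.
elim: es e => //= e' es IH e; rewrite inE negb_or => /andP[ne nx] [ee e0 ch].
by split=> //; rewrite /update ee eq_sym (negPf ne) -ee; apply: IH.
Qed.

Lemma runs_add_entry a s nt h tg l r : a \notin [:: rNe; rH; rT] ->
  rg s rH = h -> rg s rT = tg -> rg s rCl = l -> rg s rCr = r ->
  rg s a = l \/ rg s a = r -> clause_ok nt h tg l r -> pregraph nt s ->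
  runs inp (add_entry a) s 8 (fun s' => [/\ pregraph nt s', rg s' rNe = (rg s rNe).+1,
    same_entries s s' & is_entry s' (rg s rNe).+1 h tg l r (rg s a)]).
Proof.
rewrite !inE !negb_or => /and3P[aNe _ _] eh et el er ea ok [g1 g2].
apply: runs_Let_Then; first done; simpl_state; rewrite addn1.
do 6!(apply: runs_Put_Then; first done; simpl_state; rewrite ?(negPf aNe) ?eh ?et ?el ?er).
apply: runs_Put; first done; simpl_state; rewrite (negPf aNe).
set ne := rg s rNe; set s' := AState _ _.
have lt e : valid_entry s e -> (e == ne.+1) = false.
  by move=> /andP[_ le]; rewrite ltn_eqF // ltnS.
have new : is_entry s' ne.+1 h tg l r (rg s a) by rewrite /is_entry /= eqxx.
have same : same_entries s s'.
  by move=> e /lt le j; rewrite !inE => /or4P[| | |/orP[]] /eqP-> /=; rewrite le.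
have val e : valid_entry s' e -> e = ne.+1 \/ valid_entry s e.
  rewrite /valid_entry /= => /andP[e0]; rewrite leq_eqVlt => /predU1P[->|le]; first by left.
  by right; rewrite e0.
split=> //; split.
  move=> e /val[->|ve].
    by have [e1 e2 e3 e4 e5] := new; rewrite /entry_ok e1 e2 e3 e4 e5.
  have [e1 e2 e3 e4 e5] := same_fields same ve.
  by rewrite /entry_ok e1 e2 e3 e4 e5; apply: g1.
move=> u; rewrite /entries_at.
have -> : rev (iota 1 (rg s' rNe)) = ne.+1 :: rev (iota 1 ne).
  have -> : rg s' rNe = ne + 1 by rewrite addn1.
  by rewrite iotaD rev_cat add1n.
have old : [seq e <- rev (iota 1 ne) | ar s' aEa e == u] = entries_at s u.
  apply: eq_in_filter => e; rewrite mem_rev mem_iota add1n ltnS => ve.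
  by rewrite (same e ve).
(* The fresh entry occurs in no list, so setting its link leaves the old lists intact. *)
have nin w : ne.+1 \notin entries_at s w.
  by rewrite mem_filter mem_rev mem_iota add1n ltnn !andbF.
rewrite [filter _ _]/= old eqxx /= [u == _]eq_sym.
case: (_ == u) / eqP => [<-|ne']; last exact: chain_update.
by split=> //; rewrite eqxx; apply: chain_update.
Qed.

Lemma runs_add_clause s nt h tg l r :
  rg s rH = h -> rg s rT = tg -> rg s rCl = l -> rg s rCr = r ->
  clause_ok nt h tg l r -> graph nt s ->
  runs inp add_clause s 16 (fun s' => [/\ graph nt s', rg s' rNe = (rg s rNe).+2,
    same_entries s s' & is_entry s' (rg s rNe).+1 h tg l r l]).
Proof.
move=> eh et el er ok [g1 g2 g3]; have l1 : rg s rCl = l \/ rg s rCl = r by left.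
apply: (@runs_Then _ _ _ _ _ 8 8 _ _
  (@runs_add_entry rCl s nt h tg l r isT eh et el er l1 ok (conj g1 g2))) => //.
rewrite el => s1 fr1 [pg1 e1 sm1 new1].
have [eh1 et1 el1 er1] : [/\ rg s1 rH = h, rg s1 rT = tg, rg s1 rCl = l & rg s1 rCr = r].
  by split; use_frame fr1.
have l2 : rg s1 rCr = l \/ rg s1 rCr = r by right.
have := @runs_add_entry rCr s1 nt h tg l r isT eh1 et1 el1 er1 l2 ok pg1.
move/runs_weaken; apply=> // s2 _ [[pg2 ch2] e2 sm2 new2]; rewrite er1 e1 in new2.
rewrite e1 in e2; set ne := rg s rNe in e1 e2 new1 new2 *.
have v1 e : valid_entry s e -> valid_entry s1 e.
  by rewrite /valid_entry e1 => /andP[-> le]; apply: leqW.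
have sm : same_entries s s2.
  by move=> e ve j jP; rewrite (sm2 e (v1 e ve)) // (sm1 e ve).
have new : is_entry s2 ne.+1 h tg l r l.
  have ve : valid_entry s1 ne.+1 by rewrite /valid_entry e1 leqnn.
  have [e1' e2' e3' e4' e5'] := same_fields sm2 ve.
  by rewrite /is_entry e1' e2' e3' e4' e5'.
split=> //; split=> // e q ve qP.
(* Each new entry finds its partners among the two: [ne.+1] is listed under [l], and [ne.+2] under
   [r]. *)
have twin a : is_entry s2 e h tg l r a -> is_entry s2 ne.+1 h tg l r l ->
    is_entry s2 ne.+2 h tg l r r -> exists e', [/\ valid_entry s2 e',
    ar s2 aEa e' = ar s2 q e & forall j, j \in [:: aEh; aEt; aEl; aEr] -> ar s2 j e' = ar s2 j e].
  case=> f1 f2 f3 f4 f5 [p1 p2 p3 p4 p5] [q1 q2 q3 q4 q5].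
  move: qP; rewrite !inE => /orP[] /eqP->; [exists ne.+1|exists ne.+2];
    split; rewrite ?f3 ?f4 // /valid_entry ?e2 ?leqnn ?leqnSn //;
    by move=> j; rewrite !inE => /or4P[] /eqP->; rewrite ?f1 ?f2 ?f3 ?f4.
have /andP[e0] := ve; rewrite e2 leq_eqVlt => /predU1P[ee|].
  by apply: (twin r); rewrite ?ee.
rewrite ltnS leq_eqVlt => /predU1P[ee|le]; first by apply: (twin l); rewrite ?ee.
have ve0 : valid_entry s e by rewrite /valid_entry e0.
have [e' [ve' a1 a2]] := g3 e q ve0 qP.
have sub j : j \in [:: aEh; aEt; aEl; aEr] -> j \in entry_fields.
  by rewrite !inE => /or4P[] ->; rewrite ?orbT.
exists e'; split.
- by move: ve'; rewrite /valid_entry e2 => /andP[-> /leqW/leqW].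
- rewrite (sm e' ve') // (sm e ve0) //.
  by move: qP; rewrite !inE => /orP[] ->; rewrite ?orbT.
by move=> j jP; rewrite (sm e' ve') ?(sm e ve0) ?sub // a2.
Qed.

(** * The invariant of the parser *)

Lemma at_node_cat nt x u t : at_node nt u t -> at_node (nt ++ x) u t.
Proof.
by move=> [k ntk ->]; exists k; rewrite // onth_cat (onth_size ntk).
Qed.

Lemma at_node_last nt t : at_node (nt ++ [:: t]) (size nt * D) t.
Proof. by exists (size nt); rewrite // onth_cat ltnn subnn. Qed.

Lemma cells_ok_cat nt x s : cells_ok nt s -> cells_ok (nt ++ x) s.
Proof.
move=> [fs [q1 q2 q3]]; split.
  move=> c /fs[u [t [phi [nd -> gt cs]]]]; exists u, t, phi; split=> //.
  exact: at_node_cat.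
split=> // i /q1[m [t [v [nd lt e]]]]; split=> //; exists t, v; split=> //.
exact: at_node_cat.
Qed.

Lemma graph_cat nt x s : graph nt s -> graph (nt ++ x) s.
Proof.
move=> [g1 g2 g3]; split=> // e /g1[[th [tl [tr [tP nh nl nr gb]]]] ea]; split=> //.
by exists th, tl, tr; split=> //; apply: at_node_cat.
Qed.

Definition extends s s' :=
  [/\ grows s s', rg s rNe <= rg s' rNe & same_entries s s'].

Lemma extends_valid s s' e : extends s s' -> valid_entry s e -> valid_entry s' e.
Proof. by move=> [_ le _] /andP[e0 le']; rewrite /valid_entry e0 (leq_trans le'). Qed.

(** The converse of [entry_ok]: there every clause is sound, here every node has the fact or the
    clause that completeness requires. [rule_ok] does the same for the rules. *)
Variant node_ok nt s k t : Prop :=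
| Node_Var A of t = Var A & k = rank A
| Node_Atom a of t = Atom a & marked s (k * D + code (Atom a))
| Node_op e tl tr of valid_entry s e & ar s aEh e = k * D & ar s aEt e \in ops &
    at_node nt (ar s aEl e) tl & at_node nt (ar s aEr e) tr &
    t = build (ar s aEt e) tl tr &
    ar s aEt e \in unary -> ar s aEr e = ar s aEl e.

Definition rule_ok nt s (r : nonterm Gr * tree Sigma (nonterm Gr)) := exists e,
  [/\ valid_entry s e, ar s aEh e = rank r.1 * D, ar s aEt e = 0,
      at_node nt (ar s aEl e) r.2 & ar s aEr e = ar s aEl e].

Lemma node_ok_ext nt x s s' k t : extends s s' -> node_ok nt s k t ->
  node_ok (nt ++ x) s' k t.
Proof.
move=> ex; have [gr _ same] := ex.
case=> [A -> ->|a -> m|e tl tr ve eh tP nl nr -> un].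
- exact: Node_Var.
- by apply: (Node_Atom _ erefl); apply: (grows_marked gr).
have [e1 e2 e3 e4 _] := same_fields same ve.
apply: (@Node_op _ _ _ _ e tl tr); rewrite ?e1 ?e2 ?e3 ?e4 //;
  by [apply: extends_valid ve | apply: at_node_cat].
Qed.

Lemma rule_ok_ext nt x s s' r : extends s s' -> rule_ok nt s r ->
  rule_ok (nt ++ x) s' r.
Proof.
move=> ex [e [ve eh et nl er]]; exists e; have [_ _ same] := ex.
have [e1 e2 e3 e4 _] := same_fields same ve.
rewrite e1 e2 e3 e4; split=> //; [exact: extends_valid ve|exact: at_node_cat].
Qed.

Fixpoint stack_ok nt (stk : nat -> nat) sp st : Prop :=
  if st is t :: st' then
    exists sp', [/\ sp = sp'.+1, at_node nt (stk sp') t & stack_ok nt stk sp' st']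
  else sp = 0.

Lemma stack_ok_cat nt x stk sp st : stack_ok nt stk sp st -> stack_ok (nt ++ x) stk sp st.
Proof.
elim: st sp => //= t st IH sp [sp' [-> nd /IH ok]]; exists sp'; split=> //.
exact: at_node_cat.
Qed.

Lemma stack_ok_update nt stk sp sp0 st u : sp <= sp0 -> stack_ok nt stk sp st ->
  stack_ok nt (update stk sp0 u) sp st.
Proof.
elim: st sp => //= t st IH sp le [sp' [e nd ok]]; exists sp'; split=> //.
  by rewrite /update ltn_eqF // -e.
by apply: IH => //; rewrite ltnW // -e.
Qed.

(** The invariant after [dn] rules. The machine does not store [nt]; the list grows by one tree
    whenever a node number is drawn from [rNxt]. *)
Record parsed nt dn s : Prop := Parsed {
  parsed_env : env s;
  parsed_cells : cells_ok nt s;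
  parsed_graph : graph nt s;
  parsed_next : rg s rNxt = size nt * D;
  parsed_nodes : forall k t, onth nt k = Some t -> node_ok nt s k t;
  parsed_vars : forall A, onth nt (rank A) = Some (Var A);
  parsed_rules : forall k, k < dn -> rule_ok nt s (rule k)
}.

Lemma parsed_ext nt x dn s s' : parsed nt dn s -> extends s s' -> env s' ->
  cells_ok (nt ++ x) s' -> graph (nt ++ x) s' -> rg s' rNxt = size (nt ++ x) * D ->
  (forall t, x = [:: t] -> node_ok (nt ++ x) s' (size nt) t) -> size x <= 1 ->
  parsed (nt ++ x) dn s'.
Proof.
move=> [es ix gr nx nodes vars rules] ex es' ix' gr' nx' new sx; split=> //.
- move=> k t; rewrite onth_cat; case: ltnP => [_ /nodes|le]; first exact: node_ok_ext.
  case: x sx new {ix' gr' nx'} => [|t' []] // _ new; first by rewrite onth0n.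
  move/onth1P=> [e0 et]; have -> : k = size nt by apply/eqP; rewrite eqn_leq le -subn_eq0 e0.
  by rewrite -et; apply: new.
- by move=> A; rewrite onth_cat (onth_size (vars A)).
by move=> k /rules; apply: rule_ok_ext.
Qed.

Definition parse_safe c :=
  [&& env_safe c, data_safe c, graph_safe c & rNxt \notin written c].

Lemma extends_frame nt c s s' : frame c s s' -> cells_ok nt s -> data_safe c -> graph_safe c ->
  extends s s'.
Proof.
move=> fr ix dc gc; have [_ gr] := cells_ok_frame fr dc ix; split=> //.
  by case/andP: gc => ne _; rewrite (proj1 fr _ ne).
case/andP: gc => _ /hasPn sa e _ j jP; rewrite (proj2 fr) //; apply: sa.
by move: jP; rewrite !inE => /or4P[| | |/orP[]] ->; rewrite ?orbT.
Qed.

Lemma parsed_frame nt dn c s s' : frame c s s' -> parse_safe c -> parsed nt dn s ->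
  parsed nt dn s' /\ extends s s'.
Proof.
move=> fr /and4P[ec dc gc nc] pd; have ex := extends_frame fr (parsed_cells pd) dc gc.
split=> //; rewrite -[nt]cats0; apply: (parsed_ext pd ex) => //; rewrite ?cats0.
- exact: env_frame fr ec (parsed_env pd).
- by have [] := cells_ok_frame fr dc (parsed_cells pd).
- exact: graph_frame fr gc (parsed_graph pd).
- by rewrite (proj1 fr _ nc) (parsed_next pd).
Qed.

(** The expression [e] is arbitrary, because a frame depends only on what is assigned; a dummy
    assignment can thus stand for a change of state. *)
Lemma frame_setr r e s v : frame (r <~ e) s (setr s r v).
Proof. by split=> // r'; rewrite /= inE /update => /negPf->. Qed.

Definition token_post nt dn s p (tk : token Sigma (nonterm Gr)) t st s' := exists x,
  [/\ parsed (nt ++ x) dn s', at_node (nt ++ x) (rg s' rH) t,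
      stack_ok (nt ++ x) (ar s' aStk) (rg s' rSp) st,
      size x <= 1 /\ rg s' rNe <= rg s rNe + 2 &
      rg s' rP = p + size (enc_token tk)].

Lemma runs_parse_var nt dn s p A st : parsed nt dn s ->
  stack_ok nt (ar s aStk) (rg s rSp) st ->
  seg inp p (enc_token (TVar A : token Sigma (nonterm Gr))) -> rg s rP = p.+1 ->
  runs inp parse_var s (3 * n + 4) (token_post nt dn s p (TVar A) (Var A) st).
Proof.
move=> pd so sg eP; have vA := seg_head (seg_tail sg).
have eN : rg s rN = n by case: (parsed_env pd) => [[]].
have key : runs inp parse_var s (3 * n + 4)
    (fun s' => rg s' rH = rank A * D /\ rg s' rP = p + 2).
  apply: runs_Let_Then; first by rewrite addnS.
  apply: runs_Let_Then; first by rewrite !addnS.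
  simpl_state; rewrite eP (amem_at _ (seg_head (seg_tail sg))).
  apply: runs_weaken (runs_shift (v := rank A) _ _ _ _) _ _ => //; first lia.
  by move=> s1 fr1 eH; split=> //; use_frame fr1; rewrite /= addn1 addn2.
apply: runs_weaken key (leqnn _) _ => s1 fr1 [eH eP1].
have [pd1 _] := parsed_frame fr1 isT pd.
exists [::]; rewrite cats0 eH; split=> //.
- by exists (rank A); rewrite // (parsed_vars pd).
- by use_frame fr1.
by split=> //; use_frame fr1; rewrite leq_addr.
Qed.

Lemma runs_parse_atom nt dn s p a st : parsed nt dn s ->
  stack_ok nt (ar s aStk) (rg s rSp) st ->
  seg inp p (enc_token (TAtom a : token Sigma (nonterm Gr))) -> rg s rP = p.+1 ->
  runs inp parse_atom s (7 * n + 20) (token_post nt dn s p (TAtom a) (Atom a) st).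
Proof.
move=> pd so sg eP; have vA := seg_head (seg_tail sg).
have eN : rg s rN = n by case: (parsed_env pd) => [[]].
have eD : rg s rD = D by case: (parsed_env pd) => _ [].
pose nt' := nt ++ [:: Atom a]; pose t : tree Sigma (nonterm Gr) := Atom a.
have key : runs inp parse_atom s (7 * n + 20) (fun s' =>
    [/\ cells_ok nt' s', grows s s', rg s' rH = size nt * D,
      marked s' (size nt * D + code (Atom a)) & rg s' rNxt = size nt' * D /\ rg s' rP = p + 2]).
  do 4!(apply: runs_Let_Then; first by rewrite addnC); simpl_state.
  rewrite eP (amem_at _ vA) (parsed_next pd) eD.
  set s1 := AState _ _.
  apply: (@runs_Then _ _ _ _ _ (7 * n + 5) 10 _ (fun s' => rg s' rR = code (Atom a))).
  - by apply: runs_atom_value => //; apply: (parsed_env pd).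
  - move=> s2 fr2 eR; do 2!(apply: runs_Let_Then; first done).
    set s3 := setr _ _ _.
    have cx3 : cells_ok nt' s3 /\ grows s s3.
      have [cx gr] := cells_ok_frame fr2 isT (parsed_cells pd : cells_ok nt s1).
      by split=> //; apply: cells_ok_cat.
    have [[fs3 qs3] gr3] := cx3.
    have eH : rg s3 rH = size nt * D by rewrite /s3 /= /update /=; use_frame fr2.
    have rep : represents P N Gr s3 (rg s3 rG1) (rg s3 rG2) (rg s3 rG3) (Atom a).
      split=> // s' c _ /= -> ->; split=> //.
      by rewrite /s3 /= /update /=; use_frame fr2.
    have nd : at_node nt' (rg s3 rH) t by rewrite eH; apply: at_node_last.
    have := runs_add_fact fs3 qs3 nd (gen_Atom Gr a : gen t (Atom a)) _ rep => /(_ eR).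
    move/runs_weaken; apply=> // s4 fr4 [fs4 qs4 gr4 m4].
    have eP4 : rg s4 rP = p + 2.
      by use_frame fr4; rewrite /s3 /= /update /=; use_frame fr2; rewrite /= addn1 addn2.
    have eN4 : rg s4 rNxt = size nt' * D.
      use_frame fr4; rewrite /s3 /= /update /=; use_frame fr2.
      by rewrite /= /nt' size_cat mulnDl mul1n.
    split=> //; first exact: grows_trans gr4.
      by use_frame fr4.
    by rewrite -eH.
  by lia.
apply: runs_weaken key (leqnn _) _ => s1 fr1 [cx1 gr1 eH m1 [eN1 eP1]].
have ex : extends s s1.
  split=> //; first by use_frame fr1.
  by move=> e _ j; rewrite !inE => /or4P[| | |/orP[]] /eqP->; use_frame fr1.
exists [:: t]; rewrite eH; split=> //.
- apply: (parsed_ext pd ex) => //; first exact: env_frame fr1 isT (parsed_env pd).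
    by apply: graph_cat; apply: graph_frame fr1 isT (parsed_graph pd).
  by move=> _ [<-]; apply: Node_Atom m1.
- exact: at_node_last.
- by use_frame fr1; apply: stack_ok_cat.
by split=> //; use_frame fr1; rewrite leq_addr.
Qed.

Lemma runs_pop_args nt s k st t st0 : k \in ops -> rg s rT = k ->
  stack_ok nt (ar s aStk) (rg s rSp) st -> tok_step (TOp k) st = Some (t :: st0) ->
  runs inp pop_args s 8 (fun s' => exists tl tr,
    [/\ at_node nt (rg s' rCl) tl, at_node nt (rg s' rCr) tr, t = build k tl tr,
      k \in unary -> rg s' rCr = rg s' rCl &
      stack_ok nt (ar s aStk) (rg s' rSp) st0]).
Proof.
move=> kP eT + step.
case: st step => [//|t2 st1] step [sp1 [e1 nd2 so1]].
do 3!(apply: runs_Let_Then; first done); simpl_state; rewrite e1 subSS subn0.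
have k0 : k \in 0 :: ops by rewrite inE kP orbT.
have un : k \in unary -> t = build k t2 t2 /\ st0 = st1.
  by move: step => /= + ku; rewrite ku => -[-> ->].
have bi : k \notin unary -> exists t1, t = build k t1 t2 /\ st1 = t1 :: st0.
  move: step => /= + /negPf ku; rewrite ku; case: (st1) => // t1 st2 [<- <-].
  by exists t1.
case: (opsP k0) => [|[|[|[|[|]]]]] ek; rewrite ek in eT kP un bi *; first by [];
  repeat (apply: runs_Cond => //=; rewrite eT => c; first [by [] | clear c]).
1,4: have [t1 [et est]] := bi isT; rewrite est in so1; have [sp2 [e2 nd1 so2]] := so1;
  apply: runs_Let_Then => //; apply: runs_Let => //; simpl_state;
  by rewrite e2 subSS subn0 -e2; exists t1, t2; split=> //; rewrite e2 in nd2 *.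
all: have [et est] := un isT; rewrite est.
all: by apply: runs_Nop => //; exists t2, t2.
Qed.

Lemma gen_build_ok nt h l r k tl tr : k \in ops -> at_node nt h (build k tl tr) ->
  at_node nt l tl -> at_node nt r tr -> clause_ok nt h k l r.
Proof.
move=> kP nh nl nr; exists (build k tl tr), tl, tr; split=> //; first by rewrite inE kP orbT.
by move=> f g; apply: gen_build; rewrite inE kP orbT.
Qed.

Lemma runs_parse_op nt dn s p k st t st0 : parsed nt dn s ->
  stack_ok nt (ar s aStk) (rg s rSp) st -> k \in ops -> rg s rT = k ->
  tok_step (TOp k) st = Some (t :: st0) -> rg s rP = p.+1 ->
  runs inp parse_op s 30 (token_post nt dn s p (TOp k) t st0).
Proof.
move=> pd so kP eT step eP.
have eD : rg s rD = D by case: (parsed_env pd) => _ [].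
pose nt' := nt ++ [:: t]; pose ne := rg s rNe.
have key : runs inp parse_op s 30 (fun s' =>
    [/\ graph nt' s', rg s' rNe = ne.+2, same_entries s s',
      rg s' rH = size nt * D /\ rg s' rNxt = size nt' * D &
      exists l r tl tr, [/\ is_entry s' ne.+1 (size nt * D) k l r l,
        at_node nt l tl, at_node nt r tr,
        t = build k tl tr /\ (k \in unary -> r = l) &
        stack_ok nt (ar s aStk) (rg s' rSp) st0]]).
  do 2!(apply: runs_Let_Then; first done); simpl_state.
  rewrite (parsed_next pd) eD; set s1 := AState _ _.
  apply: (@runs_Then _ _ _ _ _ 8 16 _ _ (@runs_pop_args nt s1 k st t st0 kP eT so step)) => //.
  move=> s2 fr2 [tl [tr [nl nr et un so2]]].
  have eH : rg s2 rH = size nt * D by use_frame fr2.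
  have eT2 : rg s2 rT = k by use_frame fr2.
  have cl : clause_ok nt' (size nt * D) k (rg s2 rCl) (rg s2 rCr).
    apply: (gen_build_ok (tl := tl) (tr := tr)) => //; try exact: at_node_cat.
    by rewrite -et; apply: at_node_last.
  have gr2 : graph nt' s2.
    by apply: graph_cat; apply: graph_frame fr2 isT (parsed_graph pd).
  have := runs_add_clause eH eT2 erefl erefl cl gr2; move/runs_weaken; apply=> //.
  move=> s3 fr3 [gr3 eNe3 same3 new3].
  have eNe2 : rg s2 rNe = ne by use_frame fr2.
  rewrite eNe2 in eNe3 new3; split=> //.
  - move=> e ve j jP; rewrite same3 //; last by rewrite /valid_entry eNe2.
    by move: jP; rewrite !inE => /or4P[| | |/orP[]] /eqP->; use_frame fr2.
  - split; first by use_frame fr3.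
    by use_frame fr3; use_frame fr2; rewrite /nt' size_cat mulnDl mul1n.
  exists (rg s2 rCl), (rg s2 rCr), tl, tr; split=> //.
  by use_frame fr3.
apply: runs_weaken key (leqnn _) _ => s1 fr1.
move=> [gr1 eNe1 same1 [eH eN1] [l [r [tl [tr [new nl nr [et un] so1]]]]]].
have [cx1 gw1] := cells_ok_frame fr1 isT (parsed_cells pd).
have ex : extends s s1 by split=> //; rewrite eNe1 /ne; lia.
exists [:: t]; rewrite eH; split=> //.
- apply: (parsed_ext pd ex) => //; first exact: env_frame fr1 isT (parsed_env pd).
    exact: cells_ok_cat.
  move=> _ [<-]; have [e1 e2 e3 e4 _] := new.
  apply: (@Node_op _ _ _ _ ne.+1 tl tr); rewrite ?e1 ?e2 ?e3 ?e4 //;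
    try exact: at_node_cat.
  by rewrite /valid_entry eNe1 leqnSn.
- exact: at_node_last.
- by use_frame fr1; apply: stack_ok_cat.
- by split=> //; rewrite eNe1 /ne addn2.
by use_frame fr1; rewrite eP addn1.
Qed.

Lemma runs_parse_token nt dn s p tk st t st0 : parsed nt dn s ->
  stack_ok nt (ar s aStk) (rg s rSp) st -> seg inp p (enc_token tk) -> rg s rP = p ->
  tok_ok tk -> tok_step tk st = Some (t :: st0) ->
  runs inp parse_token s (7 * n + 40) (fun s' => exists x,
    [/\ parsed (nt ++ x) dn s', stack_ok (nt ++ x) (ar s' aStk) (rg s' rSp) (t :: st0),
      size x <= 1 /\ rg s' rNe <= rg s rNe + 2 & rg s' rP = p + size (enc_token tk)]).
Proof.
move=> pd so sg eP tok step.
apply: runs_Let_Then; first by rewrite addnC.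
apply: runs_Let_Then; first by rewrite addnC.
rewrite /= /update /= eP addn1.
have hd : amem inp s p = nth 0 (enc_token tk) 0.
  by case: (tk) sg => [x|a|k] /seg_head/amem_at->.
rewrite hd; set s1 := setr _ _ _.
have pd1 : parsed nt dn s1.
  have [pd0 _] := parsed_frame (frame_setr rT 0 s (nth 0 (enc_token tk) 0)) isT pd.
  by have [] := parsed_frame (frame_setr rP 0 _ p.+1) isT pd0.
apply: (@runs_Then _ _ _ _ _ (7 * n + 32) 2 _ (token_post nt dn s1 p tk t st0)).
- have eT1 : rg s1 rT = nth 0 (enc_token tk) 0 by [].
  have eP1 : rg s1 rP = p.+1 by [].
  have so1 : stack_ok nt (ar s1 aStk) (rg s1 rSp) st by [].
  clearbody s1; case: tk {hd} sg tok step eT1 => [A|a|k] sg tok step eT1.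
  + apply: runs_Cond; first (by rewrite addnC); rewrite /= eT1 => // _.
    case: step => <- <-.
    by apply: runs_weaken (runs_parse_var pd1 so1 sg eP1) _ _ => //; lia.
  + apply: runs_Cond; first (by rewrite addnC); rewrite /= eT1 => // _.
    apply: runs_Cond; first (by rewrite addnC); rewrite /= eT1 => // _.
    case: step => <- <-.
    by apply: runs_weaken (runs_parse_atom pd1 so1 sg eP1) _ _ => //; lia.
  have k1 : k - 1 != 0 by case: (k) tok => [|[]].
  apply: runs_Cond => [||z]; [by rewrite addnC|move=> _|
    by move: z k1 tok; rewrite /= eT1 /= => ->].
  apply: runs_Cond => [||z]; [by rewrite addnC|move=> _|
    by move: z k1; rewrite /= eT1 /= => ->].
  by apply: runs_weaken (runs_parse_op pd1 so1 tok eT1 step eP1) _ _ => //; lia.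
- move=> s2 fr2 [x [pd2 nd so2 sz eP2]].
  apply: runs_Put_Then => //; apply: runs_Let => //; simpl_state.
  exists x; split=> //; last first.
    by exists (rg s2 rSp); rewrite addn1 eqxx; split=> //; apply: stack_ok_update.
  have f1 : frame (Put aStk rSp rH;; rSp <~ 0) s2
    (setr (seta s2 aStk (rg s2 rSp) (rg s2 rH)) rSp (rg s2 rSp + 1)).
    by split=> r; rewrite /= inE /update => /negPf->.
  by have [] := parsed_frame f1 isT pd2.
by lia.
Qed.

Lemma tok_step_cons tk st st' :
  tok_step tk st = Some st' -> exists (t : tree Sigma (nonterm Gr)) st0, st' = t :: st0.
Proof.
case: tk st => [A|a|k] [|t st] //=; try by move=> [<-]; do 2!eexists.
by case: ifP => _; [move=> [<-]|case: st => // u st [<-]]; do 2!eexists.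
Qed.

Notation rpos := (rpos P N Gr).
Notation rule_size := (rule_size Gr).

Lemma runs_parse_tokens nt dn s (r := rule dn) : parsed nt dn s ->
  rg s rSp = 0 -> dn < size (rules Gr) -> rg s rP = rpos dn + 2 ->
  rg s rTl = size (tokens r.2) ->
  runs inp (For rJ rTl parse_token) s (size (tokens r.2) * (7 * n + 42) + 2)
    (fun s' => exists x, [/\ parsed (nt ++ x) dn s', rg s' rSp = 1,
      at_node (nt ++ x) (ar s' aStk 0) r.2,
      size x <= size (tokens r.2) /\
      rg s' rNe <= rg s rNe + 2 * size (tokens r.2) &
      rg s' rP = rpos dn.+1]).
Proof.
move=> pd sp0 ltd eP eTl; have rk := onth_rule ltd.
(* The invariant looks ahead: reading the remaining letters on the current stack must leave exactly
   the right-hand side. *)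
pose J j s' := exists x st, [/\ parsed (nt ++ x) dn s',
  stack_ok (nt ++ x) (ar s' aStk) (rg s' rSp) st,
  tok_run (drop j (tokens r.2)) st = Some [:: r.2],
  size x <= j /\ rg s' rNe <= rg s rNe + 2 * j &
  rg s' rP = rpos dn + 2 + tpos r.2 j].
apply: runs_weaken (leqnn _) _.
  apply: (@runs_For _ J (7 * n + 40)); rewrite ?eTl //.
  - exists [::], [::]; rewrite cats0 drop0 /tpos psum0 addn0; split=> //=.
    + by have [] := parsed_frame (frame_setr rJ 0 s 0) isT pd.
    + by rewrite -[tokens _]cats0 tok_run_tokens.
    by rewrite addn0.
  - move=> j s1 ltj fr1 ej [x [st [pd1 so1 run1 [sx1 ne1] eP1]]].
    have [tk tkj] := onth_lt ltj.
    have tok := onth_all (tokens_ok r.2) tkj.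
    have sg := seg_token P N rk tkj.
    move: run1; rewrite (drop_onth tkj) /=.
    case step: (tok_step tk st) => [st'|] //= run1.
    have [t [st0 est]] := tok_step_cons step; rewrite est in step run1.
    have := runs_parse_token pd1 so1 sg eP1 tok step; move/runs_weaken; apply=> // s2 fr2.
    move=> [y [pd2 so2 [sy2 ne2] eP2]].
    exists (x ++ y), (t :: st0); rewrite catA; split=> //.
    + by have [] := parsed_frame (frame_setr rJ 0 s2 j.+1) isT pd2.
    + by rewrite size_cat /= /update /=; split; lia.
    by rewrite /= /update /= eP2 (tposS tkj) addnA.
  by rewrite leq_add2r leq_mul2l -addnA leqnn orbT.
move=> s1 fr1; rewrite eTl => -[x [st [pd1 so1 + sz eP1]]].
rewrite drop_size => -[est]; rewrite est in so1; have [sp' [esp nd e0]] := so1.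
rewrite e0 in esp nd; exists x; split=> //.
by rewrite eP1 (rposS _ _ rk).
Qed.

Lemma runs_parse_rule nt dn s : parsed nt dn s -> rg s rSp = 0 ->
  dn < size (rules Gr) -> rg s rP = rpos dn ->
  runs inp parse_rule s (rule_size dn * (7 * n + 42)) (fun s' => exists x,
    [/\ parsed (nt ++ x) dn.+1 s', rg s' rSp = 0,
      size x <= rule_size dn, rg s' rNe <= rg s rNe + 2 * rule_size dn &
      rg s' rP = rpos dn.+1]).
Proof.
move=> pd sp0 ltd eP; have rk := onth_rule ltd.
set A := (rule dn).1; set t := (rule dn).2; set len := size (tokens t).
have eN : rg s rN = n by case: (parsed_env pd) => [[]].
rewrite /rule_size -/t -/len mulSn.
apply: runs_Let_Then; first by rewrite -addnA addnC.
rewrite /= eP (amem_at _ (at_lhs P N rk)) -/A; set s1 := setr _ _ _.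
have pd1 : parsed nt dn s1 by have [] := parsed_frame (frame_setr rLhs 0 s (rank A)) isT pd.
apply: (@runs_Then _ _ _ _ _ (3 * n + 2) (len * (7 * n + 42) + 25) _ _
  (@runs_shift s1 rLhs (rank A) eN erefl isT isT)); last by lia.
move=> s2 fr2 eL2; have [pd2 _] := parsed_frame fr2 isT pd1.
do 2!(apply: runs_Let_Then; first by rewrite addnC); simpl_state.
use_frame fr2; rewrite /s1 /= /update /= eP (amem_at _ (at_tree_size _ _ rk)).
set s3 := AState _ _.
have pd3 : parsed nt dn s3.
  have [pd3 _] := parsed_frame (frame_setr rTl 0 s2 (size (tokens t))) isT pd2.
  by have [] := parsed_frame (frame_setr rP 0 _ (rpos dn + 2)) isT pd3.
have sp3 : rg s3 rSp = 0 by rewrite /s3 /=; use_frame fr2.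
apply: (@runs_Then _ _ _ _ _ (len * (7 * n + 42) + 2) 21 _ _
  (@runs_parse_tokens nt dn s3 pd3 sp3 ltd erefl erefl)); last by lia.
move=> s4 fr4 [x [pd4 sp4 nd4 [sx4 ne4] eP4]].
have eL4 : rg s4 rLhs = rank A * D by use_frame fr4.
do 5!(apply: runs_Let_Then; first done); simpl_state; rewrite sp4 eL4 subnn.
set s5 := AState _ _.
have gr5 : graph (nt ++ x) s5 by apply: (parsed_graph pd4).
have cl : clause_ok (nt ++ x) (rank A * D) 0 (ar s4 aStk 0) (ar s4 aStk 0).
  exists (Var A), t, t; split=> //; first by exists (rank A); rewrite // (parsed_vars pd4).
  move=> f g gf _; apply: gen_Var gf; apply/In_onth; exists dn.
  by rewrite rk /A /t; case: (rule dn).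
have := @runs_add_clause s5 _ _ _ _ _ erefl erefl erefl erefl cl gr5.
move/runs_weaken; apply=> // s6 fr6 [gr6 ne6 same6 new6].
have pd5 : parsed (nt ++ x) dn s5.
  have f5 : frame (rSp <~ 0;; rH <~ 0;; rT <~ 0;; rCl <~ 0;; rCr <~ 0) s4 s5.
    by split=> // r; rewrite /= !inE !negb_or; do 4!case/andP=> /negPf->; move/negPf->.
  by have [] := parsed_frame f5 isT pd4.
have [cx6 gw6] := cells_ok_frame fr6 isT (parsed_cells pd5).
have ex : extends s5 s6 by split=> //; rewrite ne6; lia.
have pd6 : parsed (nt ++ x) dn s6.
  rewrite -[_ ++ x]cats0; apply: (parsed_ext pd5 ex); rewrite ?cats0 //.
    exact: env_frame fr6 isT (parsed_env pd5).
  by use_frame fr6; apply: (parsed_next pd5).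
exists x; split.
- case: pd6 => p1 p2 p3 p4 p5 p6 p7; split=> // k; rewrite ltnS leq_eqVlt.
  case/predU1P=> [->|]; last exact: p7.
  have [e1 e2 e3 e4 _] := new6; exists (rg s5 rNe).+1; rewrite e1 e2 e3 e4; split=> //.
  by rewrite /valid_entry ne6 leqnSn.
- by use_frame fr6.
- exact: leqW.
- have e3 : rg s3 rNe = rg s rNe by rewrite /s3 /=; use_frame fr2.
  rewrite e3 -/t -/len in ne4; rewrite ne6; have -> : rg s5 rNe = rg s4 rNe by [].
  by move: ne4; move: (rg s4 rNe) (rg s rNe) len => a b c; lia.
by use_frame fr6.
Qed.

Lemma onth_enum (T : finType) k (x : T) : onth (enum T) k = Some x <-> k = rank x.
Proof.
have lt : rank x < size (enum T) by rewrite -cardE rank_lt.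
split=> [kx|->].
  have := nth_uniq x (onth_size kx) lt (enum_uniq T).
  by rewrite (@onth_nth _ x _ _ _ kx) nth_rank eqxx => /esym/eqP.
by rewrite onthE (nth_map x) // nth_rank.
Qed.

(** The nonterminals receive their numbers in advance, so a right-hand side may mention one whose
    rules come later. *)
Definition start_nodes : trees := [seq Var A | A <- enum (nonterm Gr)].

Lemma onth_start_nodes k t :
  onth start_nodes k = Some t <-> exists2 A, t = Var A & k = rank A.
Proof.
rewrite onth_map; split=> [|[A -> /onth_enum->] //].
by case e: onth => [A|] //= -[<-]; exists A => //; apply/onth_enum.
Qed.

Lemma parsed_start s : env s -> ar s aTag =1 (fun=> 0) -> ar s aHead =1 (fun=> 0) ->
  rg s rNe = 0 -> rg s rQt = 0 -> rg s rNxt = #|nonterm Gr| * D ->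
  parsed start_nodes 0 s.
Proof.
move=> es tag0 head0 ne0 qt0 nx.
have nomark c : marked s c = false by rewrite /marked tag0.
split=> //.
- split; first by move=> c; rewrite nomark.
  by split=> [i|i j|c]; rewrite ?qt0 ?nomark.
- split=> [e|u|e r]; rewrite /valid_entry ?ne0; try by case: e.
  by rewrite head0 /entries_at ne0.
- by rewrite nx size_map -cardE.
- by move=> k t /onth_start_nodes[A -> ->]; apply: Node_Var.
by move=> A; apply/onth_start_nodes; exists A.
Qed.

Lemma runs_parse_grammar s : env s -> rg s rP = gpos P N ->
  ar s aTag =1 (fun=> 0) -> ar s aHead =1 (fun=> 0) ->
  runs inp parse_grammar s (grammar_size Gr * (7 * n + 44)) (fun s' => exists nt,
    [/\ parsed nt (size (rules Gr)) s', rg s' rAx = rank (axiom Gr) * D,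
      size nt <= grammar_size Gr & rg s' rNe <= 2 * grammar_size Gr]).
Proof.
move=> es eP tag0 head0; have eN : rg s rN = n by case: es => [[]].
set S := fun k => \sum_(0 <= i < k) rule_size i.
have gsE := sum_rule_size Gr; rewrite -/(S _) in gsE; rewrite -gsE mulnDl.
have nt0 := leq_mul (nonterm_gt0 Gr) (leqnn (7 * n + 44)); rewrite mul1n in nt0.
(* The overhead outside the loop over the rules is charged to the nonterminals, of which there is at
   least one. *)
set T := #|_| * _ + _; have leT : 6 * n + 13 + S (size (rules Gr)) * (7 * n + 44) <= T.
  by rewrite leq_add2r (leq_trans _ nt0) //; lia.
apply: (fun h => runs_weaken h leT (fun _ _ q => q)).
apply: runs_Let_Then; first by rewrite addnAC addnC.
rewrite /= eP (amem_at _ (at_nonterm P N Gr)).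
set s1 := setr _ _ _; set T1 := _.-1.
apply: (@runs_Then _ _ _ _ _ (3 * n + 2) (3 * n + 10 + S (size (rules Gr)) * (7 * n + 44)) _ _
  (@runs_shift s1 rNxt _ eN erefl isT isT)); last by rewrite /T1; lia.
move=> s2 fr2 eNx2; apply: runs_Let_Then; first by rewrite addnAC addnC.
have eP2 : rg s2 rP = gpos P N by use_frame fr2.
rewrite /= eP2 (amem_at _ (at_axiom P N Gr)); set s3 := setr _ _ _.
have eN3 : rg s3 rN = n by rewrite /s3 /= /update /=; use_frame fr2.
apply: (@runs_Then _ _ _ _ _ (3 * n + 2) (7 + S (size (rules Gr)) * (7 * n + 44)) _ _
  (@runs_shift s3 rAx _ eN3 erefl isT isT)); last by lia.
move=> s4 fr4 eAx4; have eP4 : rg s4 rP = gpos P N.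
  by use_frame fr4; rewrite /s3 /= /update /=.
have eNx4 : rg s4 rNxt = #|nonterm Gr| * D.
  by use_frame fr4; rewrite /s3 /= /update /=.
do 5!(apply: runs_Let_Then; first done); simpl_state.
rewrite eP4 (amem_at _ (at_nrules P N Gr)); set s5 := AState _ _.
have es5 : env s5.
  by apply: (env_frame fr4 isT (s := s3)); apply: (env_frame fr2 isT (s := s1)).
have tag5 : ar s5 aTag =1 (fun=> 0).
  by move=> c; rewrite /s5 /=; use_frame fr4; rewrite /s3 /=; use_frame fr2; apply: tag0.
have head5 : ar s5 aHead =1 (fun=> 0).
  by move=> c; rewrite /s5 /=; use_frame fr4; rewrite /s3 /=; use_frame fr2; apply: head0.
have pd5 := parsed_start es5 tag5 head5 erefl erefl eNx4.
pose J k s' := exists nt, [/\ parsed nt k s', rg s' rSp = 0,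
  size nt <= #|nonterm Gr| + S k, rg s' rNe <= 2 * S k & rg s' rP = rpos k].
apply: runs_weaken (leqnn _) _.
  apply: (@runs_For_sum _ J (fun k => rule_size k * (7 * n + 42))) => //.
  - exists start_nodes; split=> //.
    + by have [] := parsed_frame (frame_setr rI 0 s5 0) isT pd5.
    + by rewrite size_map -cardE leq_addr.
    by rewrite /= /update /= /rpos psum0 addn0.
  - move=> k s6 ltk fr6 ek [nt [pd6 sp6 sz6 ne6 eP6]].
    have := runs_parse_rule pd6 sp6 ltk eP6; move/runs_weaken; apply=> // s7 fr7.
    move=> [x [pd7 sp7 sx ne7 eP7]]; exists (nt ++ x); rewrite /S big_nat_recr //=.
    split=> //.
    + by have [] := parsed_frame (frame_setr rI 0 s7 k.+1) isT pd7.
    + by rewrite size_cat addnA leq_add.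
    by rewrite /update /= mulnDr (leq_trans ne7) // leq_add2r.
  - rewrite /=; have: \sum_(0 <= k < size (rules Gr)) (rule_size k * (7 * n + 42) + 2) <=
        S (size (rules Gr)) * (7 * n + 44).
      rewrite /S big_distrl /=; apply: leq_sum => k _.
      by rewrite -[7 * n + 44]/(7 * n + (42 + 2)) addnA [_ * (_ + 2)]mulnDr leq_add2l leq_pmull.
    by move=> le; rewrite addnC (leq_trans (leq_add (leqnn 2) le)) //; lia.
move=> s6 fr6 [nt [pd6 _ sz6 ne6 _]]; exists nt; split=> //.
  by use_frame fr6.
by rewrite (leq_trans ne6) // leq_mul2l leq_addl.
Qed.

End Parsing.

(** * Search among the cells of the axiom *)

Notation rOk := 41.

(** The positive structures come first in the list, so [$rPs - $rI] is nonzero exactly for them. *)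
Definition check_starts :=
  For rI rM (
    Cond ($rPs - $rI)
      (Cond (At aA (At aSt $rI)) Nop (rOk <~ 0))
      (Cond (At aA (At aSt $rI)) (rOk <~ 0) Nop)).

Definition check_cell := rV <~ $rV1;; decode aA;; rOk <~ 1;; check_starts.

Definition scan_cell :=
  check_cell;;
  Cond $rOk (rRes <~ 1;; rPtr <~ Adr ($rAx + $rV1)) Nop.

(** A later success overwrites an earlier one; each of them yields a solution. *)
Definition scan :=
  rRes <~ 0;; For rV1 rD (Cond (At aTag ($rAx + $rV1)) scan_cell Nop).

Section Scan.

Variables (Sigma : finType) (P N : seq (kripke Sigma)) (Gr : grammar Sigma).
Notation Ks := (P ++ N).
Notation inp := (enc_input P N Gr).
Notation n := (n_nodes Ks).
Notation D := (2 ^ n).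
Notation code := (code Ks).
Notation env := (env P N).
Notation at_node := (at_node P N).
Notation cells_ok := (cells_ok P N).

Lemma separatesP f : separates P N f <->
  forall k K, onth Ks k = Some K -> (start K \in sem K f) = (k < size P).
Proof.
split=> [[sP sN] k K|sep].
  rewrite onth_cat; case: ltnP => _ sk.
    by apply/sP/In_onth; exists k.
  by apply/negbTE/negP/sN/In_onth; exists (k - size P).
split=> K /In_onth[k sk].
  by rewrite /models (sep k) ?onth_cat ?(onth_size sk).
have e : onth Ks (size P + k) = Some K by rewrite onth_cat ltnNge leq_addr /= addKn.
by rewrite /models (sep _ _ e) ltnNge leq_addr.
Qed.

Lemma separates_code f g : code f = code g -> separates P N f -> separates P N g.
Proof.
move=> e /separatesP sep; apply/separatesP => k K sk; rewrite -(sep k K sk).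
by rewrite (code_sem e) //; apply/In_onth; exists k.
Qed.

Definition starts_ok (st : nat -> nat) f j :=
  all (fun k => glue Ks (semF f) (st k) == (k < size P)) (iota 0 j).

Lemma starts_okP s f : env s -> starts_ok (ar s aSt) f (size Ks) <-> separates P N f.
Proof.
move=> [[_ _ _ rows] _].
have st k K : onth Ks k = Some K ->
    glue Ks (semF f) (ar s aSt k) = (start K \in sem K f).
  move=> sk; have [-> _] := rows k K (onth_size sk) sk.
  by rewrite (glue_at _ sk (rank_lt _)) /nd nth_rank.
split=> [/allP ok|/separatesP sep].
  apply/separatesP=> k K sk; rewrite -(st k K sk); apply/eqP/ok.
  by rewrite mem_iota /= (onth_size sk).
apply/allP=> k; rewrite mem_iota /= add0n => /onth_lt[K sk].
by rewrite (st k K sk) (sep k K sk).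
Qed.

Lemma runs_check_starts s f : env s -> bits P N s aA (glue Ks (semF f)) -> rg s rOk = 1 ->
  runs inp check_starts s (5 * n + 2) (fun s' =>
    rg s' rOk = starts_ok (ar s aSt) f (size Ks)).
Proof.
move=> [[_ eM ePs rows] _] hA ok1; have le := size_le_total P N.
apply: runs_weaken (leqnn _) _.
  apply: (@runs_For _ (fun k s' => rg s' rOk = starts_ok (ar s aSt) f k) 3); rewrite ?eM //.
  - move=> k s1 ltk fr1 ek e1.
    have [K sk] := onth_lt ltk; have [sko _] := rows k K ltk sk.
    have lts : ar s aSt k < n by rewrite sko (glue_lt sk (rank_lt _)).
    have eS : starts_ok (ar s aSt) f k.+1 = starts_ok (ar s aSt) f k &&
        (glue Ks (semF f) (ar s aSt k) == (k < size P)).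
      have ei : iota 0 k.+1 = iota 0 k ++ [:: k] by rewrite -addn1 iotaD.
      by rewrite /starts_ok ei all_cat /= andbT.
    have eA : ar s1 aA (ar s1 aSt k) = glue Ks (semF f) (ar s aSt k).
      by use_frame fr1; apply: hA.
    have ePs1 : rg s1 rPs = size P by use_frame fr1.
    apply: runs_Cond => //=; rewrite ePs1 ek => c.
      have lt : k < size P by lia.
      apply: runs_Cond => //=; rewrite ek eA => c2.
        apply: runs_Nop => //; rewrite /= /update /= e1 eS lt.
        by case: (glue _ _ _) c2; rewrite ?andbT.
      apply: runs_Let => //; rewrite /= /update /= eS lt.
      by case: (glue _ _ _) c2; rewrite ?andbF.
    have ge : (k < size P) = false by lia.
    apply: runs_Cond => //=; rewrite ek eA => c2.
      apply: runs_Let => //; rewrite /= /update /= eS ge.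
      by case: (glue _ _ _) c2; rewrite ?andbF.
    apply: runs_Nop => //; rewrite /= /update /= e1 eS ge.
    by case: (glue _ _ _) c2; rewrite ?andbT.
  by rewrite leq_add2r mulnC leq_mul2l le.
by move=> s' _; rewrite eM.
Qed.

Definition found s s' := exists phi, [/\ rg s' rRes = 1, gen (Var (axiom Gr)) phi,
  separates P N phi & exists2 c, rg s' rPtr = adr inp c & cell_stores P N Gr (ar s) c phi].

Lemma runs_scan nt s : env s -> cells_ok nt s ->
  at_node nt (rg s rAx) (Var (axiom Gr)) ->
  runs inp scan s (D * (11 * n + 20) + 3) (fun s' => found s s' \/
    rg s' rRes = 0 /\ forall f, marked s (rg s rAx + code f) -> ~ separates P N f).
Proof.
move=> es cx nd; have eD : rg s rD = D by case: es => _ [].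
apply: runs_Let_Then; first by rewrite addnC.
set s0 := setr _ _ _.
pose I k s' := found s s' \/ rg s' rRes = 0 /\
  forall f, code f < k -> marked s (rg s rAx + code f) -> ~ separates P N f.
apply: runs_weaken.
- apply: (@runs_For _ I (11 * n + 18)); last exact: leqnn.
  + done.
  + by right; split.
  + move=> k s1 ltk fr1 ek Ik.
    have eAx : rg s1 rAx = rg s rAx by use_frame fr1.
    have eTag : ar s1 aTag = ar s aTag by use_frame fr1.
    have es1 : env s1 by apply: (env_frame fr1).
    apply: runs_Cond; first by rewrite addnC.
      rewrite /= eAx ek eTag => m; have ltD : k < D by move: ltk; rewrite /s0 /= /update /= eD.
      have [f ef] := marked_code cx nd ltD m.
      have mf : marked s (rg s rAx + code f) by rewrite -ef.
      have [f' [ef' gf' sf']] := marked_fact cx nd mf; rewrite ef in ek.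
      rewrite ef' in ek sf'.
      apply: (@runs_Then _ _ _ _ _ (11 * n + 6) 3 _
        (fun s' => rg s' rOk = starts_ok (ar s aSt) f' (size Ks))).
      * apply: runs_Let_Then; first by rewrite addnC.
        rewrite /= ek.
        apply: (@runs_Then _ _ _ _ _ (6 * n + 2) (5 * n + 3) _ _
          (@runs_decode _ _ _ Gr (setr s1 rV (code f')) aA (glue Ks (semF f'))
            isT es1 erefl)); last lia.
        move=> s2 fr2 hA; apply: runs_Let_Then; first by rewrite addnC.
        have es2 : env (setr s2 rOk 1) by apply: (env_frame fr2).
        rewrite addnS /=; have := @runs_check_starts (setr s2 rOk 1) f' es2 hA erefl.
        by rewrite /=; use_frame fr2; rewrite /=; use_frame fr1.
      * move=> s2 fr2 eOk.
        have new : starts_ok (ar s aSt) f' (size Ks) <-> separates P N f' by apply: starts_okP.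
        have eAx2 : rg s2 rAx = rg s rAx by use_frame fr2.
        have e1 : rg s2 rV1 = code f' by use_frame fr2.
        apply: runs_Cond => //=; rewrite eOk => c.
          apply: runs_Let_Then => //; apply: runs_Let => //; left; exists f'.
          split=> //; first by apply/new; case: (starts_ok _ _ _) c.
          by exists (rg s rAx + code f'); rewrite //= /update /= eAx2 e1.
        apply: runs_Nop => //; case: Ik => [[phi [r1 g1 sep [d ed cd]]]|[r0 no]].
          left; exists phi; split=> //; rewrite /= /update /=; use_frame fr2 => //.
          by exists d.
        right; split; first by rewrite /= /update /=; use_frame fr2.
        move=> g; rewrite ltnS leq_eqVlt => /predU1P[eg _ sepg|]; last exact: no.
        have /new : separates P N f' by apply: separates_code sepg; rewrite eg ef.
        by case: (starts_ok _ _ _) c.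
      lia.
    rewrite /= eAx ek eTag => m; apply: runs_Nop; first by rewrite addnC.
    case: Ik => [fd|[r0 no]]; [by left|right; split=> // g].
    rewrite ltnS leq_eqVlt => /predU1P[eg|]; last exact: no.
    by rewrite /marked eg m.
- have -> : (D * (11 * n + 20) + 3).-1 = D * (11 * n + 20) + 2 by rewrite addnS.
  by rewrite /s0 /= /update /= eD leq_add2r leq_mul2l -addnA leqnn orbT.
move=> s' fr'; rewrite /s0 /= /update /= eD => -[fd|[r0 no]]; [by left|right; split=> //].
by move=> f; apply: no; apply: code_lt.
Qed.

(** * Completeness of the saturated table *)

Lemma build_inj (V : Type) k k' (t1 t2 u1 u2 : tree Sigma V) : k \in ops -> k' \in ops ->
  build k t1 t2 = build k' u1 u2 -> [/\ k = k', t1 = u1 & k \notin unary -> t2 = u2].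
Proof.
move=> kP kP'; have k0 : k \in 0 :: ops by rewrite inE kP orbT.
have k0' : k' \in 0 :: ops by rewrite inE kP' orbT.
case: (opsP k0) kP => [|[|[|[|[|]]]]] ->; case: (opsP k0') kP' => [|[|[|[|[|]]]]] -> //= _ _;
  by case=> -> // ->.
Qed.

Lemma build_not_leaf (V : Type) k (t u : tree Sigma V) : k \in ops ->
  (forall x, Var x <> build k t u) /\ (forall a, Atom a <> build k t u).
Proof.
move=> kP; have k0 : k \in 0 :: ops by rewrite inE kP orbT.
by case: (opsP k0) kP => [|[|[|[|[|]]]]] ->.
Qed.

(** By induction on the derivation: a nonterminal is served by the tag 0 clause of the rule applied,
    an atom by its initial fact, and an operator by the clause of its node. *)
Lemma complete nt s t phi u :
  (forall k t, onth nt k = Some t -> node_ok P N nt s k t) ->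
  (forall k, k < size (rules Gr) -> rule_ok P N nt s (rule Gr k)) ->
  saturated P N s -> gen t phi -> at_node nt u t -> marked s (u + code phi).
Proof.
move=> nodes rules cl gt.
have op_case k t1 t2 f g w : k \in ops -> at_node nt w (build k t1 t2) ->
    (forall w, at_node nt w t1 -> marked s (w + code f)) ->
    (k \notin unary -> forall w, at_node nt w t2 -> marked s (w + code g)) ->
    marked s (w + code (build k f g)).
  move=> kP [i ti ->] m1 m2; case: (nodes i _ ti).
  - by move=> A /esym eA; have [/(_ A)] := build_not_leaf t1 t2 kP.
  - by move=> a /esym ea; have [_ /(_ a)] := build_not_leaf t1 t2 kP.
  move=> e tl tr ve <- kP' nl nr /(build_inj kP kP')[ek el er] un.
  rewrite ek -el in kP m1 m2 er nl *; have ml := m1 _ nl.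
  (* A unary clause has the same node twice, so its first operand can serve as the second. *)
  case kU : (ar s aEt e \in unary).
    have -> : build (ar s aEt e) f g = build (ar s aEt e) f f.
      by case: (ar s aEt e) kU => [|[|[|[|[|[|[|]]]]]]].
    by apply: cl => //; rewrite un.
  by apply: cl => //; apply: m2; rewrite ?kU // er // kU.
elim: gt u => {t phi}.
- move=> A t phi r _ IH u [i ti ->]; case: (nodes i _ ti).
  + move=> A' [<-] ->; have [k rk] := proj1 (In_onth _ _) r.
    have [e [ve eh et nl er]] := rules k (onth_size rk).
    have eR : rule Gr k = (A, t) by have := onth_rule (onth_size rk); rewrite rk => -[].
    rewrite eR /= in eh nl; rewrite -eh.
    by have := cl e phi phi ve (IH _ nl); rewrite er et /=; apply; apply: IH.
  + by [].
  by move=> e tl tr _ _ kP _ _ /esym eb; have [/(_ A)] := build_not_leaf tl tr kP; rewrite eb.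
- move=> a u [i ti ->]; case: (nodes i _ ti) => [//|a' [<-] //|].
  by move=> e tl tr _ _ kP _ _ /esym eb; have [_ /(_ a)] := build_not_leaf tl tr kP; rewrite eb.
- by move=> t u f g _ IHt _ IHu w nd; apply: (@op_case 2 t u f g).
- by move=> t f _ IHt w nd; apply: (@op_case 3 t t f f).
- by move=> t f _ IHt w nd; apply: (@op_case 4 t t f f).
- by move=> t u f g _ IHt _ IHu w nd; apply: (@op_case 5 t u f g).
by move=> t f _ IHt w nd; apply: (@op_case 6 t t f f).
Qed.

(** * The total cost of the saturation *)

Lemma sum_blocks (f : nat -> nat) b k : 0 < b ->
  \sum_(c < k * b) f (c %/ b) = b * \sum_(i < k) f i.
Proof.
move=> b0; elim: k f => [|k IH] f; first by rewrite !big_ord0 muln0.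
rewrite mulSn big_split_ord /= big_ord_recl mulnDr; congr (_ + _).
  rewrite (eq_bigr (fun=> f 0)) => [|c _]; last by rewrite divn_small.
  by rewrite sum_nat_const card_ord.
rewrite -(IH (fun i => f i.+1)); apply: eq_bigr => c _ /=.
by rewrite -{1}[b]mul1n divnMDl.
Qed.

(** The multiples of [b] are distinct, so every member of [s] is counted for at most one [i]. *)
Lemma sum_count (T : Type) (a : T -> nat) (s : seq T) b k : 0 < b ->
  \sum_(i < k) count (fun x => a x == i * b) s <= size s.
Proof.
move=> b0; elim: s => [|x s IH] /=; first by rewrite big1.
rewrite big_split /= -add1n leq_add //.
case: (pickP (fun i : 'I_k => a x == i * b)) => [i /eqP ei|no]; last first.
  by rewrite big1 // => i _; rewrite no.
rewrite (bigD1 i) //= ei eqxx big1 // => j ne.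
by rewrite eqn_pmul2r // eq_sym val_eqE (negPf ne).
Qed.

(** The source of linearity in the grammar: each node has [D] cells, and each entry lies in the list
    of at most one node, so the list lengths add up to at most the number of entries. *)
Lemma sum_weight (nt : seq (tree Sigma (nonterm Gr))) s :
  \sum_(c < n_cells P N nt) weight P N s (c %/ D * D) <=
  D * (5 * size nt + rg s rNe * (fire_time P N + 2)).
Proof.
rewrite /n_cells (sum_blocks (fun i => weight P N s (i * D))) ?expn_gt0 //.
rewrite leq_mul2l; apply/orP; right; rewrite /weight big_split /= sum_nat_const card_ord.
rewrite mulnC leq_add2l -big_distrl /= leq_mul2r; apply/orP; right.
rewrite (eq_bigr (fun i : 'I__ => count (fun e => ar s aEa e == i * D)
  (rev (iota 1 (rg s rNe))))) => [|i _]; last by rewrite size_filter.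
by apply: leq_trans (sum_count _ _ _ _) _; rewrite ?expn_gt0 // size_rev size_iota.
Qed.

Definition main := setup_structures;; setup_powers;; parse_grammar;; saturate;; scan.

Definition main_time := 40 * (n.+1 * n.+1) + (4 * n + 3 +
  (grammar_size Gr * (7 * n + 44) +
  (D * (5 * grammar_size Gr + 2 * grammar_size Gr * (fire_time P N + 2)) + 2 +
  (D * (11 * n + 20) + 3)))).

Lemma runs_main s : (forall j x, ar s j x = 0) ->
  runs inp main s main_time (fun s' =>
    (rg s' rRes = 1 /\ exists phi, solution P N Gr phi /\
      stores (amem inp s') (rg s' rPtr) phi) \/
    (rg s' rRes = 0 /\ ~ exists phi, solution P N Gr phi)).
Proof.
move=> zero; rewrite /main_time /main.
apply: runs_Then (runs_setup_structures P N Gr s) _ (leqnn _) => s1 fr1 [st1 eP1].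
apply: runs_Then (runs_setup_powers Gr st1) _ (leqnn _) => s2 fr2 es2.
have eP2 : rg s2 rP = gpos P N by use_frame fr2.
have z2 j : j \in [:: aTag; aHead] -> ar s2 j =1 (fun=> 0).
  by rewrite !inE => /orP[] /eqP-> x; use_frame fr2; use_frame fr1.
apply: runs_Then (runs_parse_grammar Gr es2 eP2 (z2 aTag isT) (z2 aHead isT)) _ (leqnn _).
move=> s3 fr3 [nt [pd3 eAx3 snt sne]].
have gr3 := parsed_graph pd3; have es3 := parsed_env pd3.
have cx3 := parsed_cells pd3.
apply: (@runs_Then _ _ _ _ _ _ (D * (11 * n + 20) + 3) _ _ (runs_saturate es3 cx3 gr3))
  => [s4 fr4 [cx4 gr4 gw4 cl4]|]; last first.
  rewrite !leq_add2r; apply: leq_trans (sum_weight _ _) _.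
  by rewrite leq_mul2l leq_add ?leq_mul ?orbT.
have es4 : env s4 by apply: (env_frame fr4).
have ex4 : extends s3 s4.
  split=> //; first by use_frame fr4.
  by move=> e _ j; rewrite !inE => /or4P[| | |/orP[]] /eqP->; use_frame fr4.
have eAx4 : rg s4 rAx = rank (axiom Gr) * D by use_frame fr4.
have nd4 : at_node nt (rg s4 rAx) (Var (axiom Gr)).
  by exists (rank (axiom Gr)); rewrite // (parsed_vars pd3).
have cmp f : gen (Var (axiom Gr)) f -> marked s4 (rg s4 rAx + code f).
  move=> gf; apply: complete cl4 gf nd4 => [k t /(parsed_nodes pd3)|k /(parsed_rules pd3)] ok.
    by rewrite -[nt]cats0; apply: node_ok_ext ok.
  by rewrite -[nt]cats0; apply: rule_ok_ext ok.
apply: runs_weaken (runs_scan es4 cx4 nd4) (leqnn _) _ => s5 fr5.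
case=> [[phi [r1 gf sep [c ec sc]]]|[r0 no]]; [left|right]; split=> //.
  exists phi; split; first by split=> //; apply/in_languageP.
  rewrite ec; apply: (@cell_storesP _ P N Gr).
  have [_ [same _ _]] := cells_ok_frame fr5 isT cx4.
  by apply: (cell_stores_same same _ sc); apply/same/(cell_stores_marked sc).
by case=> phi [/in_languageP/cmp/no].
Qed.

End Scan.

(** * The complete program and its running time *)

Definition skip := skip_structures;; skip_grammar.

(** Between the passes, the read position left by the first one, which is the length of the input,
    becomes the base address in register 0. In the end the verdict replaces it there; [rPtr] is
    compiled to register 1, where the output format expects the address. *)
Definition program :=
  Seq (compile skip) (Seq (Assign 0 (Reg rP.+1)) (Seq (compile main) (Assign 0 (Reg rRes.+1)))).

Lemma skip_time_bound m d g : m < d -> 0 < g ->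
  6 * (m.+1 * m.+1) + 10 * g <= 16 * (d ^ 6 * g).
Proof.
move=> md g0; have d0 : 0 < d by apply: leq_ltn_trans md.
have dd : m.+1 * m.+1 <= d ^ 6 * g.
  apply: leq_trans (leq_mul md md) _; by rewrite mulnn -[d ^ 2]muln1 leq_mul // leq_pexp2l.
have gg : g <= d ^ 6 * g by rewrite leq_pmull // expn_gt0 d0.
lia.
Qed.

(** Every summand is compared with [d ^ 6 * grammar_size Gr]. The saturation dominates with a factor
    of 157, and 300 leaves some slack for the sum. *)
Lemma main_time_bound (Sigma : finType) (P N : seq (kripke Sigma)) (Gr : grammar Sigma)
    (d := 2 ^ n_nodes (P ++ N)) :
  main_time P N Gr <= 300 * (d ^ 6 * grammar_size Gr).
Proof.
rewrite /main_time /fire_time /pair_time -/d.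
have : n_nodes (P ++ N) < d by apply: ltn_expl.
have : 0 < grammar_size Gr.
  by rewrite -sum_rule_size addn_gt0 nonterm_gt0.
move: (n_nodes _) (grammar_size _) d => m g d g0 md.
have d0 : 0 < d by apply: leq_ltn_trans md.
pose p i := d ^ i.
have pS i : d * p i = p i.+1 by rewrite /p expnS.
have p1 : d = p 1 by rewrite /p expn1.
have pp i j : i <= j -> p i <= p j by move=> ij; rewrite leq_pexp2l.
have e3 : d * (d * d) = p 3 by rewrite {3}p1 !pS.
(* The coefficients of the expanded polynomial add up to 74: 64 + 3 + 5 + 2. *)
have f5 : d * (d * (64 * (d * (d * d)) + 3) + 2 + 3) + 2 <= 74 * p 5.
  have -> : d * (d * (64 * (d * (d * d)) + 3) + 2 + 3) = 64 * p 5 + 3 * p 2 + 5 * p 1.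
    by rewrite e3 -[p 5]pS -[p 4]pS -[p 2]pS -p1; lia.
  have := pp 2 5 isT; have := pp 1 5 isT; have := pp 0 5 isT; rewrite {1}/p; lia.
have pos i : 0 < p i by rewrite expn_gt0 d0.
have le_q i : i <= 6 -> p i <= p 6 * g.
  by move=> le; rewrite (leq_trans (pp i 6 le)) // leq_pmulr.
have mp : m.+1 <= p 1 by rewrite -p1.
have q1 : p 1 <= p 6 * g by apply: le_q.
have q2 : p 2 <= p 6 * g by apply: le_q.
have a1 : m.+1 * m.+1 <= p 6 * g.
  by apply: leq_trans q2; rewrite -[p 2]pS {1}p1 leq_mul.
have a2 : g * (7 * m + 44) <= 51 * (p 6 * g).
  rewrite mulnC mulnA leq_mul2r; apply/orP; right.
  have := pp 1 6 isT; lia.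
have a3 : d * (11 * m + 20) <= 31 * (p 6 * g).
  apply: (@leq_trans (31 * p 2)); last by rewrite leq_mul2l q2 orbT.
  by rewrite -[p 2]pS mulnCA leq_mul2l; apply/orP; right; lia.
set F := d * (d * _ + 2 + 3) + 2 in f5 *.
(* Here 157 is 5 + 2 * 76, with 76 = 74 + 2 from the bound on [F]. *)
have a4 : d * (5 * g + 2 * g * (F + 2)) <= 157 * (p 6 * g).
  apply: (@leq_trans (d * (157 * (p 5 * g)))); last by rewrite mulnCA [d * _]mulnA pS.
  rewrite leq_mul2l; apply/orP; right.
  apply: (@leq_trans (5 * (p 5 * g) + 2 * g * (76 * p 5))).
    rewrite leq_add ?leq_mul2l ?leq_pmull ?orbT //; apply/orP; right.
    by have := pos 5; lia.
  by rewrite mulnACA [g * _]mulnC; lia.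
rewrite -/(p 6); have := pos 6; lia.
Qed.

Lemma total_time_bound t1 t2 c1 c2 y : 0 < y -> t1 <= c1 * (16 * y) ->
  t2 <= c2 * (300 * y) -> t1 + (2 + (t2 + 2)) <= (c1 * 16 + c2 * 300 + 4) * y.
Proof. by rewrite !mulnDl -!mulnA; lia. Qed.

Lemma sum_le_max T (f : T -> nat) (s : seq T) :
  sumn (map f s) <= size s * \max_(x <- s) f x.
Proof.
elim: s => //= x s IH; rewrite big_cons mulSn leq_add ?leq_maxl //.
by rewrite (leq_trans IH) // leq_mul2l leq_maxr orbT.
Qed.

Lemma eq_stores (Sigma : finType) (M M' : nat -> nat) p (phi : ctl Sigma) :
  M =1 M' -> stores M p phi -> stores M' p phi.
Proof.
move=> e; elim: phi p => [[]|a|f IHf g IHg|f IHf|f IHf|f IHf g IHg|f IHf] p /=;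
  rewrite -?e.
- by [].
- by case=> -> /IHf sf /IHg sg.
- by case=> -> /IHf.
- by case=> -> /IHf.
- by case=> -> /IHf sf /IHg sg.
by case=> -> /IHf.
Qed.

Theorem theorem4p6 :
  exists (prog : com) (p : {poly nat}) (C : nat),
  forall (Sigma : finType) (P N : seq (kripke Sigma)) (Gr : grammar Sigma),
  let m := size P + size N in
  let n := \max_(K <- P ++ N) kripke_size K in
  exists (s : state) (t : nat),
    exec prog (init_state (enc_input P N Gr)) s t /\
    t <= C * 2 ^ p.[(m * n ^ 2)%N]%R * grammar_size Gr /\
    correct_output P N Gr s.
Proof.
pose C1 := max_cost (compile skip); pose C2 := max_cost (compile main).
(* The factor 6 is the exponent of [d] in both time bounds. Their constants 16 and 300 are converted
   to machine time, and 4 pays for the two register moves of [program]. *)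
exists program, ('X *+ 6)%R, (C1 * 16 + C2 * 300 + 4) => Sigma P N Gr m n.
set inp := enc_input P N Gr; set d := 2 ^ n_nodes (P ++ N).
have md : n_nodes (P ++ N) < d by apply: ltn_expl.
have g0 : 0 < grammar_size Gr by rewrite -sum_rule_size addn_gt0 nonterm_gt0.
have [s1 [t1 [run1 le1 [z1 eP1]]]] : runs inp skip (AState (fun=> 0) (fun _ _ => 0))
    (16 * (d ^ 6 * grammar_size Gr))
    (fun s' => (forall j x, ar s' j x = 0) /\ rg s' rP = size inp).
  apply: (fun h => runs_weaken h (skip_time_bound md g0) (fun _ _ q => q)).
  apply: runs_Then (runs_skip_structures P N Gr _) _ (leqnn _) => s' fr eP.
  apply: runs_weaken (runs_skip_grammar Gr eP) (leqnn _) _ => s'' fr' eP'; split=> // j x.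
  by rewrite (proj2 fr') // (proj2 fr).
have imp0 : implements inp 0 (AState (fun=> 0) (fun _ _ => 0)) (init_state inp).
  (* Beyond the input, the default 0 of [nth] agrees with the empty arrays. *)
  split=> // a; rewrite /amem /=; case: ltnP => // le; exact: nth_default.
have [s1' [t1' [run1' imp1 le1']]] := aexec_compile (x := false) run1 isT isT imp0.
have [s2 [t2 [run2 le2 out]]] := runs_main P N Gr z1.
have imp1' : implements inp (size inp) s1 (State (update (regs s1') 0 (size inp)) (memory s1')).
  by case: imp1 => _ er em; split.
have [s2' [t2' [run2' imp2 le2']]] :=
  aexec_compile (x := true) run2 isT (eqxx _ : true ==> (_ == _)) imp1'.
have eP1' : regs s1' rP.+1 = size inp by case: imp1 => _ ->.
exists (State (update (regs s2') 0 (regs s2' rRes.+1)) (memory s2')), (t1' + (2 + (t2' + 2))).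
split; last split.
- apply: exec_Seq run1' _; apply: exec_Seq (exec_Seq run2' (exec_Assign _ _ _)).
  by rewrite -[X in State (update _ _ X) _]eP1'; apply: exec_Assign.
(* The union of [m] structures has at most [m * n] nodes, and [n <= n ^ 2]. *)
- have lem : n_nodes (P ++ N) <= m * n ^ 2.
    have le_sq k : k <= k ^ 2 by case: k => // k; rewrite -mulnn leq_pmulr.
    by apply: leq_trans (sum_le_max _ _) _; rewrite size_cat leq_mul2l le_sq orbT.
  have -> : ('X *+ 6).[(m * n ^ 2)%N]%R = 6 * (m * n ^ 2).
    by rewrite hornerMn hornerX -GRing.mulr_natl.
  have ed : d ^ 6 <= 2 ^ (6 * (m * n ^ 2)).
    by rewrite /d -expnM mulnC leq_exp2l // leq_mul2l.
  have {}le2 := leq_trans le2 (main_time_bound P N Gr).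
  set X := 2 ^ _; apply: (@leq_trans ((C1 * 16 + C2 * 300 + 4) * (d ^ 6 * grammar_size Gr))).
    apply: total_time_bound; first by rewrite muln_gt0 g0 !expn_gt0.
      exact: leq_trans le1' (leq_mul (leqnn _) le1).
    exact: leq_trans le2' (leq_mul (leqnn _) le2).
  by rewrite mulnA leq_mul2r leq_mul2l ed !orbT.
rewrite /correct_output /=; have [_ er em] := imp2.
rewrite /update /= !er; case: out => [[-> [phi [sol st]]]|[-> no]]; [left|right] => //.
by split=> //; exists phi; split=> //; apply: eq_stores st => a; rewrite em.
Qed.
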